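(* Let $\alpha>0$, $C>0$, $\sigma>0$. Fix $\epsilon>0$ and consider nonlocal means (NLM) denoising $\hat f^{N}$ with $\delta_n=2\log^{\frac12+\epsilon}n$ and $t_n=\dfrac{2\sigma^2}{\log^{\epsilon/2}n}$. The risk of this algorithm over the class $H^{\alpha}(C)$ satisfies $$\sup_{f\in H^{\alpha}(C)}R_n(f,\hat f^{N})=O\!\left(\frac{\log^{\frac12+\epsilon}n}{n}\right)\qquad(n\to\infty).$$
   Context: Observation model: for $f$ and $n\ge1$, $\mathrm{Pixel}(i,j)=[\frac in,\frac{i+1}n)\times[\frac jn,\frac{j+1}n)$, $x_{i,j}$ is the average of $f$ over $\mathrm{Pixel}(i,j)$, and one observes $y_{i,j}=x_{i,j}+z_{i,j}$ with $z_{i,j}$ iid $N(0,\sigma^2)$. The image pixels are $S=\{1,\dots,n\}^2$; values at pixels outside $S$ that occur in neighborhoods of boundary pixels are given by the same formulas (with $f_h$ below extended to $\mathbb{R}^2$ by its defining formula). Risk: $R_n(f,\hat f)=\mathbb{E}\big(\frac1{n^2}\sum_i\sum_j (x_{i,j}-\hat f_{i,j})^2\big)$, sums over $S$. Horizon class: $\text{Hölder}^{\alpha}(C)$ is the set of functions $h:\mathbb{R}\to\mathbb{R}$ with $|h^{(k)}(t)-h^{(k)}(t')|\le C|t-t'|^{\alpha-k}$, $k=\lfloor\alpha\rfloor$; for $\alpha=1$ this is read as $|h(t)-h(t')|\le C|t-t'|$. For such $h$, $f_h(t_1,t_2)=\mathbf 1_{\{t_2<h(t_1)\}}$, and $H^{\alpha}(C)=\{f_h: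 h\in \text{Hölder}^{\alpha}(C)\cap\text{Hölder}^{1}(1)\}$. NLM: with window size $\delta_n$ (rounded to an integer) and $\rho_n^2=(2\delta_n+1)^2-1$, the $\delta_n$-neighborhood distance is $$d^2_{\delta_n}(y_{i,j},y_{q,p})=\frac1{\rho_n^2}\Big(\sum_{m=-\delta_n}^{\delta_n}\sum_{\ell=-\delta_n}^{\delta_n}|y_{i+\ell,j+m}-y_{q+\ell,p+m}|^2-|y_{i,j}-y_{q,p}|^2\Big).$$ With threshold parameter $t_n$, set $w^N_{i,j}(m,\ell)=1$ if $d^2_{\delta_n}(y_{i,j},y_{m,\ell})\le2\sigma^2+t_n$ and $0$ otherwise, and $$\hat f^{N}_{i,j}=\frac{\sum_{(m,\ell)\in S}w^N_{i,j}(m,\ell)\,y_{m,\ell}}{\sum_{(m,\ell)\in S}w^N_{i,j}(m,\ell)}.$$ $a(n)=O(b(n))$ means there are $c$ and $n_0$ with $|a(n)|\le c|b(n)|$ for all $n>n_0$; the constants may depend on $\epsilon$. *)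

(* Defs.v *)
From HB Require Import structures.
From mathcomp Require Import all_boot all_order all_algebra.
From mathcomp Require Import all_classical all_reals all_analysis.
Import Order.TTheory GRing.Theory Num.Theory.
Import numFieldNormedType.Exports.

Set Implicit Arguments.
Unset Strict Implicit.
Unset Printing Implicit Defensive.

Local Open Scope classical_set_scope.
Local Open Scope ring_scope.

Section horizon_class.
Context {R : realType}.

(* The order of the derivative is the integer part of alpha, except that
   alpha = 1 denotes the Lipschitz condition on h itself. *)
Definition holder_order (alpha : R) : nat :=
  if alpha == 1 then 0%N else Num.truncn alpha.

Definition holder (alpha C : R) : set (R -> R) :=
  [set h | (forall (j : nat) (t : R), (j < holder_order alpha)%N ->
              derivable (derive1n j h) t 1)
         /\ (forall t t' : R,
              `|derive1n (holder_order alpha) h t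
                - derive1n (holder_order alpha) h t'|
              <= C * `|t - t'| `^ (alpha - (holder_order alpha)%:R))].

Definition horizon (h : R -> R) : R * R -> R :=
  fun t => if t.2 < h t.1 then 1 else 0.

Definition horizon_class (alpha C : R) : set (R * R -> R) :=
  horizon @` (holder alpha C `&` holder 1 1).

End horizon_class.

Section observation_model.
Context {R : realType}.

(* Images are indexed by all of int * int: neighborhoods of boundary pixels
   leave the index range {1, .., n} ^ 2. *)
Definition pixel_array := int -> int -> R.

Definition pixel (n : nat) (i j : int) : set (R * R) :=
  `[i%:~R / n%:R, (i + 1)%:~R / n%:R[%classic `*`
  `[j%:~R / n%:R, (j + 1)%:~R / n%:R[%classic.

Definition pixel_average (f : R * R -> R) (n : nat) : pixel_array := fun i j =>
  (fine ((lebesgue_measure \x lebesgue_measure)%E (pixel n i j)))^-1 *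
  \int[(lebesgue_measure \x lebesgue_measure)%E]_(t in pixel n i j) f t.

Context d (T : measurableType d) (P : probability T R).

Definition mutually_independent (I : choiceType) (X : I -> {RV P >-> R}) : Prop :=
  forall (s : seq I) (B : I -> set R), uniq s -> (forall i, measurable (B i)) ->
    P (\bigcap_(i in [set` s]) (X i @^-1` B i)) =
    (\prod_(i <- s) P (X i @^-1` B i))%E.

(* The second parameter of normal_prob is the standard deviation. *)
Definition iid_gaussian (sigma : R) (z : int * int -> {RV P >-> R}) : Prop :=
  mutually_independent z /\
  forall (p : int * int) (B : set R), measurable B ->
    distribution P (z p) B = normal_prob 0 sigma B.

Definition observation (z : int * int -> {RV P >-> R}) (f : R * R -> R)
    (n : nat) (w : T) : pixel_array :=
  fun i j => pixel_average f n i j + z (i, j) w.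

Definition risk (z : int * int -> {RV P >-> R}) (n : nat)
    (f : R * R -> R) (fhat : pixel_array -> pixel_array) : \bar R :=
  ('E_P[fun w => ((n%:R ^+ 2)^-1 *
     \sum_(1 <= i < n.+1) \sum_(1 <= j < n.+1)
       (pixel_average f n i j - fhat (observation z f n w) i j) ^+ 2)%R])%E.

End observation_model.
Arguments pixel_array : clear implicits.

Section nonlocal_means.
Context {R : realType}.

Definition neighborhood_distance2 (delta : nat) (y : pixel_array R)
    (i j q p : int) : R :=
  (((2 * delta + 1) ^ 2)%N%:R - 1)^-1 *
  (\sum_(m < (2 * delta).+1) \sum_(l < (2 * delta).+1)
     `|y (i + (l%:Z - delta%:Z)) (j + (m%:Z - delta%:Z))
       - y (q + (l%:Z - delta%:Z)) (p + (m%:Z - delta%:Z))| ^+ 2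
   - `|y i j - y q p| ^+ 2).

Definition nlm_weight (sigma : R) (delta : nat) (t : R) (y : pixel_array R)
    (i j m l : int) : R :=
  if neighborhood_distance2 delta y i j m l <= 2 * sigma ^+ 2 + t
  then 1 else 0.

Definition nlm (sigma : R) (n delta : nat) (t : R) (y : pixel_array R) : pixel_array R :=
  fun i j =>
    (\sum_(1 <= m < n.+1) \sum_(1 <= l < n.+1)
        nlm_weight sigma delta t y i j m l * y m l) /
    (\sum_(1 <= m < n.+1) \sum_(1 <= l < n.+1)
        nlm_weight sigma delta t y i j m l).

End nonlocal_means.

(* k is x rounded to an integer, with any of the usual rounding modes. *)
Definition is_rounding {R : realType} (x : R) (k : nat) : Prop :=
  `|k%:R - x| < 1.

Definition bigO_seq {R : realType} (a : nat -> \bar R) (b : nat -> R) : Prop :=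
  exists (c : R) (n0 : nat), forall n : nat, (n0 < n)%N ->
    (`|a n| <= (c * `|b n|)%:E)%E.

(* Main.v *)
Require Import Defs.
From HB Require Import structures.
From mathcomp Require Import all_boot all_order all_algebra.
From mathcomp Require Import all_classical all_reals all_analysis.
From mathcomp Require Import measurable_realfun zify ring lra.
Import Order.TTheory GRing.Theory Num.Theory.
Import numFieldNormedType.Exports.

Set Implicit Arguments.
Unset Strict Implicit.
Unset Printing Implicit Defensive.

Local Open Scope classical_set_scope.
Local Open Scope ring_scope.

(* Fix a pixel i.  The horizon is 1-Lipschitz, so all pixels within distance
   k ~ t delta of i have a patch close to that of i; hence with overwhelming
   probability the number N of selected pixels is at least W = (k+1)^2, where
   K/W = O(log^epsilon n) for a patch of K pixels.
   The first point is that E[sum_v w_v z_v^2 / N] = O(1), although the weights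
   depend on the noise.  Resampling a single z_v changes the squared patch
   distances by O(B) once the noise is bounded by B on the patches, so one may
   decouple w_v / N from z_v at the price of comparing the numbers of pixels
   selected with the thresholds T + O(B) and T - O(B).  Their ratio is O(1) in
   expectation: multiplying the noise on the patch of i by 1 + jq, j < J, moves
   all the distances by more than the gap between the two thresholds while it
   keeps the law of the noise comparable, so that the J ratios telescope.
   The error is thus O(1) at the O(n delta) pixels near the horizon.  The patch
   of any other pixel lies on one side of the horizon; with overwhelming
   probability all pixels of its side and none of the other side are selected,
   so the noise averages out, except for the influence of the O(n delta) pixels
   near the horizon.  Altogether the error summed over the image is O(n delta). *)

(** * Product laws and resampling *)

(** The bound B on the squared noise cannot be of order log n, which is what bounding the noise on
    the whole image would take. To cross the gap between the thresholds the dilations need steps q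
    of order B/K, and about J = K/W of them. As the norm of the noise on a patch concentrates, the
    first-order change of the log-density cancels, and K(Jq)^2, of order J^2 B^2/K, remains. With K
    of order log^(1+2 epsilon) n and J of order log^epsilon n this is bounded only for B =
    O(log^(1/2) n); the choice is B = log^(1/4) n. Noise beyond B then has a probability smaller
    than every power of 1/log n, but not of 1/n. So truncation may be used only locally, where
    polylogarithmic factors have to be beaten, and large noise at distant pixels is handled by exact
    independence instead. Failures of concentration of the patch distances cost only exp(-c t^2 K),
    with t^2 K of order log^(1+epsilon) n; they absorb any power of n, so that union bounds over the
    whole image are allowed for them. *)

Definition cylinder (R : realType) (I : choiceType) : set (set (I -> R)) :=
  [set A | exists (s : seq I) (B : I -> set R), [/\ uniq s,
     forall i, measurable (B i) &
     A = \bigcap_(i in [set` s]) ((fun z => z i) @^-1` B i)]].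

(** The product sigma-algebra over an arbitrary index type: pixels range over the infinite set
    [int * int], and the cylinders over finitely many coordinates form a generating pi-system. *)
Definition noise_space (R : realType) (I : choiceType) : Type :=
  g_sigma_algebraType (@cylinder R I).
HB.instance Definition _ R I := Measurable.on (noise_space R I).

Section function_space.
Context {R : realType} {I : choiceType}.
Local Notation noise_space := (noise_space R I).
Local Notation cylinder := (@cylinder R I).

Definition upd (z : I -> R) (v : I) (x : R) : I -> R :=
  fun i => if i == v then x else z i.

Lemma upd_same z v x : upd z v x v = x.
Proof. by rewrite /upd eqxx. Qed.

Lemma upd_other z v x i : i != v -> upd z v x i = z i.
Proof. by rewrite /upd => /negbTE ->. Qed.

Lemma measurable_coord (i : I) :
  measurable_fun setT (fun z : noise_space => z i).
Proof.
move=> _ B mB; rewrite setTI; apply: sub_sigma_algebra.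
exists [:: i], (fun=> B); split => //.
by apply/seteqP; split=> z /=; [move=> zB j; rewrite /= inE => /eqP -> //|
  apply; rewrite /= inE].
Qed.

Lemma measurable_to_noise_space d (T : measurableType d) (f : T -> noise_space) :
  (forall i, measurable_fun setT (fun w => f w i)) -> measurable_fun setT f.
Proof.
move=> mf; apply: (@measurability _ _ _ noise_space setT f cylinder) => //.
move=> _ [_ [s [B [us mB ->]]] <-].
rewrite preimage_bigcap setTI.
apply: fin_bigcap_measurable => // i _.
by have := mf i measurableT _ (mB i); rewrite setTI.
Qed.

Lemma setI_closed_cylinder : setI_closed cylinder.
Proof.
move=> _ _ [s [B [us mB ->]]] [s' [B' [us' mB' ->]]].
exists (undup (s ++ s')), (fun i => (if i \in s then B i else setT) `&`
  (if i \in s' then B' i else setT)); split; first exact: undup_uniq.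
  by move=> i; apply: measurableI; case: ifP.
apply/seteqP; split=> z /=.
  by move=> [H H'] i /= _; split; case: ifP => // ?; [apply: H|apply: H'].
move=> H; split=> i /= si.
  by have := H i; rewrite /= mem_undup mem_cat si => /(_ erefl)[].
by have := H i; rewrite /= mem_undup mem_cat si orbT => /(_ erefl)[].
Qed.

Lemma cylinder_setT : cylinder setT.
Proof.
exists [::], (fun=> setT); split => //.
by apply/seteqP; split => z //= _ i.
Qed.

Lemma measurable_upd (v : I) : measurable_fun setT
  (fun p : noise_space * measurableTypeR R => upd p.1 v p.2 : noise_space).
Proof.
apply: measurable_to_noise_space => i; rewrite /upd.
case: eqP => _; first exact: measurable_snd.
by apply: (measurableT_comp (measurable_coord i)); exact: measurable_fst.
Qed.

End function_space.

Section resampling.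
Context {R : realType} {I : choiceType}.
Variable (g : probability (measurableTypeR R) R).

(* [Q] is the law of a family of independent variables of law [g], expressed as
   invariance under the resampling of any coordinate. *)
Definition resamplable (Q : probability (noise_space R I) R) : Prop :=
  forall (v : I) (F : noise_space R I -> \bar R), measurable_fun setT F ->
    (forall z, (0 <= F z)%E) ->
    (\int[Q]_z F z = \int[Q]_z \int[g]_x F (upd z v x))%E.

(** [Q] and the image of [Q \x g] under the update of the coordinate [v] agree on cylinders, hence
    on all measurable sets; Tonelli's theorem turns this into the resampling identity. Passing to
    the canonical space [I -> R] makes it possible to change a single coordinate, for which the
    original sample space has no operation. *)
Lemma resamplable_law d (T : measurableType d) (P : probability T R)
    (z : I -> {RV P >-> R}) :
  mutually_independent z ->
  (forall p B, measurable B -> distribution P (z p) B = g B) ->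
  exists2 Q : probability (noise_space R I) R, resamplable Q &
    forall F : noise_space R I -> \bar R, measurable_fun setT F ->
      (forall z, (0 <= F z)%E) ->
      (\int[P]_w F (fun i => z i w) = \int[Q]_z F z)%E.
Proof.
move=> indep law.
have mZ : measurable_fun setT (fun w => (fun i => z i w) : noise_space R I).
  by apply: measurable_to_noise_space => i; exact: measurable_funP.
pose Z : {mfun T >-> noise_space R I} := mfun_Sub (mem_set mZ).
pose Q : probability (noise_space R I) R := distribution P Z.
have QE (s : seq I) (B : I -> set R) : uniq s -> (forall i, measurable (B i)) ->
  Q (\bigcap_(i in [set` s]) ((fun z => z i) @^-1` B i)) =
  (\prod_(i <- s) g (B i))%E.
  move=> us mB.
  have -> : Q (\bigcap_(i in [set` s]) ((fun z => z i) @^-1` B i)) =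
    P (\bigcap_(i in [set` s]) (z i @^-1` B i)) by [].
  by rewrite indep //; apply: eq_bigr => i _; exact: law.
exists Q; last first.
  move=> F mF F0; rewrite /Q ge0_integral_distribution //.
move=> v F mF F0.
have mU := @measurable_upd R I v.
pose U : {mfun (noise_space R I * measurableTypeR R)%type >-> noise_space R I} :=
  mfun_Sub (mem_set mU).
have sameQ (A : set (noise_space R I)) : measurable A ->
   Q A = pushforward (Q \x g)%E U A.
  move=> mA.
  apply: (@g_sigma_algebra_measure_unique _ R (noise_space R I) (@cylinder R I) _
    (fun=> setT) _ _ Q (pushforward (Q \x g)%E U)).
  - by move=> B; exact: sub_sigma_algebra.
  - by move=> _; exact: cylinder_setT.
  - by apply/seteqP; split => // x _; exists 0%N.
  - exact: setI_closed_cylinder.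
  - move=> _ [s [B [us mB ->]]].
    etransitivity; first exact: (QE s B us mB).
    rewrite /pushforward.
    (* The update lifts the constraint at [v] from the cylinder and transfers it to the new
       variable. *)
    pose B' i := if i == v then setT else B i.
    have mB' i : measurable (B' i) by rewrite /B'; case: ifP.
    have UE : U @^-1` (\bigcap_(i in [set` s]) ((fun z => z i) @^-1` B i)) =
        (\bigcap_(i in [set` s]) ((fun z => z i) @^-1` B' i)) `*`
        (if v \in s then B v else setT).
      apply/seteqP; split => [[y x] /= H|[y x] /= [H1 H2] i /= si].
        split.
          move=> i /= si; rewrite /B'; case: eqP => // /eqP iv.
          by have := H i si; rewrite /= upd_other.
        case: ifP => // vs; have := H v vs; by rewrite /= upd_same.
      have := H1 i si; rewrite /B' /upd; case: eqP => // iv _.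
      by move: H2; rewrite -iv si.
    apply: (etrans _ (congr1 (Q \x g)%E (esym UE))).
    rewrite product_measure1E; last 2 first.
    + by apply: fin_bigcap_measurable => // i _; rewrite -[X in measurable X]setTI;
        exact: measurable_coord.
    + by case: ifP => _; [exact: mB|exact: measurableT].
    apply: (etrans _ (congr1 (fun x => x * _)%E (esym (QE s B' us mB')))).
    have gT : g [set: R] = 1%E by exact: probability_setT.
    case: ifP => vs.
      rewrite (bigD1_seq v) //= [in RHS](bigD1_seq v) //= /B' eqxx [X in (_ = X * _ * _)%E]gT.
      rewrite mul1e muleC; congr (_ * _)%E; apply: eq_bigr => i /negbTE -> //.
    rewrite [X in (_ * X)%E]gT mule1; apply: eq_big_seq => i si.
    by rewrite /B'; case: eqP => // iv; move: vs; rewrite -iv si.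
  - by move=> _; rewrite /= probability_setT ltry.
  - exact: mA.
rewrite (eq_measure_integral (pushforward (Q \x g)%E U)); last first.
  by move=> A mA _; exact: sameQ.
rewrite ge0_integral_pushforward //.
rewrite preimage_setT fubini_tonelli1 //.
- by apply: measurableT_comp.
- by move=> x; exact: F0.
Qed.

End resampling.

(** * Gaussian integrals *)

Lemma complete_square (F : realFieldType) (p x r v : F) :
  v != 0 -> 1 - 2 * p * v != 0 ->
  p * x ^+ 2 + r * x + - x ^+ 2 / (v *+ 2) =
  r ^+ 2 * v / (2 * (1 - 2 * p * v)) +
  - (x - r * (v / (1 - 2 * p * v))) ^+ 2 / (v / (1 - 2 * p * v) *+ 2).
Proof. by move=> v0 D0; field; rewrite D0 v0. Qed.

Section gaussian.
Context {R : realType}.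
Variable (sigma : R).
Hypothesis sigma_gt0 : 0 < sigma.
Local Notation mu := lebesgue_measure.
Local Notation gam := (normal_prob 0 sigma).

Lemma ge0_integral_normal_prob (m s : R) (f : R -> \bar R) :
  measurable_fun setT f -> (forall x, (0 <= f x)%E) ->
  (\int[normal_prob m s]_x f x = \int[mu]_x (f x * (normal_pdf m s x)%:E))%E.
Proof.
move=> mf f0.
have dom := normal_prob_dominates m s.
rewrite -(Radon_Nikodym_SigmaFinite.change_of_variables dom f0) //.
apply: ge0_ae_eq_integral => //.
- apply: emeasurable_funM => //; apply: (measurable_int mu).
  exact: Radon_Nikodym_SigmaFinite.f_integrable.
- apply: emeasurable_funM => //; apply/measurable_EFinP; exact: measurable_normal_pdf.
- by move=> x _; rewrite mule_ge0 // Radon_Nikodym_SigmaFinite.f_ge0.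
- by move=> x _; rewrite mule_ge0 // lee_fin normal_pdf_ge0.
- apply: ae_eqe_mul2l; apply: integral_ae_eq => //.
  + exact: Radon_Nikodym_SigmaFinite.f_integrable.
  + by apply/measurable_EFinP; exact: measurable_normal_pdf.
  + by move=> E _ mE; rewrite -Radon_Nikodym_SigmaFinite.f_integral.
Qed.

(** Tilting a normal density by the exponential of a quadratic gives a multiple of another normal
    density, so the value is read off from the normalisation. *)
Lemma integral_normal_exp_quadratic (p r : R) : 2 * p * sigma ^+ 2 < 1 ->
  (\int[gam]_x (expR (p * x ^+ 2 + r * x))%:E =
   ((Num.sqrt (1 - 2 * p * sigma ^+ 2))^-1 *
    expR (r ^+ 2 * sigma ^+ 2 / (2 * (1 - 2 * p * sigma ^+ 2))))%:E)%E.
Proof.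
move=> hp; pose D : R := 1 - 2 * p * sigma ^+ 2; rewrite -/D.
have D0 : 0 < D by rewrite subr_gt0.
have mq : measurable_fun setT (fun x : R => expR (p * x ^+ 2 + r * x)).
  apply: (measurableT_comp (@measurable_expR R)).
  by apply: measurable_funD; apply: measurable_funM => //; apply: measurable_funX.
rewrite ge0_integral_normal_prob; last 2 first.
- exact/measurable_EFinP.
- by move=> x; rewrite lee_fin expR_ge0.
(* Standard deviation and mean of the tilted normal law. *)
pose s := sigma / Num.sqrt D; pose m := r * s ^+ 2.
have sD0 : 0 < Num.sqrt D by rewrite sqrtr_gt0.
have s0 : 0 < s by rewrite divr_gt0.
have s2 : s ^+ 2 = sigma ^+ 2 / D by rewrite expr_div_n sqr_sqrtr // ltW.
have sgn0 : sigma != 0 by rewrite gt_eqF.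
have sn0 : s != 0 by rewrite gt_eqF.
have alg (a b c e k q : R) : q != 0 -> a * b = c * e ->
    a * (k^-1 * b) = (q^-1 * c) * ((k / q)^-1 * e).
  move=> q0 h; rewrite mulrCA h invf_div.
  rewrite [RHS](_ : _ = (q^-1 * q) * (k^-1 * (c * e))); last by ring.
  by rewrite mulVf // mul1r.
transitivity (\int[mu]_x (((Num.sqrt D)^-1 *
    expR (r ^+ 2 * sigma ^+ 2 / (2 * D)))%:E * (normal_pdf m s x)%:E))%E.
  apply: eq_integral => x _; rewrite -!EFinM; congr EFin.
  rewrite !normal_pdfE //= /normal_peak /normal_fun subr0 s2.
  have -> : sigma ^+ 2 / D * pi *+ 2 = (sigma ^+ 2 * pi *+ 2) * D^-1.
    by rewrite -!mulrnAr mulrAC.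
  rewrite sqrtrM; last by rewrite mulrn_wge0 // mulr_ge0 ?pi_ge0 ?sqr_ge0.
  rewrite sqrtrV ?ltW //; apply: alg; rewrite ?gt_eqF // -!expRD; congr expR.
  rewrite /m s2; apply: complete_square; rewrite ?expf_neq0 //.
  by rewrite gt_eqF.
rewrite ge0_integralZl_EFin //.
- by rewrite integral_normal_pdf mule1.
- by move=> x _; rewrite lee_fin normal_pdf_ge0.
- by apply/measurable_EFinP; exact: measurable_normal_pdf.
Qed.

Lemma lebesgue_measure_scale (l : R) (A : set R) : 0 < l -> measurable A ->
  (l%:E * mu ((fun x => (l * x)%R) @^-1` A) = mu A)%E.
Proof.
move=> l0 mA.
have ml : measurable_fun setT (fun x : measurableTypeR R => (l * x)%R : measurableTypeR R).
  exact: measurable_funM.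
pose f (x : measurableTypeR R) : measurableTypeR R := l * x.
pose pf : {measure set (measurableTypeR R) -> \bar R} := pushforward mu f.
pose m : {measure set (measurableTypeR R) -> \bar R} := mscale (NngNum (ltW l0)) (pf ml).
have mE B : m B = (l%:E * mu (f @^-1` B))%E by [].
suff H : mu A = m A by rewrite H mE.
apply: (@lebesgue_measure_unique R m) => // _ [[a b]] _ <-; rewrite mE.
have -> : f @^-1` `]a, b]%classic = `](a / l), (b / l)]%classic.
  apply/seteqP; split => x /=; rewrite !in_itv /= /f /=;
  by rewrite ler_pdivlMr // ltr_pdivrMr // mulrC.
rewrite !lebesgue_measure_itv /= !lte_fin ltr_pM2r ?invr_gt0 //.
case: ifP => _; last by rewrite mule0.
by rewrite -!EFinD -EFinM; congr EFin; field; rewrite gt_eqF.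
Qed.

Lemma ge0_integral_scale (l : R) (f : R -> \bar R) : 0 < l ->
  measurable_fun setT f -> (forall x, (0 <= f x)%E) ->
  (\int[mu]_x f x = l%:E * \int[mu]_x f (l * x)%R)%E.
Proof.
move=> l0 mf f0.
have ml : measurable_fun setT (fun x : measurableTypeR R => (l * x)%R : measurableTypeR R).
  exact: measurable_funM.
pose h (x : measurableTypeR R) : measurableTypeR R := l * x.
pose pf : {measure set (measurableTypeR R) -> \bar R} := pushforward mu h.
pose m : {measure set (measurableTypeR R) -> \bar R} := mscale (NngNum (ltW l0)) (pf ml).
rewrite (eq_measure_integral m); last first.
  by move=> A mA _; apply: esym; exact: (lebesgue_measure_scale l0 mA).
rewrite ge0_integral_mscale //; congr (_ * _)%E.
by rewrite ge0_integral_pushforward.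
Qed.

(** The factor on the right is the Jacobian [l] times the ratio of the normal densities at [l * x]
    and at [x]. *)
Lemma normal_prob_scale (l : R) (f : R -> \bar R) : 0 < l ->
  measurable_fun setT f -> (forall x, (0 <= f x)%E) ->
  (\int[gam]_x f x = \int[gam]_x (f (l * x)%R *
     (l * expR (- (l ^+ 2 - 1) * x ^+ 2 / (2 * sigma ^+ 2)))%:E))%E.
Proof.
move=> l0 mf f0.
have mfl : measurable_fun setT (fun x : R => f (l * x)%R).
  by apply: (measurableT_comp mf); exact: measurable_funM.
have me : measurable_fun setT (fun x : R =>
   l * expR (- (l ^+ 2 - 1) * x ^+ 2 / (2 * sigma ^+ 2))).
  apply: measurable_funM => //; apply: (measurableT_comp (@measurable_expR R)).
  by apply: measurable_funM => //; apply: measurable_funM => //; apply: measurable_funX.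
have e0 x : (0 <= (l * expR (- (l ^+ 2 - 1) * x ^+ 2 / (2 * sigma ^+ 2)))%:E)%E.
  by rewrite lee_fin mulr_ge0 ?expR_ge0 // ltW.
rewrite !ge0_integral_normal_prob //; last 2 first.
- by apply: emeasurable_funM => //; apply/measurable_EFinP.
- by move=> x; rewrite mule_ge0.
rewrite (ge0_integral_scale l0) //; last 2 first.
- by apply: emeasurable_funM => //; apply/measurable_EFinP; exact: measurable_normal_pdf.
- by move=> x; rewrite mule_ge0 // lee_fin normal_pdf_ge0.
rewrite -ge0_integralZl_EFin //; last 3 first.
- by move=> x _; rewrite mule_ge0 // lee_fin normal_pdf_ge0.
- apply: emeasurable_funM => //; apply/measurable_EFinP.
  apply: (measurableT_comp (measurable_normal_pdf 0 sigma)); exact: measurable_funM.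
- exact: ltW.
apply: eq_integral => x _.
rewrite muleCA -muleA; congr (_ * _)%E; rewrite -!EFinM; congr EFin.
have sgn0 : sigma != 0 by rewrite gt_eqF.
rewrite !normal_pdfE //= /normal_fun !subr0 -[RHS]mulrA; congr (_ * _).
rewrite [RHS]mulrCA; congr (_ * _); rewrite -expRD; congr expR.
have v0 : sigma ^+ 2 != 0 by rewrite expf_neq0.
by move: (sigma ^+ 2) v0 => v v0; field.
Qed.

End gaussian.

(** * Expectation bounds *)

Section measurability.
Context {R : realType} d (T : measurableType d).

Lemma measurable_invr (f : T -> R) : measurable_fun setT f ->
  (forall x, 0 <= f x) -> measurable_fun setT (fun x => (f x)^-1).
Proof.
move=> mf f0; rewrite [X in measurable_fun _ X](_ : _ = (fun x => f x `^ (-1))).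
  exact: (measurableT_comp (@measurable_powR R (-1)) mf).
apply/funext => x; have [fx|fx] := eqVneq (f x) 0.
  by rewrite fx invr0 powR0 // oppr_eq0 oner_eq0.
by rewrite powR_inv1 // ?f0.
Qed.

Lemma measurable_natr (b : T -> bool) : measurable_fun setT b ->
  measurable_fun setT (fun x => (b x)%:R : R).
Proof.
move=> mb; rewrite [X in measurable_fun _ X](_ : _ =
  (fun x => if b x then 1 else 0 : R)); last by apply/funext => x; case: (b x).
exact: measurable_fun_ifT.
Qed.

Lemma measurable_sum_seq (J : eqType) (s : seq J) (h : J -> T -> R) :
  (forall j, j \in s -> measurable_fun setT (h j)) ->
  measurable_fun setT (fun x => \sum_(j <- s) h j x).
Proof.
move=> mh; rewrite (_ : (fun x => _) = (fun x => \sum_(j <- s) (if j \in s then h j x else 0))).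
  by apply: measurable_sum => j; case js: (j \in s); [exact: mh|exact: measurable_cst].
by apply/funext => x; apply: eq_big_seq => j ->.
Qed.

End measurability.

Section expectation_bound.
Context {R : realType} d (T : measurableType d) (Q : probability T R).

Implicit Types (F G : T -> R) (a b c k : R).

(** Measurability and nonnegativity are packed with the bound so that bounds combine without side
    conditions; applied to the indicator of an event it bounds a probability. *)
Definition ebound (F : T -> R) (c : R) : Prop :=
  [/\ measurable_fun setT F, forall z, 0 <= F z &
      (\int[Q]_z (F z)%:E <= c%:E)%E].

Lemma ebound_le F G c : measurable_fun setT F -> (forall z, 0 <= F z) ->
  (forall z, F z <= G z) -> ebound G c -> ebound F c.
Proof.
move=> mF F0 FG [mG G0 Gc]; split => //; apply: le_trans Gc.
apply: ge0_le_integral => //; try exact/measurable_EFinP.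
- by move=> z _; rewrite lee_fin.
- by move=> z _; rewrite lee_fin.
Qed.

Lemma ebound_weaken F a b : a <= b -> ebound F a -> ebound F b.
Proof. by move=> ab [? ? Fa]; split => //; apply: (le_trans Fa); rewrite lee_fin. Qed.

Lemma ebound_cst c : 0 <= c -> ebound (fun=> c) c.
Proof.
move=> c0; split => //.
have -> : (\int[Q]_z c%:E = \int[Q]_(z in setT) cst c%:E z)%E by [].
by rewrite integral_cst // [X in (_ * X)%E]probability_setT mule1.
Qed.

Lemma ebound_add F G a b : ebound F a -> ebound G b ->
  ebound (fun z => F z + G z) (a + b).
Proof.
move=> [mF F0 Fa] [mG G0 Gb]; split.
- exact: measurable_funD.
- by move=> z; rewrite addr_ge0.
- under eq_integral do rewrite EFinD.
  rewrite ge0_integralD //; [by rewrite EFinD leeD|..]; try exact/measurable_EFinP;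
  by move=> z _; rewrite lee_fin.
Qed.

Lemma ebound_scale k F a : 0 <= k -> ebound F a ->
  ebound (fun z => k * F z) (k * a).
Proof.
move=> k0 [mF F0 Fa]; split.
- exact: measurable_funM.
- by move=> z; rewrite mulr_ge0.
- under eq_integral do rewrite EFinM.
  rewrite ge0_integralZl_EFin //; [by rewrite EFinM lee_wpmul2l|
    by move=> z _; rewrite lee_fin|exact/measurable_EFinP].
Qed.

Lemma ebound_sum (I : eqType) (s : seq I) (F : I -> T -> R) (c : I -> R) :
  (forall i, i \in s -> ebound (F i) (c i)) ->
  ebound (fun z => \sum_(i <- s) F i z) (\sum_(i <- s) c i).
Proof.
elim: s => [_|i s IH H].
  rewrite big_nil; under [X in ebound X _]funext => z do rewrite big_nil.
  exact: ebound_cst.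
rewrite big_cons; under [X in ebound X _]funext => z do rewrite big_cons.
apply: ebound_add; first by apply: H; rewrite mem_head.
by apply: IH => j js; apply: H; rewrite inE js orbT.
Qed.

Lemma ebound_sum_cst (I : eqType) (s : seq I) (F : I -> T -> R) (c : R) :
  (forall i, i \in s -> ebound (F i) c) ->
  ebound (fun z => \sum_(i <- s) F i z) ((size s)%:R * c).
Proof.
move=> H; have := ebound_sum H.
by rewrite big_const_seq count_predT iter_addr_0 mulr_natl.
Qed.

Lemma ebound_ge0 F c : ebound F c -> 0 <= c.
Proof.
move=> [_ F0 Fc]; rewrite -lee_fin; apply: le_trans Fc.
by apply: integral_ge0 => z _; rewrite lee_fin.
Qed.

Lemma ebound_markov (b1 : T -> bool) G c L : measurable_fun setT b1 ->
  0 < L -> (forall z, b1 z -> L <= G z) -> ebound G c ->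
  ebound (fun z => (b1 z)%:R) (L^-1 * c).
Proof.
move=> mb L0 bG hG.
have L0' : 0 <= L^-1 by rewrite invr_ge0 ltW.
apply: ebound_le (ebound_scale L0' hG) => [|z|z] //; first exact: measurable_natr.
case bz : (b1 z) => /=; first by rewrite ler_pdivlMl // mulr1 bG.
by case: hG => _ G0 _; rewrite mulr_ge0.
Qed.

End expectation_bound.

Section independence.
Context {R : realType} {I : choiceType}.
Variables (g : probability (measurableTypeR R) R).
Variables (Q : probability (noise_space R I) R).
Hypothesis hQ : resamplable g Q.

Lemma measurable_upd1 (F : noise_space R I -> \bar R) v z :
  measurable_fun setT F -> measurable_fun setT (fun x : measurableTypeR R => F (upd z v x)).
Proof.
move=> mF; apply: (measurableT_comp mF); apply: measurable_to_noise_space => i.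
rewrite /upd; case: eqP => _; [exact: measurable_id|exact: measurable_cst].
Qed.

Lemma measurable_resample (F : noise_space R I -> \bar R) v :
  measurable_fun setT F -> (forall z, (0 <= F z)%E) ->
  measurable_fun setT (fun z : noise_space R I => \int[g]_x F (upd z v x))%E.
Proof.
move=> mF F0.
apply: (@measurable_fun_fubini_tonelli_F _ _ (noise_space R I) (measurableTypeR R)
  R g (fun p => F (upd p.1 v p.2))) => //.
apply: (measurableT_comp mF); exact: measurable_upd.
Qed.

(** With the other coordinates fixed, averaging [X <= Y] over [x'] in [A'] bounds [X] at every [x]
    in [A] by [p^-1] times the mean of [Y] over the coordinate [v]. That bound no longer depends on
    [x], so [f] is integrated separately although [X] depends on [z v]. *)
Lemma le_integral_decouple (v : I) (X Y : noise_space R I -> R) (f : R -> R)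
    (A A' : R -> bool) (cg p : R) :
  measurable_fun setT Y -> (forall z, 0 <= Y z) ->
  measurable_fun setT X -> (forall z, 0 <= X z) ->
  measurable_fun setT f -> (forall x, 0 <= f x) ->
  measurable_fun setT A -> measurable_fun setT A' ->
  (forall z x x', A x -> A' x' -> X (upd z v x) <= Y (upd z v x')) ->
  (\int[g]_x (f x * (A x)%:R)%:E <= cg%:E)%E ->
  0 < p -> (p%:E <= \int[g]_x ((A' x)%:R)%:E)%E ->
  (\int[Q]_z (X z * (f (z v) * (A (z v))%:R))%:E <= (cg / p)%:E * \int[Q]_z (Y z)%:E)%E.
Proof.
move=> mY Y0 mX X0 mf f0 mA mA' XY hcg p0 hp.
have mfA : measurable_fun setT (fun x : R => f x * (A x)%:R).
  by apply: measurable_funM => //; exact: measurable_natr.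
have mA'r : measurable_fun setT (fun x : R => (A' x)%:R : R) by exact: measurable_natr.
have mXfA : measurable_fun setT (fun z : noise_space R I => X z * (f (z v) * (A (z v))%:R)).
  by apply: measurable_funM => //; apply: (measurableT_comp mfA); exact: measurable_coord.
have XfA0 z : 0 <= X z * (f (z v) * (A (z v))%:R) by rewrite !mulr_ge0.
rewrite (hQ v) //; last exact/measurable_EFinP.
have key z : (\int[g]_x (X (upd z v x) * (f (upd z v x v) * (A (upd z v x v))%:R))%:E
    <= (cg / p)%:E * \int[g]_x (Y (upd z v x))%:E)%E.
  have mYz : measurable_fun setT (fun x : measurableTypeR R => (Y (upd z v x))%:E).
    by apply: (@measurable_upd1 (EFin \o Y)); exact/measurable_EFinP.
  set J := (\int[g]_x (Y (upd z v x))%:E)%E.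
  have J0 : (0 <= J)%E by apply: integral_ge0 => x _; rewrite lee_fin.
  have XJ x : A x -> ((X (upd z v x))%:E <= p^-1%:E * J)%E.
    move=> Ax; rewrite lee_pdivlMl //.
    apply: (@le_trans _ _ ((X (upd z v x))%:E * \int[g]_x' ((A' x')%:R)%:E)%E).
      by rewrite muleC lee_wpmul2l // lee_fin.
    rewrite -ge0_integralZl_EFin //; last exact/measurable_EFinP.
    apply: ge0_le_integral => //.
    - by move=> x' _; rewrite -EFinM lee_fin mulr_ge0.
    - by apply: measurable_funeM; exact/measurable_EFinP.
    - move=> x' _; rewrite -EFinM lee_fin.
      by case A'x' : (A' x'); rewrite ?mulr1 ?mulr0 ?Y0 // XY.
  apply: (@le_trans _ _ (\int[g]_x ((p^-1%:E * J) * (f x * (A x)%:R)%:E))%E).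
    apply: ge0_le_integral => //.
    - by move=> x _; rewrite lee_fin.
    - apply: (@measurable_upd1 (fun z => (X z * (f (z v) * (A (z v))%:R))%:E)).
      exact/measurable_EFinP.
    - by apply: measurable_funeM; exact/measurable_EFinP.
    - move=> x _; rewrite upd_same EFinM.
      case Ax : (A x); last by rewrite mulr0 !mule0.
      by rewrite lee_wpmul2r ?lee_fin ?mulr_ge0 // XJ.
  rewrite ge0_integralZl //; last 3 first.
  - exact/measurable_EFinP.
  - by move=> x _; rewrite lee_fin mulr_ge0.
  - by rewrite mule_ge0 // lee_fin invr_ge0 ltW.
  rewrite muleC EFinM -muleA; apply: lee_wpmul2r => //.
  by rewrite mule_ge0 // lee_fin invr_ge0 ltW.
apply: (@le_trans _ _ (\int[Q]_z ((cg / p)%:E * \int[g]_x (Y (upd z v x))%:E))%E).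
  apply: ge0_le_integral => //.
  - by move=> z _; apply: integral_ge0 => x _; rewrite lee_fin.
  - apply: (@measurable_resample (fun z => (X z * (f (z v) * (A (z v))%:R))%:E)).
      exact/measurable_EFinP.
    by move=> z; rewrite lee_fin.
  - apply: measurable_funeM; apply: (@measurable_resample (EFin \o Y)).
      exact/measurable_EFinP.
    by move=> z /=; rewrite lee_fin.
have cg0 : 0 <= cg.
  rewrite -lee_fin; apply: le_trans hcg; apply: integral_ge0 => x _.
  by rewrite lee_fin mulr_ge0.
rewrite ge0_integralZl_EFin //; last 3 first.
- by move=> z _; apply: integral_ge0 => x _; rewrite lee_fin.
- apply: (@measurable_resample (EFin \o Y)); first exact/measurable_EFinP.
  by move=> z /=; rewrite lee_fin.
- by rewrite divr_ge0 // ltW.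
apply: lee_wpmul2l; first by rewrite lee_fin divr_ge0 ?(ltW p0).
rewrite -(@hQ v (fun z => (Y z)%:E)) //; first exact/measurable_EFinP.
Qed.

(** Only the sum of the [Y v] has to be controlled, with one constant [cg / p] for all [v]: in the
    main applications that sum is a ratio of two counts. *)
Lemma ebound_decouple_sum (s : seq I) (X Y : I -> noise_space R I -> R) (f : R -> R)
    (A A' : R -> bool) (cg p y : R) :
  (forall v, v \in s -> [/\ measurable_fun setT (X v), forall z, 0 <= X v z,
     measurable_fun setT (Y v), forall z, 0 <= Y v z &
     forall z x x', A x -> A' x' -> X v (upd z v x) <= Y v (upd z v x')]) ->
  measurable_fun setT f -> (forall x, 0 <= f x) ->
  measurable_fun setT A -> measurable_fun setT A' ->
  (\int[g]_x (f x * (A x)%:R)%:E <= cg%:E)%E ->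
  0 < p -> (p%:E <= \int[g]_x ((A' x)%:R)%:E)%E ->
  ebound Q (fun z => \sum_(v <- s) Y v z) y ->
  ebound Q (fun z => \sum_(v <- s) X v z * (f (z v) * (A (z v))%:R)) (cg / p * y).
Proof.
move=> XY mf f0 mA mA' hcg p0 hp [_ _ Yy].
have cg0 : 0 <= cg.
  rewrite -lee_fin; apply: le_trans hcg; apply: integral_ge0 => x _.
  by rewrite lee_fin mulr_ge0.
have mfA : measurable_fun setT (fun x : R => f x * (A x)%:R).
  by apply: measurable_funM => //; exact: measurable_natr.
suff [mS S0 SY] : [/\ measurable_fun setT
    (fun z : noise_space R I => \sum_(v <- s) X v z * (f (z v) * (A (z v))%:R)),
    forall z : noise_space R I, 0 <= \sum_(v <- s) X v z * (f (z v) * (A (z v))%:R) &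
    (\int[Q]_z (\sum_(v <- s) X v z * (f (z v) * (A (z v))%:R))%:E <=
     (cg / p)%:E * \int[Q]_z (\sum_(v <- s) Y v z)%:E)%E].
  split => //; apply: le_trans SY _; rewrite [leRHS]EFinM lee_wpmul2l //.
  by rewrite lee_fin divr_ge0 // ltW.
have mfAz v : measurable_fun setT (fun z : noise_space R I => f (z v) * (A (z v))%:R).
  by apply: (measurableT_comp mfA); exact: measurable_coord.
have mXfA v : v \in s ->
    measurable_fun setT (fun z : noise_space R I => X v z * (f (z v) * (A (z v))%:R)).
  by move=> /XY[mX _ _ _ _]; exact: measurable_funM.
have XfA0 v z : v \in s -> 0 <= X v z * (f (z v) * (A (z v))%:R).
  by move=> /XY[_ X0 _ _ _]; rewrite !mulr_ge0.
split; first exact: measurable_sum_seq.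
  by move=> z; rewrite big_seq; apply: sumr_ge0 => v; exact: XfA0.
elim: s XY mXfA XfA0 {Yy} => [_ _ _|v s IH XY mXfA XfA0].
  under eq_integral do rewrite big_nil.
  by rewrite integral0 mule_ge0 ?lee_fin ?divr_ge0 ?(ltW p0) // integral_ge0 // => z _;
    rewrite big_nil.
have us u : u \in s -> u \in v :: s by move=> us; rewrite inE us orbT.
have SY := IH (fun u h => XY u (us u h)) (fun u h => mXfA u (us u h))
  (fun u z h => XfA0 u z (us u h)).
have [mX X0 mY Y0 hXY] := XY v (mem_head _ _).
have mYsum : measurable_fun setT (fun z => \sum_(u <- s) Y u z).
  by apply: measurable_sum_seq => u /us /XY[].
have mXsum : measurable_fun setT
   (fun z => \sum_(u <- s) X u z * (f (z u) * (A (z u))%:R)).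
  by apply: measurable_sum_seq => u /us /mXfA.
have Ysum0 z : 0 <= \sum_(u <- s) Y u z.
  by rewrite big_seq; apply: sumr_ge0 => u /us /XY[].
have Xsum0 z : 0 <= \sum_(u <- s) X u z * (f (z u) * (A (z u))%:R).
  by rewrite big_seq; apply: sumr_ge0 => u /us /XfA0.
have Xv0 z := XfA0 v z (mem_head _ _).
have mXv := mXfA v (mem_head _ _).
under eq_integral do rewrite big_cons EFinD.
under [X in (_ <= _ * X)%E]eq_integral do rewrite big_cons EFinD.
rewrite !ge0_integralD //; try exact/measurable_EFinP; try by move=> z _; rewrite lee_fin.
rewrite muleDr; last 2 first.
- by [].
- by rewrite ge0_adde_def // inE integral_ge0 // => z _; rewrite lee_fin.
by apply: leeD => //; apply: (le_integral_decouple (A' := A')).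
Qed.

(** No coordinate occurs twice among the pairs, so resampling [a j] and [b j] integrates one factor
    and leaves the others fixed. Pairs are needed because a patch distance couples the noises at
    [i + e] and [u + e]. *)
Lemma ebound_prod_pairs (J : eqType) (s : seq J) (a b : J -> I)
    (G : J -> R -> R -> R) (c : J -> R) :
  uniq ([seq a j | j <- s] ++ [seq b j | j <- s]) ->
  (forall j, measurable_fun setT (fun p : R * R => G j p.1 p.2)) ->
  (forall j x y, 0 <= G j x y) ->
  (forall j, (\int[g]_y \int[g]_x (G j x y)%:E <= (c j)%:E)%E) ->
  ebound Q (fun z => \prod_(j <- s) G j (z (a j)) (z (b j))) (\prod_(j <- s) c j).
Proof.
move=> + mG G0 Gc; elim: s => [_|j s IH us].
  rewrite big_nil; under [X in ebound _ X _]funext => z do rewrite big_nil.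
  exact: ebound_cst.
have mGz i : measurable_fun setT (fun z : noise_space R I => G i (z (a i)) (z (b i))).
  apply: (@measurableT_comp _ _ _ _ _ _ (fun p : R * R => G i p.1 p.2) _
    (fun z : noise_space R I => (z (a i), z (b i)))) => //.
  by apply: measurable_fun_pair; exact: measurable_coord.
move: us; rewrite /= mem_cat inE !negb_or cat_uniq /= -!andbA.
move=> /and5P[ajs ajbj bjs us1 /and3P[]]; rewrite negb_or => /andP[bj h] bs us2.
have us : uniq ([seq a j | j <- s] ++ [seq b j | j <- s]).
  by rewrite cat_uniq us1 us2 h.
have [mr r0 rc] := IH us.
have c0 i : 0 <= c i.
  rewrite -lee_fin; apply: le_trans (Gc i).
  by apply: integral_ge0 => y _; apply: integral_ge0 => x _; rewrite lee_fin.
rewrite big_cons; under [X in ebound _ X _]funext => z do rewrite big_cons.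
set r := fun z => \prod_(j <- s) G j (z (a j)) (z (b j)).
have mF : measurable_fun setT (fun z : noise_space R I =>
    (G j (z (a j)) (z (b j)) * r z)%:E).
  by apply/measurable_EFinP; apply: measurable_funM.
have F0 z : (0 <= (G j (z (a j)) (z (b j)) * r z)%:E)%E.
  by rewrite lee_fin; apply: mulr_ge0 => //; exact: r0.
split => //; [exact/measurable_EFinP|].
rewrite (hQ (a j)) // (hQ (b j)); last 2 first.
- exact: (@measurable_resample (fun z => (G j (z (a j)) (z (b j)) * r z)%:E)).
- by move=> z; apply: integral_ge0 => x _; exact: F0.
have rE z x y : r (upd (upd z (b j) y) (a j) x) = r z.
  rewrite /r; apply: eq_big_seq => i si.
  have ai : a i \in [seq a j | j <- s] by apply: map_f.
  have bi : b i \in [seq b j | j <- s] by apply: map_f.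
  by rewrite !upd_other //; apply/eqP => E;
    first [by move: bjs; rewrite -E bi|by move: bj; rewrite -E ai|
           by move: bs; rewrite -E bi|by move: ajs; rewrite -E ai].
have mGj : measurable_fun setT (fun p : measurableTypeR R * measurableTypeR R =>
    (G j p.2 p.1)%:E).
  apply/measurable_EFinP; apply: (@measurableT_comp _ _ _ _ _ _ (fun p : R * R => G j p.1 p.2) _
    (fun p : measurableTypeR R * measurableTypeR R => (p.2, p.1))) => //.
  by apply: measurable_fun_pair; [exact: measurable_snd|exact: measurable_fst].
have mGy y : measurable_fun setT (fun x : measurableTypeR R => (G j x y)%:E).
  apply: (measurableT_comp mGj (g := fun x => (y, x))); exact: pair1_measurable.
apply: (@le_trans _ _ (\int[Q]_z ((c j)%:E * (r z)%:E))%E).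
  apply: ge0_le_integral => //.
  - by move=> z _; apply: integral_ge0 => y _; apply: integral_ge0 => x _; exact: F0.
  - apply: (@measurable_resample (fun z => \int[g]_x (G j (upd z (a j) x (a j))
        (upd z (a j) x (b j)) * r (upd z (a j) x))%:E)%E (b j)).
      exact: (@measurable_resample (fun z => (G j (z (a j)) (z (b j)) * r z)%:E)).
    by move=> z; apply: integral_ge0 => x _; exact: F0.
  - by apply: measurable_funeM; exact/measurable_EFinP.
  move=> z _; rewrite -/(r _); apply: (@le_trans _ _
      (\int[g]_y \int[g]_x ((G j x y)%:E * (r z)%:E))%E); last first.
    have rz : (0 <= (r z)%:E)%E by rewrite lee_fin; exact: r0.
    have Gp y (x : measurableTypeR R) : setT x -> (0 <= (G j x y)%:E)%E by move=> _; rewrite lee_fin.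
    under eq_integral => y _ do rewrite (ge0_integralZr g measurableT (mGy y) (Gp y) rz).
    rewrite ge0_integralZr //; last 2 first.
    - apply: (@measurable_fun_fubini_tonelli_F _ _ (measurableTypeR R)
        (measurableTypeR R) R g (fun p => (G j p.2 p.1)%:E)) => //.
      by move=> p; rewrite lee_fin.
    - by move=> y _; apply: integral_ge0 => x _; rewrite lee_fin.
    by apply: lee_wpmul2r.
  rewrite le_eqVlt; apply/orP; left; apply/eqP; apply: eq_integral => y _.
  apply: eq_integral => x _; rewrite -[X in (_ * X)%:E]/(r _) rE upd_same.
  by rewrite upd_other 1?eq_sym // upd_same EFinM.
rewrite ge0_integralZl_EFin //; last 2 first.
- by move=> z _; rewrite lee_fin; exact: r0.
- exact/measurable_EFinP.
by rewrite [leRHS]EFinM; apply: lee_wpmul2l; rewrite ?lee_fin.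
Qed.

End independence.

(** This is [- ln (1 - t) / 2 <= t / 2 + t ^+ 2 / 2]. Bounding the exponential below by [1 + v] and
    squaring reduces it to a polynomial inequality. *)
Lemma inv_sqrt1B_le (R : realType) (t : R) : `|t| <= 4^-1 ->
  (Num.sqrt (1 - t))^-1 <= expR (t / 2 + t ^+ 2 / 2).
Proof.
move=> ht; have [h1 h2] : - 4^-1 <= t /\ t <= 4^-1 by apply/andP; rewrite -ler_norml.
have t1 : 0 < 1 - t by lra.
have s0 : 0 < Num.sqrt (1 - t) by rewrite sqrtr_gt0.
rewrite -[leLHS]mul1r ler_pdivrMr //.
set v := t / 2 + t ^+ 2 / 2.
have v0 : 0 <= 1 + v by rewrite /v; nra.
have ev : 1 + v <= expR v by exact: expR_ge1Dx.
rewrite -(@ler_pXn2r _ 2) ?nnegrE ?ler01 ?mulr_ge0 ?expR_ge0 ?(ltW s0) //.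
rewrite expr1n exprMn sqr_sqrtr ?(ltW t1) //.
apply: (@le_trans _ _ ((1 + v) ^+ 2 * (1 - t))); last first.
  by rewrite ler_wpM2r ?(ltW t1) // ler_pXn2r // nnegrE ?expR_ge0.
rewrite -subr_ge0 [leRHS](_ : _ = t ^+ 2 * ((1 - t) * (1 + t) ^+ 2 / 4 - t)); last first.
  by rewrite /v; field.
apply: mulr_ge0; first exact: sqr_ge0.
have : 0 <= (4^-1 - t) by lra.
nra.
Qed.

Lemma normal_exp_quadratic_le (R : realType) (sigma p r : R) : 0 < sigma ->
  `|p| * sigma ^+ 2 <= 8^-1 ->
  (\int[normal_prob 0 sigma]_x (expR (p * x ^+ 2 + r * x))%:E <=
   (expR (p * sigma ^+ 2 + 2 * (p * sigma ^+ 2) ^+ 2 + r ^+ 2 * sigma ^+ 2))%:E)%E.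
Proof.
move=> s0 hp; set s := sigma ^+ 2 in hp *.
have s20 : 0 < s by rewrite exprn_gt0.
have ps : `|p * s| <= 8^-1 by rewrite normrM (ger0_norm (ltW s20)).
have [h1 h2] : - 8^-1 <= p * s /\ p * s <= 8^-1 by apply/andP; rewrite -ler_norml.
rewrite integral_normal_exp_quadratic //; last by rewrite -/s; lra.
rewrite -/s lee_fin -mulrA; set t := 2 * (p * s).
have ht : `|t| <= 4^-1 by rewrite ler_norml /t; lra.
apply: (@le_trans _ _ (expR (t / 2 + t ^+ 2 / 2) * expR (r ^+ 2 * s))).
  apply: ler_pM; rewrite ?invr_ge0 ?sqrtr_ge0 ?expR_ge0 ?inv_sqrt1B_le //.
  rewrite ler_expR ler_pdivrMr; last by rewrite /t; lra.
  rewrite -[leLHS]mulr1; apply: ler_wpM2l; first by rewrite mulr_ge0 ?sqr_ge0 ?ltW.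
  by rewrite /t; lra.
rewrite -expRD ler_expR; apply: lerD => //.
by rewrite /t; lra.
Qed.

(** One family of forms in two noises covers the patch distance, its derivative under dilation and
    the norm of a patch. *)
Definition quad {R : realType} (al be ga ka la x y : R) : R :=
  al * x ^+ 2 + be * y ^+ 2 + ga * (x * y) + ka * x + la * y.

(** The form has mean [(al + be) * sigma ^+ 2], so the centred exponent has no first-order term in
    [m] and the bound is sub-Gaussian. Once [x] is integrated out, the bound is again the
    exponential of a quadratic in [y]. *)
Lemma quad_mgf (R : realType) (sigma al be ga ka la m : R) : 0 < sigma ->
  `|al| <= 2 -> `|be| <= 2 -> `|ga| <= 2 -> `|ka| <= 2 -> `|la| <= 2 ->
  `|m| * sigma ^+ 2 <= 64^-1 ->
  (\int[normal_prob 0 sigma]_y \int[normal_prob 0 sigma]_x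
     (expR (m * (quad al be ga ka la x y - (al + be) * sigma ^+ 2)))%:E <=
  (expR (m ^+ 2 * (26 * (sigma ^+ 2) ^+ 2 + 12 * sigma ^+ 2)))%:E)%E.
Proof.
move=> s0; set s := sigma ^+ 2.
have s20 : 0 < s by rewrite exprn_gt0.
rewrite !ler_norml => /andP[al1 al2] /andP[be1 be2] /andP[ga1 ga2] /andP[ka1 ka2] /andP[la1 la2] hm.
have hms : `|m * s| <= 64^-1 by rewrite normrM (ger0_norm (ltW s20)).
have [m1 m2] : - 64^-1 <= m * s /\ m * s <= 64^-1 by apply/andP; rewrite -ler_norml.
have sq2 (c : R) : -2 <= c -> c <= 2 -> c ^+ 2 <= 4 by move=> ? ?; nra.
have m20 : 0 <= m ^+ 2 by exact: sqr_ge0.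
have s0' : 0 <= s by exact: ltW.
(* Integrating in [x] produces [(m * (ga * y + ka)) ^+ 2 * s], at most
   [8 * m ^+ 2 * s * (y ^+ 2 + 1)]; the two parts enter [p] and [c0]. *)
pose c0 := - m * be * s + 8 * m ^+ 2 * s ^+ 2 + 8 * m ^+ 2 * s.
pose p := m * be + 8 * m ^+ 2 * s.
have mexp (c d e : R) : measurable_fun setT
    (fun x : R => (expR (c + (d * x ^+ 2 + e * x)))%:E).
  apply/measurable_EFinP; apply: (measurableT_comp (@measurable_expR R)).
  apply: measurable_funD => //.
  by apply: measurable_funD; apply: measurable_funM => //; apply: measurable_funX.
have inner y : (\int[normal_prob 0 sigma]_x
     (expR (m * (quad al be ga ka la x y - (al + be) * s)))%:E <=
     (expR (c0 + (p * y ^+ 2 + (m * la) * y)))%:E)%E.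
  pose k := m * be * y ^+ 2 + m * la * y - m * (al + be) * s.
  have -> : (\int[normal_prob 0 sigma]_x
      (expR (m * (quad al be ga ka la x y - (al + be) * s)))%:E =
     (expR k)%:E * \int[normal_prob 0 sigma]_x
       (expR (m * al * x ^+ 2 + (m * (ga * y + ka)) * x))%:E)%E.
    rewrite -ge0_integralZl_EFin ?expR_ge0 //.
    - apply: eq_integral => x _; rewrite -EFinM -expRD; congr (expR _)%:E.
      by rewrite /quad /k; ring.
    - have := mexp 0 (m * al) (m * (ga * y + ka)).
      by under eq_fun do rewrite add0r.
  have hp : `|m * al| * sigma ^+ 2 <= 8^-1.
    rewrite -/s -[X in _ * X](ger0_norm s0') -normrM mulrAC normrM.
    have : `|al| <= 2 by rewrite ler_norml al1 al2.
    have := normr_ge0 (m * s); have := normr_ge0 al; nra.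
  apply: le_trans (lee_wpmul2l _ (normal_exp_quadratic_le (m * (ga * y + ka)) s0 hp)) _.
    by rewrite lee_fin expR_ge0.
  rewrite -EFinM lee_fin -expRD ler_expR -/s /k /c0 /p.
  have hal := sq2 _ al1 al2; have hga := sq2 _ ga1 ga2; have hka := sq2 _ ka1 ka2.
  have h1 : 2 * (m * al * s) ^+ 2 <= 8 * m ^+ 2 * s ^+ 2.
    rewrite (_ : (m * al * s) ^+ 2 = al ^+ 2 * (m ^+ 2 * s ^+ 2)); last by ring.
    have : 0 <= m ^+ 2 * s ^+ 2 by rewrite mulr_ge0 ?sqr_ge0.
    by rewrite -(mulrA 8); move: (al ^+ 2) hal (m ^+ 2 * s ^+ 2) => A hA B hB; nra.
  have h2 : (m * (ga * y + ka)) ^+ 2 * s <= 8 * m ^+ 2 * s * y ^+ 2 + 8 * m ^+ 2 * s.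
    rewrite exprMn.
    have h3 : (ga * y + ka) ^+ 2 <= 8 * y ^+ 2 + 8.
      have : (ga * y + ka) ^+ 2 <= 2 * (ga ^+ 2 * y ^+ 2) + 2 * ka ^+ 2.
        by have := sqr_ge0 (ga * y - ka); lra.
      have : ga ^+ 2 * y ^+ 2 <= 4 * y ^+ 2 by rewrite ler_wpM2r ?sqr_ge0.
      by lra.
    have : 0 <= m ^+ 2 * s by rewrite mulr_ge0.
    move=> ms0; have := ler_wpM2l ms0 h3.
    by lra.
  lra.
apply: (@le_trans _ _ (\int[normal_prob 0 sigma]_y
  (expR (c0 + (p * y ^+ 2 + (m * la) * y)))%:E)%E).
  apply: ge0_le_integral => //.
  - by move=> y _; apply: integral_ge0 => x _; rewrite lee_fin expR_ge0.
  - apply: (@measurable_fun_fubini_tonelli_F _ _ (measurableTypeR R)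
        (measurableTypeR R) R (normal_prob 0 sigma) (fun q =>
      (expR (m * (quad al be ga ka la q.2 q.1 - (al + be) * s)))%:E)) => //.
    apply/measurable_EFinP; apply: (measurableT_comp (@measurable_expR R)).
      apply: measurable_funM => //; apply: measurable_funB => //.
      have m1' : measurable_fun setT (fun q : measurableTypeR R * measurableTypeR R => q.1 : R).
        exact: measurable_fst.
      have m2' : measurable_fun setT (fun q : measurableTypeR R * measurableTypeR R => q.2 : R).
        exact: measurable_snd.
      rewrite /quad; repeat apply: measurable_funD; repeat apply: measurable_funM => //;
      by apply: measurable_funX.
  - exact: mexp.
have -> : (\int[normal_prob 0 sigma]_y (expR (c0 + (p * y ^+ 2 + (m * la) * y)))%:E =
   (expR c0)%:E * \int[normal_prob 0 sigma]_y (expR (p * y ^+ 2 + (m * la) * y))%:E)%E.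
  rewrite -ge0_integralZl_EFin ?expR_ge0 //.
  - by apply: eq_integral => x _; rewrite -EFinM -expRD.
  - have := mexp 0 p (m * la).
    by under eq_fun do rewrite add0r.
have ps : `|p * s| <= 17 / 8 * `|m * s|.
  rewrite (_ : p * s = (m * s) * (be + 8 * (m * s))); last by rewrite /p; ring.
  rewrite normrM mulrC ler_wpM2r // ler_norml; lra.
have hp : `|p| * sigma ^+ 2 <= 8^-1.
  rewrite -/s -[X in _ * X](ger0_norm s0') -normrM.
  by have := normr_ge0 (m * s); lra.
apply: le_trans (lee_wpmul2l _ (normal_exp_quadratic_le (m * la) s0 hp)) _.
  by rewrite lee_fin expR_ge0.
rewrite -EFinM lee_fin -expRD ler_expR -/s.
have hla := sq2 _ la1 la2.
have h1 : (p * s) ^+ 2 <= 5 * (m ^+ 2 * s ^+ 2).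
  rewrite -exprMn -(real_normK (num_real (p * s))) -(real_normK (num_real (m * s))).
  have := normr_ge0 (p * s); have := normr_ge0 (m * s).
  by move: `|m * s| `|p * s| ps => a b; nra.
have h2 : (m * la) ^+ 2 * s <= 4 * (m ^+ 2 * s).
  rewrite exprMn mulrAC mulrC ler_wpM2r // mulr_ge0 //.
rewrite [X in c0 + (X + _ + _)](_ : _ = m * be * s + 8 * m ^+ 2 * s ^+ 2); last by rewrite /p; ring.
by rewrite /c0; lra.
Qed.

(** * Concentration of quadratic forms along stripes *)

Section concentration.
Context {R : realType} {I : choiceType}.
Variable sigma : R.
Hypothesis sigma_gt0 : 0 < sigma.
Variables (Q : probability (noise_space R I) R).
Hypothesis hQ : resamplable (normal_prob 0 sigma) Q.

Definition tail_cst : R := 26 * (sigma ^+ 2) ^+ 2 + 12 * sigma ^+ 2.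

Lemma tail_cst_gt0 : 0 < tail_cst.
Proof. by rewrite addr_gt0 // mulr_gt0 // ?exprn_gt0. Qed.

Lemma measurable_quad (al be ga ka la : R) (a b : I) :
  measurable_fun setT (fun z : noise_space R I => quad al be ga ka la (z a) (z b)).
Proof.
have m i : measurable_fun setT (fun z : noise_space R I => z i).
  exact: measurable_coord.
rewrite /quad; repeat apply: measurable_funD; repeat apply: measurable_funM => //;
by apply: measurable_funX.
Qed.

(** Chernoff's method. Different pairs may share a coordinate, but the pairs of one colour are
    disjoint and their summands independent; the exponentials of the two colours are joined by the
    arithmetic-geometric mean inequality, at the price of [2 * m] in place of [m]. *)
Lemma quad_sum_tail (J : eqType) (s : seq J) (a b : J -> I) (color : pred J)
    (al be ga ka la : J -> R) (N rho : R) :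
  (forall c : bool, uniq ([seq a j | j <- s & color j == c] ++
                          [seq b j | j <- s & color j == c])) ->
  (forall j, [/\ `|al j| <= 2, `|be j| <= 2, `|ga j| <= 2, `|ka j| <= 2 & `|la j| <= 2]) ->
  (size s)%:R <= N -> 0 < rho -> rho <= 3 / 4 ->
  ebound Q (fun z => ((\sum_(j <- s) (al j + be j)) * sigma ^+ 2 + rho * N <=
     \sum_(j <- s) quad (al j) (be j) (ga j) (ka j) (la j) (z (a j)) (z (b j)))%R%:R)
    (expR (- (rho ^+ 2 * N / (16 * tail_cst)))).
Proof.
move=> us cf sN rho0 rho1.
have C0 := tail_cst_gt0.
set q := fun j (z : noise_space R I) =>
  quad (al j) (be j) (ga j) (ka j) (la j) (z (a j)) (z (b j)).
(* Minimises [- m * rho * N + (2 * m) ^+ 2 * tail_cst * N]. The condition [rho <= 3 / 4] then yields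
   the [64^-1] that [quad_mgf] requires. *)
set m := rho / (8 * tail_cst).
have m0 : 0 < m by rewrite divr_gt0 // mulr_gt0.
pose G c z := \prod_(j <- s | color j == c)
   expR (2 * m * (q j z - (al j + be j) * sigma ^+ 2)).
have m64 : `|2 * m| * sigma ^+ 2 <= 64^-1.
  have m20 : 0 < 2 * m by rewrite mulr_gt0.
  rewrite gtr0_norm //.
  have -> : 2 * m * sigma ^+ 2 = rho / (104 * sigma ^+ 2 + 48).
    rewrite /m /tail_cst; field.
    by rewrite !gt_eqF ?addr_gt0 ?mulr_gt0 ?exprn_gt0.
  rewrite ler_pdivrMr; last by rewrite addr_gt0 // mulr_gt0 ?exprn_gt0.
  have : 0 < sigma ^+ 2 by rewrite exprn_gt0.
  lra.
have GB c : ebound Q (G c) (expR ((2 * m) ^+ 2 * tail_cst * N)).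
  rewrite /G; under [X in ebound _ X _]funext => z do rewrite -big_filter.
  apply: (@ebound_weaken _ _ _ _ _
     (\prod_(j <- [seq j <- s | color j == c]) expR ((2 * m) ^+ 2 * tail_cst))).
    rewrite -expR_sum ler_expR big_const_seq count_predT iter_addr_0 -[leLHS]mulr_natr.
    apply: ler_wpM2l; first by rewrite mulr_ge0 ?sqr_ge0 // ltW.
    by apply: le_trans sN; rewrite ler_nat size_filter count_size.
  apply: (ebound_prod_pairs hQ (G := fun j x y => expR (2 * m *
     (quad (al j) (be j) (ga j) (ka j) (la j) x y - (al j + be j) * sigma ^+ 2)))
     (us c)).
  - move=> j; apply: (measurableT_comp (@measurable_expR R)).
    apply: measurable_funM => //; apply: measurable_funB => //.
    have m1' : measurable_fun setT (fun q : R * R => q.1 : R) by exact: measurable_fst.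
    have m2' : measurable_fun setT (fun q : R * R => q.2 : R) by exact: measurable_snd.
    rewrite /quad; repeat apply: measurable_funD; repeat apply: measurable_funM => //;
    by apply: measurable_funX.
  - by move=> j x y; exact: expR_ge0.
  - by move=> j; have [? ? ? ? ?] := cf j; exact: quad_mgf.
have := ebound_scale (expR_ge0 (- (m * rho * N))) (ebound_add (GB true) (GB false)).
have mq j : measurable_fun setT (q j) by exact: measurable_quad.
move=> /(ebound_markov (b1 := fun z => (\sum_(j <- s) (al j + be j)) * sigma ^+ 2 + rho * N <=
     \sum_(j <- s) q j z)) H.
have L0 : (0 : R) < 2 by [].
apply: ebound_weaken (H 2 _ L0 _).
- have half (x y : R) : 2^-1 * (x * (y + y)) = x * y by field.
  rewrite half -expRD ler_expR.
  rewrite (_ : _ + _ = - (rho ^+ 2 * N / (16 * tail_cst))) //.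
  by rewrite /m; field; rewrite gt_eqF.
- apply: measurable_fun_ler => //; exact: measurable_sum.
- move=> z hz.
  set A := \sum_(j <- s | color j) (q j z - (al j + be j) * sigma ^+ 2).
  set B := \sum_(j <- s | ~~ color j) (q j z - (al j + be j) * sigma ^+ 2).
  have hAB : rho * N <= A + B.
    have -> : A + B = \sum_(j <- s) (q j z - (al j + be j) * sigma ^+ 2).
      by rewrite [RHS](bigID color).
    rewrite sumrB -mulr_suml; lra.
  have -> : G true z = expR (2 * m * A).
    rewrite /G /A mulr_sumr expR_sum; apply: eq_bigl => j.
    by rewrite eqb_id.
  have -> : G false z = expR (2 * m * B).
    rewrite /G /B mulr_sumr expR_sum; apply: eq_bigl => j.
    by rewrite eqbF_neg.
  rewrite expRN mulrC ler_pdivlMr ?expR_gt0 //.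
  apply: (@le_trans _ _ (2 * expR (m * (A + B)))).
    by rewrite ler_pM2l // ler_expR -mulrA ler_pM2l.
  have sq C : expR (2 * m * C) = expR (m * C) ^+ 2.
    by rewrite -expRM_natl mulrA.
  rewrite mulrDr expRD !sq.
  by have := sqr_ge0 (expR (m * A) - expR (m * B)); lra.
Qed.

End concentration.

Section offsets.

Local Notation V := (int * int)%type.

(* Translating by [s] moves one stripe of width [s] to the next one, so the
   parity of the stripe separates [o] from [o + s]. *)
Definition stripe (s o : V) : bool :=
  if s.1 != 0 then (2 %| (o.1 %/ s.1)%Z)%Z else (2 %| (o.2 %/ s.2)%Z)%Z.

Lemma stripe_shift (s o : V) : s != 0 -> stripe s (o + s) = ~~ stripe s o.
Proof.
case: s o => [s1 s2] [p1 p2]; rewrite /stripe /= => s0.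
have par (x y : int) : y != 0 -> (2 %| ((x + y) %/ y)%Z)%Z = ~~ (2 %| (x %/ y)%Z)%Z.
  move=> y0; rewrite -[X in (_ + X)]mul1r addrC divzMDl //; lia.
have [s10|s10] := eqVneq s1 0; last exact: par.
rewrite /= par //; apply/eqP => s20; by move: s0; rewrite s10 s20 eqxx.
Qed.

(** A coincidence [u + o = i + o'] forces [o' = o + (u - i)], whose stripe has the other parity. *)
Lemma uniq_stripe (i u : V) (s : seq V) (c : bool) : i != u -> uniq s ->
  uniq ([seq i + o | o <- s & stripe (u - i) o == c] ++
        [seq u + o | o <- s & stripe (u - i) o == c]).
Proof.
move=> iu us; rewrite cat_uniq !map_inj_uniq ?filter_uniq //=; try exact: addrI.
rewrite andbT; apply/hasPn => _ /mapP[ o + ->]; rewrite mem_filter => /andP[/eqP co _].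
apply/negP => /mapP[ o']; rewrite mem_filter => /andP[/eqP co' _] E.
have : o' = o + (u - i) by rewrite -[LHS](addKr i) addrC -E [u + o]addrC addrA.
move=> Eo; move: co'; rewrite Eo stripe_shift ?co; last by rewrite subr_eq0 eq_sym.
by case: c co.
Qed.

End offsets.

(** * Patches and patch distances *)

Local Notation V := (int * int)%type.

Section boxes.

Definition box (r : nat) : seq V :=
  [seq (l%:Z - r%:Z, m%:Z - r%:Z) | l <- iota 0 (2 * r).+1, m <- iota 0 (2 * r).+1].

Arguments box r : simpl never.

Lemma mem_box r (p : V) : (p \in box r) = (`|p.1| <= r)%N && (`|p.2| <= r)%N.
Proof.
apply/idP/idP => [/allpairsP[[l m] [hl hm ->]]|].
  by move: hl hm; rewrite !mem_iota /=; lia.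
case: p => [a b] /= h.
apply/allpairsP; exists (absz (a + r%:Z), absz (b + r%:Z)).
by rewrite !mem_iota /=; split; [lia|lia|congr (_, _); lia].
Qed.

Lemma box_uniq r : uniq (box r).
Proof.
apply: allpairs_uniq; rewrite ?iota_uniq // => -[a b] [c e] _ _ /= [h1 h2].
by congr (_, _); lia.
Qed.

Lemma size_box r : size (box r) = ((2 * r).+1 ^ 2)%N.
Proof. by rewrite size_allpairs !size_iota mulnn. Qed.

Lemma box0 r : (0 : V) \in box r.
Proof. by rewrite mem_box. Qed.

Definition pixels (n : nat) : seq V :=
  [seq (i%:Z, j%:Z) | i <- index_iota 1 n.+1, j <- index_iota 1 n.+1].

Arguments pixels n : simpl never.

Lemma mem_pixels n (p : V) :
  (p \in pixels n) = (1 <= p.1 <= n%:Z) && (1 <= p.2 <= n%:Z).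
Proof.
apply/idP/idP => [/allpairsP[[l m] [hl hm ->]]|].
  by move: hl hm; rewrite !mem_index_iota /=; lia.
case: p => [a b] /= h.
apply/allpairsP; exists (absz a, absz b).
by rewrite !mem_index_iota /=; split; [lia|lia|congr (_, _); lia].
Qed.

Lemma pixels_uniq n : uniq (pixels n).
Proof.
apply: allpairs_uniq; rewrite ?iota_uniq // => -[a b] [c e] _ _ /= [h1 h2].
by congr (_, _); lia.
Qed.

Lemma size_pixels n : size (pixels n) = (n ^ 2)%N.
Proof. by rewrite size_allpairs size_iota subn1 mulnn. Qed.

End boxes.

Section patch_distance.
Context {R : realType}.
Implicit Types (x z : V -> R) (i u v w : V).

Definition sqd (r : nat) (y : V -> R) i u : R :=
  \sum_(e <- box r | e != 0) (y (i + e) - y (u + e)) ^+ 2.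

Definition obs x z : V -> R := fun u => x u + z u.

Lemma sqd_self r y i : sqd r y i i = 0.
Proof. by apply: big1 => e _; rewrite subrr expr0n. Qed.

Lemma measurable_sqd r x i u :
  measurable_fun setT (fun z : noise_space R V => sqd r (obs x z) i u).
Proof.
rewrite (_ : (fun z => _) = (fun z : noise_space R V =>
    \sum_(e <- [seq e <- box r | e != 0]) (obs x z (i + e) - obs x z (u + e)) ^+ 2)).
  2: by apply/funext => z; rewrite big_filter.
apply: measurable_sum => e; apply: measurable_funX.
by apply: measurable_funB; apply: measurable_funD => //; exact: measurable_coord.
Qed.

Lemma sum_pred1_le (s : seq V) (f : V -> V) w : uniq s -> injective f ->
  \sum_(e <- s) (f e == w)%:R <= 1 :> R.
Proof.
move=> us fi; rewrite -natr_sum -[leRHS]/(1%:R) ler_nat.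
rewrite (_ : (\sum_(e <- s) (f e == w))%N = count_mem w (map f s)); last first.
  by rewrite count_map -sum1_count [RHS]big_mkcond; apply: eq_bigr => e _ /=; case: eqP.
by rewrite count_uniq_mem ?map_inj_uniq // leq_b1.
Qed.

(** At most two summands see [v], those with [i + e = v] and with [u + e = v], and each is at most
    [3 * (1 + B + B) <= 9 * B]. Only [z] has to be bounded, since the summands for [z'] are
    nonnegative. *)
Lemma sqd_local r x z z' v i u (B : R) : (forall w, 0 <= x w <= 1) -> 1 <= B ->
  (forall w, w != v -> z w = z' w) ->
  (forall e, e \in box r -> e != 0 -> (i + e == v) || (u + e == v) ->
     z (i + e) ^+ 2 <= B /\ z (u + e) ^+ 2 <= B) ->
  sqd r (obs x z) i u <= sqd r (obs x z') i u + 18 * B.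
Proof.
move=> x01 B1 zz' hB.
have B0 : 0 <= B by lra.
apply: (@le_trans _ _ (sqd r (obs x z') i u +
   \sum_(e <- box r) (9 * B * (i + e == v)%:R + 9 * B * (u + e == v)%:R))); last first.
  rewrite lerD2l big_split /= -!mulr_sumr.
  have := sum_pred1_le v (box_uniq r) (addrI i).
  have := sum_pred1_le v (box_uniq r) (addrI u).
  nra.
rewrite /sqd [in X in _ <= _ + X](bigID (fun e => e != 0)) /= addrA -big_split /=.
apply: ler_wpDr.
  by apply: sumr_ge0 => e _; rewrite addr_ge0 // mulr_ge0 // mulr_ge0.
rewrite [leLHS]big_seq_cond [leRHS]big_seq_cond.
apply: ler_sum => e /andP[eb e0]; rewrite /obs.
have := hB e eb e0.
have := x01 (i + e); have := x01 (u + e).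
have [iv|iv] := eqVneq (i + e) v; last first.
  have [uv|uv] := eqVneq (u + e) v; last first.
    by move=> _ _ _; rewrite !mulr0 !addr0 (zz' _ iv) (zz' _ uv).
  rewrite (zz' _ iv) => /andP[? ?] /andP[? ?] /(_ erefl)[h1 h2].
  rewrite mulr0 mulr1 add0r; apply: ler_wpDl; first exact: sqr_ge0.
  have := sqr_ge0 (x (i + e) - x (u + e) - z' (i + e)).
  have := sqr_ge0 (x (i + e) - x (u + e) + z (u + e)).
  have := sqr_ge0 (z' (i + e) + z (u + e)).
  have : (x (i + e) - x (u + e)) ^+ 2 <= 1 by nra.
  nra.
move=> /andP[? ?] /andP[? ?] /(_ erefl)[h1 h2].
have h3 : (x (i + e) + z (i + e) - (x (u + e) + z (u + e))) ^+ 2 <= 9 * B.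
  have := sqr_ge0 (x (i + e) - x (u + e) - z (i + e)).
  have := sqr_ge0 (x (i + e) - x (u + e) + z (u + e)).
  have := sqr_ge0 (z (i + e) + z (u + e)).
  have : (x (i + e) - x (u + e)) ^+ 2 <= 1 by nra.
  nra.
apply: ler_wpDl; first exact: sqr_ge0.
by rewrite mulr1; apply: ler_wpDr => //; rewrite !mulr_ge0.
Qed.

(** The alternative [v == u] is available because the centre [e = 0] is left out of the distance:
    the weight of a pixel away from the patch of [i] ignores its own noise. *)
Lemma sqd_indep r x z z' v i u : (forall w, w != v -> z w = z' w) ->
  v - i \notin box r -> (v - u \notin box r) || (v == u) ->
  sqd r (obs x z) i u = sqd r (obs x z') i u.
Proof.
move=> zz' vi vu; rewrite /sqd big_seq_cond [RHS]big_seq_cond.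
apply: eq_bigr => e /andP[eb e0].
have iv : i + e != v by apply: contraNneq vi => <-; rewrite addrC addKr.
have uv : u + e != v.
  case/orP: vu => [vu|/eqP ->]; first by apply: contraNneq vu => <-; rewrite addrC addKr.
  by apply: contraNneq e0 => E; rewrite -(addKr u e) E addrC subrr.
by rewrite /obs !zz'.
Qed.

Lemma count_box_le r (U : seq V) v : uniq U ->
  \sum_(u <- U) (v - u \in box r)%:R <= ((2 * r).+1 ^ 2)%:R :> R.
Proof.
move=> uU; rewrite -natr_sum ler_nat -size_box.
rewrite (_ : (\sum_(u <- U) _)%N = size [seq v - u | u <- U & v - u \in box r]); last first.
  rewrite size_map size_filter -sum1_count [RHS]big_mkcond.
  by apply: eq_bigr => u _ /=; case: (_ \in _).
apply: uniq_leq_size.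
  rewrite map_inj_uniq ?filter_uniq // => a b /addrI /oppr_inj //.
by move=> _ /mapP[u + ->]; rewrite mem_filter => /andP[].
Qed.

Definition scl (s : seq V) (l : R) z : V -> R := fun w => if w \in s then l * z w else z w.

(** Half the derivative of the squared distance at [l = 1] when the noise on the patch of [i] is
    multiplied by [l]. The indicator accounts for the part of the patch of [u] that overlaps the
    patch of [i] and is dilated with it. *)
Definition slope (r : nat) x z i u : R := \sum_(e <- box r | e != 0)
  (obs x z (i + e) - obs x z (u + e)) *
  (z (i + e) - (u + e - i \in box r)%:R * z (u + e)).

(** As a function of [l] the distance is a quadratic polynomial whose leading coefficient is a sum
    of squares, so it lies above its tangent at [l = 1]. *)
Lemma sqd_scl r x z i u (l : R) : 1 <= l ->
  sqd r (obs x z) i u + 2 * (l - 1) * slope r x z i u <=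
  sqd r (obs x (scl [seq i + e | e <- box r] l z)) i u.
Proof.
move=> l1; rewrite /sqd /slope mulr_sumr -big_split /=.
rewrite [leLHS]big_seq_cond [leRHS]big_seq_cond.
apply: ler_sum => e /andP[eb e0].
have mI w : (w \in [seq i + e | e <- box r]) = (w - i \in box r).
  apply/mapP/idP => [[e' h ->]|h]; first by rewrite addrC addKr.
  by exists (w - i) => //; rewrite addrC subrK.
rewrite /obs /scl !mI [i + e]addrC addrK eb [e + i]addrC.
set X := x (i + e); set X' := x (u + e); set Z := z (i + e); set Z' := z (u + e).
set chi := (_ \in _).
rewrite (_ : X' + (if chi then l * Z' else Z') = X' + Z' + (l - 1) * (chi%:R * Z')); last first.
  by case: (chi) => /=; ring.
have := sqr_ge0 ((l - 1) * (Z - chi%:R * Z')); lra.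
Qed.

End patch_distance.

(** * Dilations of the noise and tail bounds for patch distances *)

Section patch_concentration.
Context {R : realType}.
Variable sigma : R.
Hypothesis sigma_gt0 : 0 < sigma.
Variables (Q : probability (noise_space R V) R).
Hypothesis hQ : resamplable (normal_prob 0 sigma) Q.
Local Notation gam := (normal_prob 0 sigma).

Lemma measurable_scl (s : seq V) (l : R) :
  measurable_fun setT (fun z : noise_space R V => scl s l z : noise_space R V).
Proof.
apply: measurable_to_noise_space => i; rewrite /scl; case: (i \in s).
  by apply: measurable_funM => //; exact: measurable_coord.
exact: measurable_coord.
Qed.

Lemma scl_nil (l : R) (z : V -> R) : scl [::] l z = z.
Proof. by apply/funext. Qed.

Lemma scl_cons (s : seq V) w (z : V -> R) (l x : R) : w \notin s ->
  scl s l (upd z w (l * x)) = scl (w :: s) l (upd z w x).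
Proof.
move=> ws; apply/funext => v; rewrite /scl /upd inE.
by case: eqP => [->|_] //=; rewrite (negbTE ws).
Qed.

(** The density picked up by the change of variables that multiplies the noise on [s] by [l]; each
    coordinate contributes a Jacobian factor [l]. *)
Definition scl_density (s : seq V) (l : R) (z : V -> R) : R :=
  \prod_(w <- s) (l * expR (- (l ^+ 2 - 1) * z w ^+ 2 / (2 * sigma ^+ 2))).

Lemma measurable_scl_density s l :
  measurable_fun setT (fun z : noise_space R V => scl_density s l z).
Proof.
apply: measurable_prod => w _; apply: measurable_funM => //.
apply: (measurableT_comp (@measurable_expR R)).
apply: measurable_funM => //; apply: measurable_funM => //; apply: measurable_funX.
exact: measurable_coord.
Qed.

Lemma scl_density_ge0 s l z : 0 <= l -> 0 <= scl_density s l z.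
Proof. by move=> l0; apply: prodr_ge0 => w _; rewrite mulr_ge0 ?expR_ge0. Qed.

Lemma integral_scl (s : seq V) (l : R) (F : noise_space R V -> \bar R) :
  uniq s -> 0 < l -> measurable_fun setT F -> (forall z, (0 <= F z)%E) ->
  (\int[Q]_z F z = \int[Q]_z (F (scl s l z) * (scl_density s l z)%:E))%E.
Proof.
move=> + l0 mF F0; have l0' := ltW l0.
elim: s => [_|w s IH /= /andP[ws us]].
  apply: eq_integral => z _; rewrite /scl_density big_nil mule1.
  by rewrite scl_nil.
rewrite IH // (hQ w); last 2 first.
- apply: emeasurable_funM; last by apply/measurable_EFinP; exact: measurable_scl_density.
  by apply: (measurableT_comp mF); exact: measurable_scl.
- by move=> z; rewrite mule_ge0 // lee_fin scl_density_ge0.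
rewrite [RHS](hQ w); last 2 first.
- apply: emeasurable_funM; last by apply/measurable_EFinP; exact: measurable_scl_density.
  by apply: (measurableT_comp mF); exact: measurable_scl.
- by move=> z; rewrite mule_ge0 // lee_fin scl_density_ge0.
apply: eq_integral => z _.
pose G (x : R) : \bar R := (F (scl s l (upd z w x)) * (scl_density s l (upd z w x))%:E)%E.
have mG : measurable_fun setT G.
  apply: (@measurable_upd1 R V (fun z => (F (scl s l z) * (scl_density s l z)%:E)%E)).
  apply: emeasurable_funM; last by apply/measurable_EFinP; exact: measurable_scl_density.
  by apply: (measurableT_comp mF); exact: measurable_scl.
have G0 x : (0 <= G x)%E by rewrite mule_ge0 // lee_fin scl_density_ge0.
rewrite [LHS](normal_prob_scale sigma_gt0 l0 mG G0).
apply: eq_integral => x _; rewrite /G -muleA -EFinM.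
rewrite (scl_cons z l x ws).
congr (_ * _%:E)%E; rewrite /scl_density big_cons upd_same mulrC; congr (_ * _).
apply: eq_big_seq => v vs.
have vw : v != w by apply/eqP => E; move: ws; rewrite -E vs.
by rewrite !(upd_other _ _ vw).
Qed.

Local Notation C0 := (tail_cst sigma).

Section quad_patch.
Variables (r : nat) (i u : V).
Hypothesis iu : i != u.
Let K : R := ((2 * r).+1 ^ 2)%:R.

Lemma patch_tail (p : pred V) (al be ga ka la : V -> R) (rho : R) :
  (forall j, [/\ `|al j| <= 2, `|be j| <= 2, `|ga j| <= 2, `|ka j| <= 2 & `|la j| <= 2]) ->
  0 < rho -> rho <= 3 / 4 ->
  ebound Q (fun z => ((\sum_(j <- box r | p j) (al j + be j)) * sigma ^+ 2 + rho * K <=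
     \sum_(j <- box r | p j) quad (al j) (be j) (ga j) (ka j) (la j) (z (i + j)) (z (u + j)))%R%:R)
    (expR (- (rho ^+ 2 * K / (16 * C0)))).
Proof.
move=> cf rho0 rho1.
have sK : (size [seq j <- box r | p j])%:R <= K.
  by rewrite /K ler_nat size_filter -size_box count_size.
have := quad_sum_tail sigma_gt0 hQ
  (fun c => uniq_stripe c iu (filter_uniq p (box_uniq r))) cf sK rho0 rho1.
by rewrite big_filter; under [X in ebound _ X _ -> _]funext => z do rewrite big_filter.
Qed.

Lemma count_nonzero : \sum_(e <- box r | e != 0) (1 : R) = K - 1.
Proof.
apply/eqP; rewrite eq_sym subr_eq; apply/eqP.
transitivity (\sum_(e <- box r) (1 : R)).
  by rewrite big_const_seq iter_addr_0 count_predT size_box /K.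
rewrite (bigID (fun e => e != 0)) /=; congr (_ + _).
rewrite big_mkcond (bigD1_seq 0) ?box0 ?box_uniq //= ?eqxx /= big1 ?addr0 //.
by move=> e /negbTE ->.
Qed.

Variable x : V -> R.
Hypothesis x01 : forall w, 0 <= x w <= 1.

Let D (e : V) := x (i + e) - x (u + e).

Let D1 e : -1 <= D e <= 1.
Proof. by have := x01 (i + e); have := x01 (u + e); rewrite /D; lra. Qed.

Lemma sqd_obs z : sqd r (obs x z) i u = \sum_(e <- box r | e != 0) D e ^+ 2 +
  \sum_(e <- box r | e != 0) quad 1 1 (-2) (2 * D e) (- 2 * D e) (z (i + e)) (z (u + e)).
Proof.
rewrite -big_split /=; apply: eq_bigr => e _.
by rewrite /obs /D /quad; ring.
Qed.

Lemma sqd_upper_tail (rho DX : R) : 0 < rho -> rho <= 3 / 4 ->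
  \sum_(e <- box r | e != 0) D e ^+ 2 <= DX ->
  ebound Q (fun z => (DX + 2 * (K - 1) * sigma ^+ 2 + rho * K <= sqd r (obs x z) i u)%R%:R)
    (expR (- (rho ^+ 2 * K / (16 * C0)))).
Proof.
move=> rho0 rho1 hDX.
have cf j : [/\ `|1 : R| <= 2, `|1 : R| <= 2, `|-2 : R| <= 2, `|2 * D j| <= 2 & `|- 2 * D j| <= 2].
  by have := D1 j; split; rewrite ler_norml; lra.
apply: ebound_le (@patch_tail (fun e => e != 0) (fun=> 1) (fun=> 1) (fun=> -2)
  (fun e => 2 * D e) (fun e => - 2 * D e) rho cf rho0 rho1) => [|z|z] //.
  apply: measurable_natr; apply: measurable_fun_ler => //; exact: measurable_sqd.
rewrite ler_nat; case h : (_ <= sqd _ _ _ _) => //=.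
rewrite lt0b big_split /= count_nonzero; move: h; rewrite sqd_obs; lra.
Qed.

Lemma sqd_lower_tail (rho DX : R) : 0 < rho -> rho <= 3 / 4 ->
  DX <= \sum_(e <- box r | e != 0) D e ^+ 2 ->
  ebound Q (fun z => (sqd r (obs x z) i u <= DX + 2 * (K - 1) * sigma ^+ 2 - rho * K)%R%:R)
    (expR (- (rho ^+ 2 * K / (16 * C0)))).
Proof.
move=> rho0 rho1 hDX.
have cf j : [/\ `|-1 : R| <= 2, `|-1 : R| <= 2, `|2 : R| <= 2, `|- 2 * D j| <= 2 & `|2 * D j| <= 2].
  by have := D1 j; split; rewrite ler_norml; lra.
apply: ebound_le (@patch_tail (fun e => e != 0) (fun=> -1) (fun=> -1) (fun=> 2)
  (fun e => - 2 * D e) (fun e => 2 * D e) rho cf rho0 rho1) => [|z|z] //.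
  apply: measurable_natr; apply: measurable_fun_ler => //; exact: measurable_sqd.
rewrite ler_nat; case h : (sqd _ _ _ _ <= _) => //=.
rewrite lt0b big_split /= sumrN count_nonzero.
rewrite (_ : \sum_(e <- box r | e != 0) quad _ _ _ _ _ _ _ =
  - \sum_(e <- box r | e != 0) quad 1 1 (-2) (2 * D e) (- 2 * D e) (z (i + e)) (z (u + e))).
  by move: h; rewrite sqd_obs; lra.
by rewrite -sumrN; apply: eq_bigr => e _; rewrite /quad; ring.
Qed.

Lemma measurable_slope : measurable_fun setT (fun z : noise_space R V => slope r x z i u).
Proof.
rewrite (_ : (fun z => _) = (fun z : noise_space R V =>
  \sum_(e <- [seq e <- box r | e != 0]) (obs x z (i + e) - obs x z (u + e)) *
    (z (i + e) - (u + e - i \in box r)%:R * z (u + e)))).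
  2: by apply/funext => z; rewrite big_filter.
apply: measurable_sum => e; apply: measurable_funM; apply: measurable_funB.
- by apply: measurable_funD => //; exact: measurable_coord.
- by apply: measurable_funD => //; exact: measurable_coord.
- exact: measurable_coord.
- by apply: measurable_funM => //; exact: measurable_coord.
Qed.

(** The mean of the slope is [sigma ^+ 2] times the sum of [1 + c e], so an overlap of the two
    patches only raises it above [(K - 1) * sigma ^+ 2]. *)
Lemma slope_lower_tail (rho : R) : 0 < rho -> rho <= 3 / 4 ->
  ebound Q (fun z => (slope r x z i u <= (K - 1) * sigma ^+ 2 - rho * K)%R%:R)
    (expR (- (rho ^+ 2 * K / (16 * C0)))).
Proof.
move=> rho0 rho1; pose c (e : V) : R := (u + e - i \in box r)%:R.
have c01 e : 0 <= c e <= 1 by rewrite /c; case: (_ \in _); rewrite /= ?lexx ?ler01.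
have cf j : [/\ `|-1 : R| <= 2, `|- c j| <= 2, `|1 + c j| <= 2, `|- D j| <= 2 & `|c j * D j| <= 2].
  have := D1 j; have := c01 j; split; rewrite ler_norml; try lra.
  nra.
apply: ebound_le (@patch_tail (fun e => e != 0) (fun=> -1) (fun e => - c e) (fun e => 1 + c e)
  (fun e => - D e) (fun e => c e * D e) rho cf rho0 rho1) => [|z|z] //.
  apply: measurable_natr; apply: measurable_fun_ler => //; exact: measurable_slope.
rewrite ler_nat; case h : (slope _ _ _ _ _ <= _) => //=.
rewrite lt0b big_split /= !sumrN count_nonzero.
rewrite (_ : \sum_(e <- box r | e != 0) quad _ _ _ _ _ _ _ = - slope r x z i u); last first.
  rewrite /slope -sumrN; apply: eq_bigr => e _.
  by rewrite /quad /obs /D -/(c e); ring.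
have : 0 <= (\sum_(e <- box r | e != 0) c e) * sigma ^+ 2.
  by rewrite mulr_ge0 ?sqr_ge0 //; apply: sumr_ge0 => e _; case/andP: (c01 e).
move: h; lra.
Qed.

Lemma norm_lower_tail (rho : R) : 0 < rho -> rho <= 3 / 4 ->
  ebound Q (fun z => (\sum_(e <- box r) z (i + e) ^+ 2 <= K * sigma ^+ 2 - rho * K)%R%:R)
    (expR (- (rho ^+ 2 * K / (16 * C0)))).
Proof.
move=> rho0 rho1.
have cf (j : V) : [/\ `|-1 : R| <= 2, `|0 : R| <= 2, `|0 : R| <= 2, `|0 : R| <= 2 & `|0 : R| <= 2].
  by split; rewrite ler_norml; lra.
apply: ebound_le (@patch_tail predT (fun=> -1) (fun=> 0) (fun=> 0)
  (fun=> 0) (fun=> 0) rho cf rho0 rho1) => [|z|z] //.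
  apply: measurable_natr; apply: measurable_fun_ler => //; apply: measurable_sum => e.
  by apply: measurable_funX; exact: measurable_coord.
rewrite ler_nat; case h : (_ <= _ - _) => //=.
rewrite lt0b big_const_seq iter_addr_0 count_predT size_box.
rewrite (_ : \sum_(e <- box r) quad _ _ _ _ _ _ _ = - \sum_(e <- box r) z (i + e) ^+ 2); last first.
  by rewrite -sumrN; apply: eq_bigr => e _; rewrite /quad; ring.
by move: h; rewrite addr0 -[-1 *+ _]mulr_natr -/K; lra.
Qed.

End quad_patch.
End patch_concentration.

(** * Anticoncentration of the number of selected pixels *)

Lemma expR1_le4 (R : realType) : expR 1 <= 4 :> R.
Proof.
have h : 2^-1 <= expR (- 2^-1) :> R.
  by apply: le_trans (expR_ge1Dx _); lra.
have -> : (1 : R) = 2^-1 + 2^-1 by lra.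
rewrite expRD; have h2 : expR 2^-1 <= 2 :> R.
  by rewrite -[2^-1]opprK expRN -[leRHS]invrK lef_pV2 ?posrE ?expR_gt0.
have := expR_ge0 (2^-1 : R); nra.
Qed.

Lemma dilation_factor_ge (R : realFieldType) (a : R) : 0 <= a ->
  1 - 2 * a <= (1 + a / 2) / (1 + a) ^+ 2.
Proof.
move=> a0; rewrite ler_pdivlMr; last by rewrite exprn_gt0 // ltr_wpDr.
have := exprn_ge0 2 a0; have := exprn_ge0 3 a0; lra.
Qed.

Lemma sume_const (R : realDomainType) (J : Type) (s : seq J) (c : \bar R) :
  (0 <= c)%E -> (\sum_(j <- s) c = (size s)%:R%:E * c)%E.
Proof.
move=> c0; elim: s => [|a s IH]; first by rewrite big_nil mul0e.
by rewrite big_cons IH /= -natr1 EFinD ge0_muleDl ?lee_fin // mul1e addeC.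
Qed.

Section descending_chain.
Context {R : realType}.
Variables (h : pred nat) (A C : nat -> R).
Hypothesis C0 : forall j, 0 <= C j.
Hypothesis AC : forall j k, (j < k)%N -> h j -> h k -> A k <= C j.

(** The nonempty intervals from [C j] to [A j] are stacked, each below the preceding ones, and all
    lie between [0] and [B], so their lengths add up to at most [B]. *)
Lemma chain_gap_sum (J j0 : nat) (B : R) : 0 <= B ->
  (forall j, (j0 <= j)%N -> h j -> A j <= B) ->
  \sum_(j <- iota j0 J | h j) Num.max (A j - C j) 0 <= B.
Proof.
elim: J j0 B => [|J IH] j0 B B0 AB; first by rewrite big_nil.
rewrite /= big_cons; case: ifP => hj0; last first.
  by apply: IH => // j /ltnW; exact: AB.
have [CA|AC0] := lerP (C j0) (A j0).
  rewrite max_l ?subr_ge0 //.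
  have := IH j0.+1 (C j0) (C0 j0) (fun j jj0 hj => AC jj0 hj0 hj).
  have := AB j0 (leqnn _) hj0; lra.
rewrite max_r ?add0r; last by rewrite subr_le0 ltW.
by apply: IH => // j /ltnW; exact: AB.
Qed.

(** Each ratio is at most [1] plus the length of its interval divided by [W]. *)
Lemma chain_ratio_sum (J : nat) (M W : R) : 0 <= M -> 0 < W ->
  (forall j, h j -> A j <= M) ->
  \sum_(j <- iota 0 J | h j) A j / Num.max (C j) W <= J%:R + M / W.
Proof.
move=> M0 W0 AM.
apply: (@le_trans _ _ (\sum_(j <- iota 0 J | h j) (1 + Num.max (A j - C j) 0 / W))).
  apply: ler_sum => j _.
  have m0 : 0 < Num.max (C j) W by rewrite lt_max W0 orbT.
  have Wm : W <= Num.max (C j) W by rewrite le_max lexx orbT.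
  have Cm : C j <= Num.max (C j) W by rewrite le_max lexx.
  have [Am|mA] := lerP (A j) (Num.max (C j) W).
    apply: (@le_trans _ _ 1); first by rewrite ler_pdivrMr // mul1r.
    by rewrite lerDl divr_ge0 ?(ltW W0) // le_max lexx orbT.
  rewrite ler_pdivrMr // mulrDl mul1r.
  have -> : Num.max (A j - C j) 0 = A j - C j.
    by rewrite max_l // subr_ge0 (le_trans Cm) // ltW.
  have : A j - C j <= (A j - C j) / W * Num.max (C j) W.
    rewrite mulrAC -mulrA ler_peMr ?subr_ge0 ?(le_trans Cm (ltW mA)) //.
    by rewrite ler_pdivlMr // mul1r.
  lra.
rewrite big_split /= -mulr_suml; apply: lerD.
  rewrite -big_filter big_const_seq iter_addr_0 count_predT ler_nat size_filter.
  by rewrite -[leqRHS](size_iota 0) count_size.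
by rewrite ler_pM2r ?invr_gt0 //; apply: chain_gap_sum => // j _; exact: AM.
Qed.

End descending_chain.

Section anticoncentration.
Context {R : realType}.
Variable sigma : R.
Hypothesis sigma_gt0 : 0 < sigma.
Variables (Q : probability (noise_space R V) R).
Hypothesis hQ : resamplable (normal_prob 0 sigma) Q.
Variables (x : V -> R) (r : nat) (i : V).

Definition cnt (U : seq V) (T : R) (z : V -> R) : R :=
  \sum_(u <- U) (sqd r (obs x z) i u <= T)%R%:R.

Lemma cnt_ge0 U T z : 0 <= cnt U T z.
Proof. by apply: sumr_ge0 => u _. Qed.

Lemma cnt_le U T T' z : T <= T' -> cnt U T z <= cnt U T' z.
Proof.
move=> TT'; apply: ler_sum => u _; rewrite ler_nat.
by case h : (_ <= T) => //=; rewrite (le_trans h TT').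
Qed.

Lemma measurable_close u T : measurable_fun setT
  (fun z : noise_space R V => (sqd r (obs x z) i u <= T)%R%:R : R).
Proof.
by apply: measurable_natr; apply: measurable_fun_ler => //; exact: measurable_sqd.
Qed.

Lemma measurable_cnt U T : measurable_fun setT (fun z : noise_space R V => cnt U T z).
Proof. by apply: measurable_sum => u; exact: measurable_close. Qed.

Variables (K : R) (U : seq V) (T eta W q s kappa pb : R) (J : nat).
Hypothesis KE : K = ((2 * r).+1 ^ 2)%:R.
Hypotheses (eta_ge0 : 0 <= eta) (W_gt0 : 0 < W) (J_gt0 : (0 < J)%N) (q_gt0 : 0 < q)
  (s_ge0 : 0 <= s) (s_le : s <= sigma ^+ 2).
Hypothesis qJ : J%:R * q <= 2^-1.
Hypothesis qkappa : 2 * eta <= q * kappa.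
Hypothesis density_le : K * (J%:R * q) * (2 * (J%:R * q) + s / sigma ^+ 2) <= 1.
Hypothesis T_ge : eta <= T.

(** The norm of the patch keeps the density of the dilated noise bounded; the slopes make a dilation
    raise every distance except that of [u = i], which is always zero. *)
Let regular (z : V -> R) : bool :=
  (K * sigma ^+ 2 - s * K <= \sum_(e <- box r) z (i + e) ^+ 2) &&
  all (fun u => (u == i) || (kappa <= slope r x z i u)) U.

Hypothesis irregular : ebound Q (fun z => (~~ regular z)%:R) pb.

Let K_gt0 : 0 < K. Proof. by rewrite KE ltr0n expn_gt0. Qed.

Let S := [seq i + e | e <- box r].
Let lam (j : nat) : R := 1 + j%:R * q.
Let ratio z := Num.min (cnt U (T + eta) z) (2 * K) / Num.max (cnt U (T - eta) z) W.

Let lam_ge1 j : 1 <= lam j.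
Proof. by rewrite lerDl mulr_ge0 // ltW. Qed.

Let lam_le2 j : (j < J)%N -> lam j <= 1 + J%:R * q.
Proof. by move=> jJ; rewrite lerD2l ler_pM2r // ler_nat ltnW. Qed.

Let scl_scl (a b : R) z : scl S a (scl S b z) = scl S (a * b) z.
Proof. by apply/funext => w; rewrite /scl; case: (w \in S); rewrite ?mulrA. Qed.

Let sum_S (f : V -> R) : \sum_(w <- S) f w = \sum_(e <- box r) f (i + e).
Proof. by rewrite big_map. Qed.

Let uniq_S : uniq S.
Proof. by rewrite map_inj_uniq ?box_uniq //; exact: addrI. Qed.

(** Since [lam j <= 2], passing from [lam j] to [lam k] is a dilation by at least [1 + q / 2], which
    raises each distance by at least [q * kappa >= 2 * eta]. A distance at most [T + eta] after it
    was thus at most [T - eta] before. For [u = i] the condition [eta <= T] is used. *)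
Let cnt_descends j k z : (j < k)%N -> (k < J)%N -> regular (scl S (lam j) z) ->
  cnt U (T + eta) (scl S (lam k) z) <= cnt U (T - eta) (scl S (lam j) z).
Proof.
move=> jk kJ /andP[_ /allP reg].
rewrite /cnt [leLHS]big_seq [leRHS]big_seq; apply: ler_sum => u uU.
rewrite ler_nat; case h : (_ <= T + eta) => //=; rewrite lt0b.
have := reg u uU; case: eqP => [->|_] /= hs; first by rewrite sqd_self subr_ge0.
have lj := lam_ge1 j; have lj0 : 0 < lam j by lra.
have ljk : lam k = (lam k / lam j) * lam j by rewrite divfK // gt_eqF.
have lq : 1 + q / 2 <= lam k / lam j.
  rewrite ler_pdivlMr //.
  have lj2 : lam j <= 2.
    have h1 : lam j <= 1 + J%:R * q by apply: lam_le2; exact: ltn_trans kJ.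
    by apply: (le_trans h1); move: qJ; move: (J%:R * q) => y; lra.
  have : lam j + q <= lam k.
    by rewrite /lam -addrA lerD2l -{2}(mul1r q) -mulrDl ler_pM2r // natr1 ler_nat.
  have : q * lam j <= q * 2 by rewrite ler_pM2l.
  by move: (lam j) (lam k) => a b; lra.
have l1 : 1 <= lam k / lam j by apply: le_trans lq; have := q_gt0; lra.
have kap0 : 0 <= kappa.
  by rewrite -(pmulr_rge0 _ q_gt0); apply: le_trans qkappa; rewrite mulr_ge0.
move: h; rewrite ljk -scl_scl => h.
have := sqd_scl r x (scl S (lam j) z) i u l1.
have : q * kappa <= 2 * (lam k / lam j - 1) * slope r x (scl S (lam j) z) i u.
  by apply: ler_pM => //; [exact: ltW|move: lq q_gt0; move: (lam k / lam j) => a; lra].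
by rewrite -/S; move: qkappa h; lra.
Qed.

(** With [a = j * q], the logarithm of the density is at most [K * a] minus
    [K * a * (1 - 2 * a - s / sigma ^+ 2)]: on a regular patch the first-order terms cancel. The
    remainder is at most [1] by [density_le]. *)
Let density_bound j z : (j < J)%N -> regular (scl S (lam j) z) ->
  scl_density sigma S (lam j) z <= 4.
Proof.
move=> jJ /andP[hn _].
have lj := lam_ge1 j; have lj0 : 0 < lam j by lra.
set a := j%:R * q; have a0 : 0 <= a by rewrite mulr_ge0 // ltW.
have aJ : a <= J%:R * q by rewrite ler_pM2r // ler_nat ltnW.
have v0 : 0 < sigma ^+ 2 by rewrite exprn_gt0.
have hn2 : K * (sigma ^+ 2 - s) <= lam j ^+ 2 * \sum_(e <- box r) z (i + e) ^+ 2.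
  rewrite mulr_sumr; apply: le_trans (_ : _ <= \sum_(e <- box r) scl S (lam j) z (i + e) ^+ 2) _.
    lra.
  rewrite [leLHS]big_seq [leRHS]big_seq; apply: ler_sum => e he.
  by rewrite /scl map_f // exprMn.
set N := \sum_(e <- box r) z (i + e) ^+ 2 in hn2.
have -> : scl_density sigma S (lam j) z =
    lam j ^+ ((2 * r).+1 ^ 2) * expR (- (lam j ^+ 2 - 1) * N / (2 * sigma ^+ 2)).
  rewrite /scl_density big_split /= big_const_seq count_predT size_map size_box iter_mulr_1.
  by rewrite -expR_sum -mulr_suml -mulr_sumr sum_S.
apply: (@le_trans _ _ (expR (K * a) * expR (- (K * a * (1 - 2 * a - s / sigma ^+ 2))))); last first.
  rewrite -expRD; apply: (@le_trans _ _ (expR 1)).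
    rewrite ler_expR; apply: le_trans density_le.
    rewrite [leLHS](_ : _ = K * a * (2 * a + s / sigma ^+ 2)); last by ring.
    apply: ler_pM; [exact: mulr_ge0 (ltW K_gt0) a0| |by rewrite ler_pM2l|
      by rewrite lerD2r ler_pM2l].
    by apply: addr_ge0; [exact: mulr_ge0|apply: divr_ge0 => //; exact: ltW].
  exact: expR1_le4.
apply: ler_pM; rewrite ?exprn_ge0 ?expR_ge0 ?(ltW lj0) //.
  rewrite KE expRM_natl lerXn2r ?nnegrE ?expR_ge0 ?(ltW lj0) //.
  exact: expR_ge1Dx.
rewrite ler_expR !mulNr lerN2.
have l2 : 0 < lam j ^+ 2 by rewrite exprn_gt0.
have hN : K * (sigma ^+ 2 - s) / lam j ^+ 2 <= N by rewrite ler_pdivrMr // [leRHS]mulrC.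
apply: (@le_trans _ _ ((lam j ^+ 2 - 1) * (K * (sigma ^+ 2 - s) / lam j ^+ 2) / (2 * sigma ^+ 2))); last first.
  rewrite ler_pM2r ?invr_gt0 ?mulr_gt0 //; apply: ler_wpM2l => //.
  by rewrite subr_ge0 -(expr1n _ 2) lerXn2r ?nnegrE ?(ltW lj0).
have -> : (lam j ^+ 2 - 1) * (K * (sigma ^+ 2 - s) / lam j ^+ 2) / (2 * sigma ^+ 2) =
  K * a * ((1 + a / 2) / (1 + a) ^+ 2 * (1 - s / sigma ^+ 2)).
  rewrite /lam -/a; field; rewrite gt_eqF //=; by move: lj0; rewrite /lam -/a => /gt_eqF ->.
apply: ler_wpM2l; first by rewrite mulr_ge0 // ltW.
have b0 : 0 <= s / sigma ^+ 2 by rewrite divr_ge0 // ltW.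
have b1 : s / sigma ^+ 2 <= 1 by rewrite ler_pdivrMr // mul1r.
set b := s / sigma ^+ 2 in b0 b1 *.
have := dilation_factor_ge a0.
set A := _ / _ => hA.
have : (1 - 2 * a) * (1 - b) <= A * (1 - b) by apply: ler_wpM2r => //; rewrite subr_ge0.
have : 0 <= a * b by exact: mulr_ge0.
move: (a) (b) (A) => a' b' A'; lra.
Qed.

Let measurable_regular : measurable_fun setT (fun z : noise_space R V => regular z).
Proof.
apply: measurable_and.
  apply: measurable_fun_ler => //; apply: measurable_sum => e.
  by apply: measurable_funX; exact: measurable_coord.
elim: U => [|u t IH] /=; first exact: measurable_cst.
apply: measurable_and => //; case: (u == i) => /=; first exact: measurable_cst.
by apply: measurable_fun_ler => //; exact: measurable_slope.
Qed.

Let max_gt0 z : 0 < Num.max (cnt U (T - eta) z) W.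
Proof. by rewrite lt_max W_gt0 orbT. Qed.

Let ratio_ge0 z : 0 <= ratio z.
Proof.
by rewrite divr_ge0 ?(ltW (max_gt0 z)) // le_min cnt_ge0 mulr_ge0 // ltW.
Qed.

Let ratio_le z : ratio z <= 2 * K / W.
Proof.
apply: ler_pM.
- by rewrite le_min cnt_ge0 mulr_ge0 // ltW.
- by rewrite invr_ge0 ltW.
- by rewrite ge_min lexx orbT.
- by rewrite lef_pV2 ?posrE // le_max lexx orbT.
Qed.

Let measurable_ratio : measurable_fun setT (fun z : noise_space R V => ratio z).
Proof.
apply: measurable_funM.
  by apply: measurable_minr => //; exact: measurable_cnt.
apply: measurable_invr; last by move=> z; exact: ltW.
by apply: measurable_maxr => //; exact: measurable_cnt.
Qed.

(* Dilating the noise on the patch of [i] by the factors [lam j] moves all the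
   distances across the window [T - eta, T + eta] while the density of the noise
   changes by a bounded factor, so the count is stable for most of the dilations. *)
Lemma ebound_cnt_ratio : ebound Q
  (fun z => Num.min (cnt U (T + eta) z) (2 * K) / Num.max (cnt U (T - eta) z) W)
  (J%:R^-1 * (4 * (J%:R + 2 * K / W)) + 2 * K / W * pb).
Proof.
pose F z := ratio z * (regular z)%:R.
have KW0 : 0 <= 2 * K / W by rewrite divr_ge0 ?mulr_ge0 ?(ltW K_gt0) ?(ltW W_gt0).
have mF : measurable_fun setT (fun z : noise_space R V => F z).
  by apply: measurable_funM => //; exact: measurable_natr.
have F0 z : 0 <= F z by rewrite mulr_ge0.
suff hF : ebound Q F (J%:R^-1 * (4 * (J%:R + 2 * K / W))).
  apply: ebound_le (ebound_add hF (ebound_scale KW0 irregular)) => [|z|z] //.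
    exact: ratio_ge0.
  have := ratio_le z; have := ratio_ge0 z; rewrite -/(ratio z) /F.
  case: (regular z) => /=; lra.
split => //; rewrite EFinM lee_pdivlMl ?ltr0n //.
have mFj j : measurable_fun setT (fun z : noise_space R V => F (scl S (lam j) z)).
  by apply: (measurableT_comp mF); exact: measurable_scl.
(* Every dilation represents the same integral up to the factor [4]; averaging over [j] therefore
   replaces a statement about the law by the deterministic chain bound at each fixed [z]. *)
have FJ j : (j < J)%N -> (\int[Q]_z (F z)%:E <= \int[Q]_z (4 * F (scl S (lam j) z))%:E)%E.
  move=> jJ; have lj := lam_ge1 j; have lj0 : 0 < lam j by lra.
  rewrite (integral_scl sigma_gt0 hQ uniq_S lj0 (F := fun z => (F z)%:E)) //; last exact/measurable_EFinP.
  apply: ge0_le_integral => //.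
  - by move=> z _; rewrite -EFinM lee_fin mulr_ge0 // scl_density_ge0 // ltW.
  - apply: emeasurable_funM; apply/measurable_EFinP => //.
    exact: measurable_scl_density.
  - by apply/measurable_EFinP; apply: measurable_funM.
  - move=> z _; rewrite -EFinM lee_fin mulrC.
    case reg : (regular (scl S (lam j) z)); last by rewrite /F reg mulr0 !mulr0.
    by apply: ler_wpM2r => //; exact: density_bound.
have chain (z : noise_space R V) :
    \sum_(j <- iota 0 J) 4 * F (scl S (lam j) z) <= 4 * (J%:R + 2 * K / W).
  rewrite -mulr_sumr ler_pM2l //.
  rewrite (_ : \sum_(j <- iota 0 J) _ = \sum_(j <- iota 0 J | (j < J)%N && regular (scl S (lam j) z))
    ratio (scl S (lam j) z)); last first.
    rewrite [RHS]big_mkcond; apply: eq_big_seq => j; rewrite mem_iota add0n /= => ->.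
    by rewrite /F; case: (regular _); rewrite ?mulr1 ?mulr0.
  apply: (@chain_ratio_sum _ (fun j => (j < J)%N && regular (scl S (lam j) z))
    (fun j => Num.min (cnt U (T + eta) (scl S (lam j) z)) (2 * K))
    (fun j => cnt U (T - eta) (scl S (lam j) z))) => //.
  - by move=> j; exact: cnt_ge0.
  - move=> j k jk /andP[_ rj] /andP[kJ _].
    by apply: le_trans (cnt_descends jk kJ rj); rewrite ge_min lexx.
  - by rewrite mulr_ge0 // ltW.
  - by move=> j _; rewrite ge_min lexx orbT.
have [_ _] : ebound Q (fun z => \sum_(j <- iota 0 J) 4 * F (scl S (lam j) z))
    (4 * (J%:R + 2 * K / W)).
  have c0 : 0 <= 4 * (J%:R + 2 * K / W) by rewrite mulr_ge0 // addr_ge0.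
  apply: ebound_le (ebound_cst _ c0) => [|z|z] //.
    by apply: measurable_sum => j; apply: measurable_funM.
  by apply: sumr_ge0 => j _; rewrite mulr_ge0.
apply: le_trans.
under [leRHS]eq_integral do rewrite -sumEFin.
rewrite ge0_integral_sum //; last 2 first.
- by move=> j; apply/measurable_EFinP; apply: measurable_funM.
- by move=> j z _; rewrite lee_fin mulr_ge0.
have -> : (J%:R%:E * \int[Q]_z (F z)%:E = \sum_(j <- iota 0 J) \int[Q]_z (F z)%:E)%E.
  by rewrite sume_const ?size_iota // integral_ge0 // => z _; rewrite lee_fin.
rewrite [leLHS]big_seq [leRHS]big_seq; apply: lee_sum => j.
by rewrite mem_iota add0n => /= jJ; exact: FJ.
Qed.

End anticoncentration.

(** * Weighted noise at a single pixel *)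

Section bounded_weighted_noise.
Context {R : realType}.
Variable sigma : R.
Hypothesis sigma_gt0 : 0 < sigma.
Variables (Q : probability (noise_space R V) R).
Local Notation gam := (normal_prob 0 sigma).
Hypothesis hQ : resamplable gam Q.
Variables (x : V -> R) (r : nat) (i : V) (S : seq V).
Hypothesis x01 : forall w, 0 <= x w <= 1.
Hypotheses (uniq_S : uniq S) (iS : i \in S).
Variables (K T B W e1 tB c2 c4 rho1 rhoS : R).
Hypothesis KE : K = ((2 * r).+1 ^ 2)%:R.
Hypotheses (B_ge1 : 1 <= B) (W_gt0 : 0 < W).

Local Notation cnt := (cnt x r i).
Local Notation near := (fun v : V => v - i \in box r).
Local Notation U1 := [seq u <- S | near u].
Local Notation U2 := [seq u <- S | ~~ near u].
Local Notation eta := (18 * B).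
Local Notation w := (fun v (z : V -> R) => (sqd r (obs x z) i v <= T)%R%:R : R).

Let small (y : R) := y ^+ 2 <= B.
Let large (y : R) := B < y ^+ 2.
(** The patches of the pixels near [i] stay within [box (2 * r)] around [i], so this event controls
    all of them. Its failure has probability of order [K * tB], without any power of [n]. *)
Let calm (z : V -> R) := all (fun e => small (z (i + e))) (box (2 * r)).

Hypothesis few_near : ebound Q (fun z => (cnt U1 (T - eta) z < W)%R%:R) e1.
Hypothesis second_large : (\int[gam]_y (y ^+ 2 * (large y)%:R)%:E <= tB%:E)%E.
Hypothesis prob_large : forall v, ebound Q (fun z => (large (z v))%:R) tB.
Hypothesis second_small : (\int[gam]_y (y ^+ 2 * (small y)%:R)%:E <= c2%:E)%E.
Hypothesis prob_small : ((2^-1)%:E <= \int[gam]_y ((small y)%:R)%:E)%E.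
Hypothesis fourth_moment : forall v, ebound Q (fun z => z v ^+ 4) c4.
Hypothesis ratio_near : ebound Q (fun z =>
  Num.min (cnt U1 (T + eta) z) (2 * K) / Num.max (cnt U1 (T - eta) z) W) rho1.
Hypothesis ratio_all : ebound Q (fun z =>
  Num.min (cnt S (T + eta) z) (2 * K) / Num.max (cnt S (T - eta) z) W) rhoS.

Let eta_ge0 : 0 <= eta. Proof. by have := B_ge1; lra. Qed.
Let K_gt0 : 0 < K. Proof. by rewrite KE ltr0n expn_gt0. Qed.

Let m_small : measurable_fun setT small.
Proof. by apply: measurable_fun_ler => //; exact: measurable_funX. Qed.

Let m_large : measurable_fun setT large.
Proof. by apply: measurable_fun_ltr => //; exact: measurable_funX. Qed.

Let m_sqr : measurable_fun setT (fun y : R => y ^+ 2).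
Proof. exact: measurable_funX. Qed.

Let m_calm : measurable_fun setT (fun z : noise_space R V => calm z).
Proof.
rewrite /calm; elim: (box (2 * r)) => [|e t IH] /=; first exact: measurable_cst.
apply: measurable_and => //; apply: (measurableT_comp m_small).
exact: measurable_coord.
Qed.

Let m_max (f : noise_space R V -> R) : measurable_fun setT f ->
  measurable_fun setT (fun z => (Num.max (f z) W)^-1).
Proof.
move=> mf; apply: measurable_invr; first exact: measurable_maxr.
by move=> z; rewrite le_max (ltW W_gt0) orbT.
Qed.

Let invmax_ge0 (a : R) : 0 <= (Num.max a W)^-1.
Proof. by rewrite invr_ge0 le_max (ltW W_gt0) orbT. Qed.

#[local] Hint Resolve invmax_ge0 : core.

Let split_near (f : V -> R) : \sum_(v <- S) f v = \sum_(v <- U1) f v + \sum_(v <- U2) f v.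
Proof. by rewrite !big_filter [LHS](bigID (fun v => near v)). Qed.

Let calm_upd v z y y' : small y -> small y' -> calm (upd z v y) -> calm (upd z v y').
Proof.
move=> sy sy' /allP c; apply/allP => e eb; have := c e eb.
by rewrite /upd; case: eqP.
Qed.

Let upd_off (v : V) (z : V -> R) (y y' : R) u : u != v -> upd z v y u = upd z v y' u.
Proof. by move=> uv; rewrite !upd_other. Qed.

Let box_double u e : near u -> e \in box r -> u + e - i \in box (2 * r).
Proof. by rewrite !mem_box /=; lia. Qed.

Let calmP z u : calm z -> u - i \in box (2 * r) -> z u ^+ 2 <= B.
Proof. by move=> /allP c ub; have := c _ ub; rewrite addrC subrK. Qed.

Let box_sub e : e \in box r -> i + e - i \in box (2 * r).
Proof. by rewrite !mem_box /=; lia. Qed.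

Let sqd_near v u z y y' : near u -> calm (upd z v y) -> calm (upd z v y') ->
  sqd r (obs x (upd z v y)) i u <= sqd r (obs x (upd z v y')) i u + eta.
Proof.
move=> nu c _; apply: (sqd_local x01 B_ge1 (@upd_off v z y y')) => e eb _ _.
by split; apply: (calmP c); [exact: box_sub|exact: box_double].
Qed.

(** As [v] is off the patch of [i], a summand that changes has [u + e = v]; there the noise at
    [i + e] is controlled by [calm] and that at [v] is small, so [u] may be any pixel. *)
Let sqd_far v u z y y' : ~~ near v -> small y -> calm (upd z v y) ->
  sqd r (obs x (upd z v y)) i u <= sqd r (obs x (upd z v y')) i u + eta.
Proof.
move=> nv sy c; apply: (sqd_local x01 B_ge1 (@upd_off v z y y')) => e eb _.
case/orP => /eqP E.
  by move: nv; rewrite -E [i + e]addrC addrK eb.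
by split; [apply: (calmP c); exact: box_sub|rewrite E upd_same].
Qed.

Let w_far v z y y' : ~~ near v -> w v (upd z v y) = w v (upd z v y').
Proof.
move=> nv; congr (_ <= _)%R%:R; apply: (sqd_indep x (@upd_off v z y y')) => //.
by rewrite eqxx orbT.
Qed.

(** Only the weights of pixels whose patch contains [v] can change, and there are at most [K] of
    them. *)
Let cnt_far U v z y y' : uniq U -> ~~ near v ->
  cnt U T (upd z v y) <= cnt U T (upd z v y') + K.
Proof.
move=> uU nv; rewrite KE.
apply: le_trans (_ : cnt U T (upd z v y') + \sum_(u <- U) (v - u \in box r)%:R <= _); last first.
  by rewrite lerD2l count_box_le.
rewrite -big_split /=; apply: ler_sum => u _.
case vu : (v - u \in box r) => /=; last first.
  by rewrite addr0 (sqd_indep x (@upd_off v z y y')) // vu.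
by case: (_ <= T); case: (_ <= T); rewrite /= ?addr0 ?add0r //; lra.
Qed.

(** With [m = size S], on the bad event [z v ^+ 2 <= m^-1 * z v ^+ 4 + m]. Summing over [S] gives
    the factor [(size S) ^+ 2] that [e1] has to beat. *)
Let bound_bad : ebound Q (fun z => (cnt U1 (T - eta) z < W)%R%:R * \sum_(v <- S) z v ^+ 2)
  (c4 + (size S)%:R ^+ 2 * e1).
Proof.
set m := (size S)%:R : R.
have m0 : 0 < m by rewrite ltr0n lt0n size_eq0; apply/eqP => E; move: iS; rewrite E.
have h v : v \in S -> ebound Q (fun z => m^-1 * z v ^+ 4 + m * (cnt U1 (T - eta) z < W)%R%:R)
   (m^-1 * c4 + m * e1).
  by move=> _; apply: ebound_add; apply: ebound_scale => //; rewrite ?invr_ge0 ltW.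
have [mb b0 _] := few_near.
apply: ebound_weaken; last apply: ebound_le (ebound_sum_cst h) => [|z|z].
- by rewrite -/m mulrDr !mulrA mulfV ?gt_eqF // mul1r.
- apply: measurable_funM => //; apply: measurable_sum => v.
  by apply: measurable_funX; exact: measurable_coord.
- by rewrite mulr_ge0 // sumr_ge0 // => v _; exact: sqr_ge0.
- rewrite mulr_sumr; apply: ler_sum => v _; case: (_ < _) => /=; last first.
    by rewrite mul0r mulr0 addr0 mulr_ge0 ?invr_ge0 ?(ltW m0) // exprn_even_ge0.
  rewrite mul1r mulr1; have := sqr_ge0 (m^-1 * z v ^+ 2 - 1).
  have mV : m * m^-1 = 1 by rewrite mulfV // gt_eqF.
  have -> : m^-1 * z v ^+ 4 + m = m * ((m^-1 * z v ^+ 2) ^+ 2 + 1).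
    rewrite (_ : z v ^+ 4 = (z v ^+ 2) ^+ 2) -?exprM // mulrDr mulr1 exprMn expr2.
    by rewrite !mulrA mV mul1r.
  move=> h2; rewrite -[leLHS]mul1r -mV -mulrA ler_pM2l //.
  have : 0 <= m^-1 * z v ^+ 2 by rewrite mulr_ge0 ?sqr_ge0 // invr_ge0 ltW.
  move: h2; move: (m^-1 * _) => a; nra.
Qed.

Let bound_near_large : ebound Q
  (fun z => \sum_(v <- U1) W^-1 * (z v ^+ 2 * (large (z v))%:R)) (tB / 1 * (K / W)).
Proof.
apply: (ebound_decouple_sum (f := fun y => y ^+ 2) (A := large)
  (X := fun v z => W^-1) (Y := fun v z => W^-1) hQ
  (A' := fun=> true)) => //.
- by move=> v _; split => // *; rewrite invr_ge0 ltW.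
- by move=> y; exact: sqr_ge0.
- have -> : (\int[gam]_y (true%:R)%:E = \int[gam]_(y in setT) (cst 1%:E) y)%E by [].
  by rewrite integral_cst // mul1e [leRHS]probability_setT.
- have KW0 : 0 <= K / W by rewrite divr_ge0 ?ltW.
  apply: ebound_le (ebound_cst _ KW0) => [|z|z]; first exact: measurable_sum.
    by apply: sumr_ge0 => v _; rewrite invr_ge0 ltW.
  rewrite big_const_seq iter_addr_0 count_predT -[leLHS]mulr_natl ler_pM2r ?invr_gt0 //.
  rewrite KE ler_nat -size_box.
  rewrite -(size_map (fun u => u - i)); apply: uniq_leq_size.
    by rewrite map_inj_uniq ?filter_uniq //; exact: addIr.
  by move=> _ /mapP[u + ->]; rewrite mem_filter => /andP[].
Qed.

(** Large noise is outside the reach of [calm], but the weight of a far pixel is independent of its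
    own noise and the count [N] varies by at most [K]. Replacing [N] by the maximum of [N - K] and
    [W] decouples without truncation and costs the factor [1 + K / W], for which [tB]
    compensates. *)
Let bound_far_large : ebound Q
  (fun z => \sum_(v <- U2) (w v z / Num.max (cnt S T z) W) * (z v ^+ 2 * (large (z v))%:R))
  (tB / 1 * (1 + K / W)).
Proof.
apply: (ebound_decouple_sum (f := fun y => y ^+ 2) (A := large)
  (X := fun v z => w v z / Num.max (cnt S T z) W)
  (Y := fun v z => w v z / Num.max (cnt S T z - K) W) hQ (A' := fun=> true)) => //.
- move=> v; rewrite mem_filter => /andP[nv vS]; split.
  + apply: measurable_funM; first exact: measurable_close.
    by apply: m_max; exact: measurable_cnt.
  + by move=> z; rewrite mulr_ge0.
  + apply: measurable_funM; first exact: measurable_close.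
    by apply: m_max; apply: measurable_funB => //; exact: measurable_cnt.
  + by move=> z; rewrite mulr_ge0.
  + move=> z y y' _ _; rewrite (w_far z y y' nv) ler_wpM2l //.
    rewrite lef_pV2 ?posrE ?lt_max ?W_gt0 ?orbT // ge_max !le_max lexx orbT andbT.
    by rewrite lerBlDr (cnt_far z y' y uniq_S nv).
- by move=> y; exact: sqr_ge0.
- have -> : (\int[gam]_y (true%:R)%:E = \int[gam]_(y in setT) (cst 1%:E) y)%E by [].
  by rewrite integral_cst // mul1e [leRHS]probability_setT.
- have c0 : 0 <= 1 + K / W by rewrite addr_ge0 // divr_ge0 ?ltW.
  apply: ebound_le (ebound_cst _ c0) => [|z|z].
  + apply: measurable_sum => v; apply: measurable_funM; first exact: measurable_close.
    by apply: m_max; apply: measurable_funB => //; exact: measurable_cnt.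
  + by apply: sumr_ge0 => v _; rewrite mulr_ge0.
  rewrite -mulr_suml.
  have cN : \sum_(v <- U2) w v z <= cnt S T z.
    by rewrite /cnt split_near lerDr sumr_ge0.
  have m0 : 0 < Num.max (cnt S T z - K) W by rewrite lt_max W_gt0 orbT.
  rewrite ler_pdivrMr //; apply: (le_trans cN).
  have [NK|NK] := leP (cnt S T z - K) W.
    by rewrite mulrDl mul1r divfK ?gt_eqF //; lra.
  rewrite mulrDl mul1r -lerBlDl opprB addrC subrK mulrAC -mulrA ler_peMr ?(ltW K_gt0) //.
  by rewrite ler_pdivlMr // mul1r ltW.
Qed.

Let bound_not_calm : ebound Q (fun z => B * (~~ calm z)%:R)
  (B * (((2 * (2 * r)).+1 ^ 2)%:R * tB)).
Proof.
apply: ebound_scale; first by have := B_ge1; lra.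
rewrite -size_box.
apply: ebound_le (ebound_sum_cst (fun e _ => prob_large (i + e))) => [|z|z] //.
  by apply: measurable_natr; apply: measurable_neg.
case c : (calm z) => /=; first exact: sumr_ge0.
have /allPn[e eb] : ~~ calm z by rewrite c.
rewrite -ltNge => le_.
rewrite (bigD1_seq e) ?box_uniq //= /large le_ lerDl.
exact: sumr_ge0.
Qed.

(** The denominator counts near pixels only: for a far [u] the resampled noise at [v] is compared
    with noise at [u + e], which [calm] does not control. The truncation at [2 * K] is harmless
    because there are at most [K] near pixels. *)
Let bound_near_small : ebound Q
  (fun z => \sum_(v <- U1) ((calm z)%:R * w v z / Num.max (cnt U1 T z) W) *
      (z v ^+ 2 * (small (z v))%:R)) (c2 / 2^-1 * rho1).
Proof.
apply: (ebound_decouple_sum (f := fun y => y ^+ 2) (A := small)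
  (X := fun v z => (calm z)%:R * w v z / Num.max (cnt U1 T z) W)
  (Y := fun v z => (calm z)%:R * (sqd r (obs x z) i v <= T + eta)%R%:R /
     Num.max (cnt U1 (T - eta) z) W) hQ (A' := small)) => //.
- move=> v; rewrite mem_filter => /andP[nv vS]; split.
  + apply: measurable_funM; last by apply: m_max; exact: measurable_cnt.
    by apply: measurable_funM; [exact: measurable_natr|exact: measurable_close].
  + by move=> z; rewrite !mulr_ge0.
  + apply: measurable_funM; last by apply: m_max; exact: measurable_cnt.
    by apply: measurable_funM; [exact: measurable_natr|exact: measurable_close].
  + by move=> z; rewrite !mulr_ge0.
  + move=> z y y' sy sy'; case c : (calm (upd z v y)); last by rewrite !mul0r !mulr_ge0.
    have c' : calm (upd z v y') by exact: calm_upd c.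
    rewrite c' !mul1r; apply: ler_pM => //.
      rewrite ler_nat; case h : (_ <= T) => //=.
      by rewrite (le_trans (sqd_near nv c' c)) // lerD2r.
    rewrite lef_pV2 ?posrE ?lt_max ?W_gt0 ?orbT // ge_max !le_max lexx orbT andbT.
    apply/orP; left; rewrite /cnt [leLHS]big_seq [leRHS]big_seq; apply: ler_sum => u.
    rewrite mem_filter => /andP[nu _]; rewrite ler_nat.
    case h : (_ <= T - eta) => //=.
    by rewrite lt0b (le_trans (sqd_near nu c c')) // -lerBrDr.
- by move=> y; exact: sqr_ge0.
- apply: ebound_le ratio_near => [|z|z].
  + apply: measurable_sum => v; apply: measurable_funM; last by apply: m_max; exact: measurable_cnt.
    by apply: measurable_funM; [exact: measurable_natr|exact: measurable_close].
  + by apply: sumr_ge0 => v _; rewrite !mulr_ge0.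
  rewrite -mulr_suml -mulr_sumr; apply: ler_wpM2r => //.
  rewrite -/(cnt U1 (T + eta) z) le_min; apply/andP; split.
    by case: (calm z); rewrite ?mul1r // mul0r cnt_ge0.
  apply: (@le_trans _ _ (cnt U1 (T + eta) z)).
    by case: (calm z); rewrite ?mul1r // mul0r cnt_ge0.
  apply: (@le_trans _ _ K); last by have := K_gt0; lra.
  rewrite KE -size_box.
  apply: (@le_trans _ _ (size U1)%:R).
    rewrite -sum1_size natr_sum; apply: ler_sum => u _; by case: (_ <= T + eta).
  rewrite ler_nat -(size_map (fun u => u - i)); apply: uniq_leq_size.
    by rewrite map_inj_uniq ?filter_uniq //; exact: addIr.
  by move=> _ /mapP[u + ->]; rewrite mem_filter => /andP[].
Qed.

(** [den] combines two lower bounds for the resampled count. If the count exceeds [2 * K], a change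
    by at most [K] costs a factor [2]; otherwise the thresholds [T + eta] and [T - eta] are
    compared, and the truncation in [ratio_all] does no harm. That truncation keeps the ratio below
    [2 * K / W] even for irregular noise. *)
Let bound_far_small : ebound Q
  (fun z => \sum_(v <- U2) ((calm z)%:R * w v z / Num.max (cnt S T z) W) *
      (z v ^+ 2 * (small (z v))%:R)) (c2 / 2^-1 * (2 + rhoS)).
Proof.
pose den z := Num.max (Num.max (cnt S (T - eta) z) (cnt S T z - K)) W.
have mden : measurable_fun setT (fun z : noise_space R V => (den z)^-1).
  apply: m_max; apply: measurable_maxr; first exact: measurable_cnt.
  by apply: measurable_funB => //; exact: measurable_cnt.
apply: (ebound_decouple_sum (f := fun y => y ^+ 2) (A := small)
  (X := fun v z => (calm z)%:R * w v z / Num.max (cnt S T z) W)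
  (Y := fun v z => (calm z)%:R * w v z / den z) hQ (A' := small)) => //.
- move=> v; rewrite mem_filter => /andP[nv vS]; split.
  + apply: measurable_funM; last by apply: m_max; exact: measurable_cnt.
    by apply: measurable_funM; [exact: measurable_natr|exact: measurable_close].
  + by move=> z; rewrite !mulr_ge0.
  + apply: measurable_funM => //.
    by apply: measurable_funM; [exact: measurable_natr|exact: measurable_close].
  + by move=> z; rewrite !mulr_ge0 // invmax_ge0.
  + move=> z y y' sy sy'; case c : (calm (upd z v y)); last first.
      by rewrite !mul0r !mulr_ge0 // invmax_ge0.
    have c' : calm (upd z v y') by exact: calm_upd c.
    rewrite c' !mul1r (w_far z y y' nv) ler_wpM2l //.
    rewrite lef_pV2 ?posrE ?lt_max ?W_gt0 ?orbT // ge_max ge_max !le_max lexx orbT andbT.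
    apply/andP; split; apply/orP; left.
      apply: ler_sum => u _; rewrite ler_nat; case h : (_ <= T - eta) => //=.
      by rewrite lt0b (le_trans (sqd_far u y' nv sy c)) // -lerBrDr.
    by rewrite lerBlDr (cnt_far z y' y uniq_S nv).
- by move=> y; exact: sqr_ge0.
- apply: ebound_le (ebound_add (ebound_cst Q (ler0n R 2)) ratio_all) => [|z|z].
  + apply: measurable_sum => v; apply: measurable_funM => //.
    by apply: measurable_funM; [exact: measurable_natr|exact: measurable_close].
  + by apply: sumr_ge0 => v _; rewrite !mulr_ge0 // invmax_ge0.
  rewrite -mulr_suml -mulr_sumr.
  have den0 : 0 < den z by rewrite lt_max W_gt0 orbT.
  have max0 : 0 < Num.max (cnt S (T - eta) z) W by rewrite lt_max W_gt0 orbT.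
  have min0 : 0 <= Num.min (cnt S (T + eta) z) (2 * K).
    by rewrite le_min cnt_ge0 mulr_ge0 // ltW.
  have cN : (calm z)%:R * (\sum_(v <- U2) w v z) <= cnt S T z.
    apply: (@le_trans _ _ (\sum_(v <- U2) w v z)).
      by case: (calm z); rewrite ?mul1r // mul0r sumr_ge0.
    by rewrite /cnt split_near lerDr sumr_ge0.
  apply: (@le_trans _ _ (cnt S T z / den z)); first by rewrite ler_pM2r // invr_gt0.
  have [NK|NK] := leP (2 * K) (cnt S T z).
    apply: (@le_trans _ _ 2); last by rewrite lerDl divr_ge0 // ltW.
    rewrite ler_pdivrMr //.
    have : cnt S T z - K <= den z by rewrite !le_max lexx orbT.
    lra.
  apply: ler_wpDl => //; apply: ler_pM => //; first exact: cnt_ge0.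
  + by rewrite invr_ge0 ltW.
  + by rewrite le_min (ltW NK) andbT cnt_le // lerDl.
  + rewrite lef_pV2 ?posrE // ge_max /den !le_max !lexx ?orbT //=.
Qed.

Lemma ebound_weighted_noise :
  ebound Q (fun z => (\sum_(v <- S) w v z * z v ^+ 2) / cnt S T z)
   (c4 + (size S)%:R ^+ 2 * e1 + tB / 1 * (K / W) + tB / 1 * (1 + K / W) +
    B * (((2 * (2 * r)).+1 ^ 2)%:R * tB) + c2 / 2^-1 * rho1 + c2 / 2^-1 * (2 + rhoS)).
Proof.
have B0 : 0 <= B by have := B_ge1; lra.
have mw v : measurable_fun setT (fun z : noise_space R V => w v z * z v ^+ 2).
  apply: measurable_funM; first exact: measurable_close.
  by apply: measurable_funX; exact: measurable_coord.
have F0 z : 0 <= (\sum_(v <- S) w v z * z v ^+ 2) / cnt S T z.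
  by rewrite divr_ge0 ?cnt_ge0 // sumr_ge0 // => v _; rewrite mulr_ge0 // sqr_ge0.
apply: ebound_le (ebound_add (ebound_add (ebound_add (ebound_add (ebound_add bound_bad
  bound_near_large) bound_far_large) bound_not_calm) bound_near_small) bound_far_small) => //.
  apply: measurable_funM; first exact: measurable_sum.
  by apply: measurable_invr; [exact: measurable_cnt|move=> z; exact: cnt_ge0].
move=> z; set N := cnt S T z.
have nl0 v : 0 <= z v ^+ 2 * (large (z v))%:R by rewrite mulr_ge0 ?sqr_ge0.
have ns0 v : 0 <= z v ^+ 2 * (small (z v))%:R by rewrite mulr_ge0 ?sqr_ge0.
set a := _ * \sum_(v <- S) _; set b := \sum_(v <- U1) _; set c := \sum_(v <- U2) _.
set d := B * _; set e := \sum_(v <- U1) _; set f := \sum_(v <- U2) _.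
have a0 : 0 <= a by rewrite mulr_ge0 // sumr_ge0 // => v _; exact: sqr_ge0.
have b0 : 0 <= b by apply: sumr_ge0 => v _; rewrite mulr_ge0 // invr_ge0 ltW.
have c0 : 0 <= c by apply: sumr_ge0 => v _; rewrite mulr_ge0 // mulr_ge0.
have d0 : 0 <= d by rewrite mulr_ge0.
have e0 : 0 <= e by apply: sumr_ge0 => v _; rewrite mulr_ge0 // mulr_ge0 // mulr_ge0.
have f0 : 0 <= f by apply: sumr_ge0 => v _; rewrite mulr_ge0 // mulr_ge0 // mulr_ge0.
(* On the bad event nothing is known about [N], but every [w v z / N] is at most [1], also when
   [w v z = 0]. *)
have [bad|good] := ltP (cnt U1 (T - eta) z) W.
  suff : (\sum_(v <- S) w v z * z v ^+ 2) / N <= a by lra.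
  rewrite /a bad mul1r mulr_suml [leLHS]big_seq [leRHS]big_seq; apply: ler_sum => v vS.
  rewrite mulrAC -[leRHS]mul1r ler_wpM2r ?sqr_ge0 //.
  have wN : w v z <= N by rewrite /N /cnt (bigD1_seq v) //= lerDl sumr_ge0.
  have [->|/eqP w0] := w v z =P 0; first by rewrite mul0r.
  rewrite ler_pdivrMr ?mul1r //; apply: lt_le_trans wN.
  by rewrite lt_neqAle eq_sym w0 /=.
have N1 : cnt U1 T z <= N by rewrite /N /cnt split_near lerDl sumr_ge0.
have WN1 : W <= cnt U1 T z.
  by apply: (le_trans good); apply: cnt_le; rewrite lerBlDr lerDl.
have WN : W <= N by exact: le_trans N1.
have N0 : 0 < N by exact: lt_le_trans WN.
have maxN : Num.max N W = N by rewrite max_l.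
have maxN1 : Num.max (cnt U1 T z) W = cnt U1 T z by rewrite max_l.
have sl v : z v ^+ 2 = z v ^+ 2 * (large (z v))%:R + z v ^+ 2 * (small (z v))%:R.
  by rewrite -mulrDr /large /small ltNge; case: (_ <= B); rewrite /= ?addr0 ?add0r mulr1.
have w1 v : w v z <= 1 by case: (_ <= T).
have -> : (\sum_(v <- S) w v z * z v ^+ 2) / N =
    \sum_(v <- U1) w v z / N * (z v ^+ 2 * (large (z v))%:R) +
    \sum_(v <- U2) w v z / N * (z v ^+ 2 * (large (z v))%:R) +
    \sum_(v <- S) w v z / N * (z v ^+ 2 * (small (z v))%:R).
  rewrite -split_near -big_split /= mulr_suml; apply: eq_bigr => v _.
  by rewrite -mulrDr -sl mulrAC.
have hb : \sum_(v <- U1) w v z / N * (z v ^+ 2 * (large (z v))%:R) <= b.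
  apply: ler_sum => v _; apply: ler_wpM2r => //.
  by rewrite -[leRHS]mul1r; apply: ler_pM => //; rewrite ?invr_ge0 ?(ltW N0) // lef_pV2 ?posrE.
have hc : \sum_(v <- U2) w v z / N * (z v ^+ 2 * (large (z v))%:R) <= c.
  by rewrite /c -/N maxN.
suff : \sum_(v <- S) w v z / N * (z v ^+ 2 * (small (z v))%:R) <= d + e + f by lra.
have [calmz|ncalm] := boolP (calm z).
  rewrite split_near.
  have he : \sum_(v <- U1) w v z / N * (z v ^+ 2 * (small (z v))%:R) <= e.
    apply: ler_sum => v _; apply: ler_wpM2r => //.
    rewrite calmz mul1r maxN1 ler_wpM2l // lef_pV2 ?posrE //.
    exact: lt_le_trans WN1.
  have hf : \sum_(v <- U2) w v z / N * (z v ^+ 2 * (small (z v))%:R) <= f.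
    by apply: ler_sum => v _; rewrite calmz mul1r -/N maxN.
  lra.
(* Without [calm], the truncated squares are still at most [B], and the weights [w v z / N] sum to
   [1]. *)
suff : \sum_(v <- S) w v z / N * (z v ^+ 2 * (small (z v))%:R) <= d by lra.
rewrite (_ : d = \sum_(v <- S) w v z / N * B); last first.
  by rewrite -mulr_suml -mulr_suml -/(cnt S T z) mulfV ?lt0r_neq0 // mul1r /d ncalm mulr1.
apply: ler_sum => v _; apply: ler_wpM2l; first by rewrite divr_ge0 ?(ltW N0).
by rewrite /small; case: (leP (z v ^+ 2) B) => h; rewrite ?mulr1 // mulr0.
Qed.

End bounded_weighted_noise.

(** * Moments and tails of the normal law *)

Section gaussian_moments.
Context {R : realType}.
Variable sigma : R.
Hypothesis sigma_gt0 : 0 < sigma.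
Local Notation gam := (normal_prob 0 sigma).
(** Here [a * sigma ^+ 2 = 8^-1], the largest value that [normal_exp_quadratic_le] admits. Moments
    and tails are obtained by dominating the integrand by a multiple of [expR (a * y ^+ 2)]. *)
Let a : R := (8 * sigma ^+ 2)^-1.
Let a_gt0 : 0 < a. Proof. by rewrite invr_gt0 mulr_gt0 // exprn_gt0. Qed.

(** One expression for both tails beyond [B]: [64 * sigma ^+ 2] serves the second moment and [4] the
    probability. *)
Definition tail_moment (B : R) : R :=
  (64 * sigma ^+ 2 + 4) * expR (- (B / (16 * sigma ^+ 2))).

Let exp_moment : (\int[gam]_y (expR (a * y ^+ 2))%:E <= 4%:E)%E.
Proof.
have as2 : a * sigma ^+ 2 = 8^-1.
  by rewrite /a invfM -mulrA mulVf ?mulr1 // gt_eqF // exprn_gt0.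
have h : `|a| * sigma ^+ 2 <= 8^-1 by rewrite ger0_norm ?(ltW a_gt0) // as2.
have := normal_exp_quadratic_le 0 sigma_gt0 h.
under eq_integral do rewrite mul0r addr0.
move/le_trans; apply; rewrite lee_fin as2; apply: le_trans (@expR1_le4 R).
by rewrite ler_expR; lra.
Qed.

Let normal_bound (f : R -> R) (b : R) : measurable_fun setT f -> (forall y, 0 <= f y) ->
  0 <= b -> (forall y, f y <= b * expR (a * y ^+ 2)) ->
  (\int[gam]_y (f y)%:E <= (b * 4)%:E)%E.
Proof.
move=> mf f0 b0 fb.
have me : measurable_fun setT (fun y : R => (expR (a * y ^+ 2))%:E).
  apply/measurable_EFinP; apply: (measurableT_comp (@measurable_expR R)).
  by apply: measurable_funM => //; exact: measurable_funX.
have h : (\int[gam]_y (f y)%:E <= \int[gam]_y (b%:E * (expR (a * y ^+ 2))%:E))%E.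
  apply: ge0_le_integral => //; try exact/measurable_EFinP.
  - by move=> y _; rewrite lee_fin.
  - exact: measurable_funeM.
  - by move=> y _; rewrite -EFinM lee_fin.
apply: (le_trans h); rewrite ge0_integralZl_EFin //; first by rewrite EFinM lee_wpmul2l.
Qed.

Let le_exp (y : R) : y <= expR y. Proof. by have := expR_ge1Dx y; lra. Qed.

Let le_exp2 (y : R) : 0 <= y -> y ^+ 2 <= 4 * expR y.
Proof.
move=> y0; have -> : expR y = expR (y / 2) ^+ 2.
  by rewrite -expRM_natl; congr expR; field.
by have := expR_ge1Dx (y / 2); move: (expR (y / 2)) => u; nra.
Qed.

Let au (y : R) : y ^+ 2 = 8 * sigma ^+ 2 * (a * y ^+ 2).
Proof. by rewrite /a mulrA mulfV ?mul1r // gt_eqF // mulr_gt0 // exprn_gt0. Qed.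

Let s2 : 0 < sigma ^+ 2. Proof. exact: exprn_gt0. Qed.

Let ay0 (y : R) : 0 <= a * y ^+ 2. Proof. by rewrite mulr_ge0 ?sqr_ge0 ?(ltW a_gt0). Qed.

Lemma normal_second_moment : (\int[gam]_y (y ^+ 2)%:E <= (32 * sigma ^+ 2)%:E)%E.
Proof.
have -> : 32 * sigma ^+ 2 = (8 * sigma ^+ 2) * 4 by ring.
apply: normal_bound => [|y||y]; [exact: measurable_funX|exact: sqr_ge0| |].
  by rewrite mulr_ge0 // ltW.
by rewrite [leLHS]au ler_pM2l ?mulr_gt0.
Qed.

Lemma normal_fourth_moment : (\int[gam]_y (y ^+ 4)%:E <= (1024 * sigma ^+ 4)%:E)%E.
Proof.
have -> : 1024 * sigma ^+ 4 = ((8 * sigma ^+ 2) ^+ 2 * 4) * 4 by ring.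
apply: normal_bound => [|y||y]; [exact: measurable_funX|exact: exprn_even_ge0| |].
  by rewrite mulr_ge0 ?sqr_ge0.
rewrite (_ : y ^+ 4 = (y ^+ 2) ^+ 2); last by rewrite -exprM.
by rewrite {1}(au y) exprMn -mulrA ler_wpM2l ?sqr_ge0 // le_exp2.
Qed.

Let tail (y B : R) : B < y ^+ 2 ->
  1 <= expR (a * y ^+ 2 / 2) * expR (- (B / (16 * sigma ^+ 2))).
Proof.
move=> By; rewrite -expRD -[leLHS]expR0 ler_expR subr_ge0.
have -> : B / (16 * sigma ^+ 2) = a * B / 2 by rewrite /a; field; rewrite gt_eqF.
by rewrite ler_pM2r // ler_pM2l // ltW.
Qed.

Let tm_ge0 B : 0 <= expR (- (B / (16 * sigma ^+ 2))). Proof. exact: expR_ge0. Qed.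

Let half (y : R) : expR (a * y ^+ 2) = expR (a * y ^+ 2 / 2) ^+ 2.
Proof. by rewrite -expRM_natl; congr expR; field. Qed.

Lemma normal_second_tail (B : R) :
  (\int[gam]_y (y ^+ 2 * (B < y ^+ 2)%R%:R)%:E <= (tail_moment B)%:E)%E.
Proof.
apply: (@le_trans _ _ ((16 * sigma ^+ 2 * expR (- (B / (16 * sigma ^+ 2)))) * 4)%:E); last first.
  rewrite lee_fin /tail_moment mulrAC; apply: ler_wpM2r => //.
  lra.
apply: normal_bound => [|y||y].
- apply: measurable_funM; first exact: measurable_funX.
  by apply: measurable_natr; apply: measurable_fun_ltr => //; exact: measurable_funX.
- by rewrite mulr_ge0 ?sqr_ge0.
- by rewrite !mulr_ge0 // ltW.
case: ltP => [By|_]; last by rewrite mulr0 !mulr_ge0 ?expR_ge0 // ltW.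
have h := tail By; have g := le_exp (a * y ^+ 2 / 2).
have h1 := expR_ge0 (a * y ^+ 2 / 2).
rewrite mulr1 half; move: h g h1 (tm_ge0 B) (au y).
move: (expR (a * y ^+ 2 / 2)) (expR (- _)) (a * y ^+ 2) => u v w.
move=> uv wu u0 v0 ->.
have s16 : 0 <= 16 * sigma ^+ 2 by rewrite mulr_ge0 // ltW.
have -> : 8 * sigma ^+ 2 * w = 16 * sigma ^+ 2 * (w / 2) by field.
rewrite -[leRHS]mulrA ler_wpM2l //; apply: (le_trans wu).
by rewrite expr2 mulrCA -[leLHS]mulr1 ler_wpM2l // mulrC.
Qed.

Lemma normal_prob_tail (B : R) :
  (\int[gam]_y ((B < y ^+ 2)%R%:R)%:E <= (tail_moment B)%:E)%E.
Proof.
apply: (@le_trans _ _ (expR (- (B / (16 * sigma ^+ 2))) * 4)%:E); last first.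
  rewrite lee_fin /tail_moment mulrC; apply: ler_wpM2r => //.
  by have := s2; lra.
apply: normal_bound => [|y||y] //.
  by apply: measurable_natr; apply: measurable_fun_ltr => //; exact: measurable_funX.
case: ltP => [By|_]; last by rewrite mulr_ge0 ?expR_ge0.
rewrite mulrC; apply: (le_trans (tail By)); apply: ler_wpM2r => //.
by rewrite ler_expR; have := ay0 y; lra.
Qed.

Lemma normal_second_trunc (B : R) :
  (\int[gam]_y (y ^+ 2 * (y ^+ 2 <= B)%R%:R)%:E <= (32 * sigma ^+ 2)%:E)%E.
Proof.
apply: le_trans normal_second_moment; apply: ge0_le_integral => //.
- by move=> y _; rewrite lee_fin mulr_ge0 ?sqr_ge0.
- apply/measurable_EFinP; apply: measurable_funM; first exact: measurable_funX.
  by apply: measurable_natr; apply: measurable_fun_ler => //; exact: measurable_funX.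
- by apply/measurable_EFinP; exact: measurable_funX.
- by move=> y _; rewrite lee_fin; case: (_ <= B); rewrite ?mulr1 // mulr0 sqr_ge0.
Qed.

Lemma normal_prob_trunc (B : R) : tail_moment B <= 2^-1 ->
  ((2^-1)%:E <= \int[gam]_y ((y ^+ 2 <= B)%R%:R)%:E)%E.
Proof.
move=> hB.
have m1 : measurable_fun setT (fun y : R => (y ^+ 2 <= B)%R%:R : R).
  by apply: measurable_natr; apply: measurable_fun_ler => //; exact: measurable_funX.
have m2 : measurable_fun setT (fun y : R => (B < y ^+ 2)%R%:R : R).
  by apply: measurable_natr; apply: measurable_fun_ltr => //; exact: measurable_funX.
have : (\int[gam]_y ((y ^+ 2 <= B)%R%:R)%:E + \int[gam]_y ((B < y ^+ 2)%R%:R)%:E = 1)%E.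
  rewrite -ge0_integralD //; try exact/measurable_EFinP.
  - rewrite (eq_integral (cst 1%E)) ?integral_cst // ?mul1e //; first exact: probability_setT; move=> y _.
    by rewrite ltNge -EFinD; case: (_ <= B); rewrite /= ?addr0 ?add0r.
have := le_trans (normal_prob_tail B) (_ : (_ <= (2^-1)%:E)%E); rewrite lee_fin => /(_ hB).
have : (0 <= \int[gam]_y ((B < y ^+ 2)%R%:R)%:E)%E.
  by apply: integral_ge0 => y _; rewrite lee_fin.
case: (\int[gam]_y ((B < y ^+ 2)%R%:R)%:E)%E => [u||] //.
have : (0 <= \int[gam]_y ((y ^+ 2 <= B)%R%:R)%:E)%E.
  by apply: integral_ge0 => y _; rewrite lee_fin.
case: (\int[gam]_y ((y ^+ 2 <= B)%R%:R)%:E)%E => [v||] // _.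
- by rewrite -EFinD !lee_fin => _ h [h1]; lra.
Qed.

End gaussian_moments.

Lemma ebound_coord (R : realType) (I : choiceType) (g : probability (measurableTypeR R) R)
    (Q : probability (noise_space R I) R) (v : I) (f : R -> R) (c : R) :
  resamplable g Q -> measurable_fun setT f -> (forall y, 0 <= f y) ->
  (\int[g]_y (f y)%:E <= c%:E)%E -> ebound Q (fun z => f (z v)) c.
Proof.
move=> hQ mf f0 fc.
have mfv : measurable_fun setT (fun z : noise_space R I => f (z v)).
  by apply: (measurableT_comp mf); exact: measurable_coord.
split => //; rewrite (hQ v) //; last 2 first.
- exact/measurable_EFinP.
- by move=> z; rewrite lee_fin.
rewrite (eq_integral (cst (\int[g]_y (f y)%:E)%E)).
  by rewrite integral_cst // [X in (_ * X)%E]probability_setT mule1.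
by move=> z _; apply: eq_integral => y _; rewrite upd_same.
Qed.

Lemma box_mono k r : (k <= r)%N -> {subset box k <= box r}.
Proof. by move=> kr u; rewrite !mem_box; lia. Qed.

Lemma box_double_le r : ((2 * (2 * r)).+1 ^ 2 <= 2 ^ 2 * (2 * r).+1 ^ 2)%N.
Proof. by rewrite -expnMn leq_exp2r //; lia. Qed.

(** The square of side [k + 1] with a corner at [i] fits into the image once it points inwards in
    each direction, because [2 * k < n]. *)
Lemma near_pixels (n k : nat) (i : V) : i \in pixels n -> (2 * k < n)%N ->
  exists2 s : seq V, [/\ uniq s, size s = (k.+1 ^ 2)%N & {subset s <= pixels n}] &
    forall u, u \in s -> u - i \in box k.
Proof.
case: i => [a b]; rewrite mem_pixels /= => hi kn.
pose lo (c : int) : int := if c + k%:Z <= n%:Z then c else c - k%:Z.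
exists [seq (lo a + p%:Z, lo b + q%:Z) | p <- iota 0 k.+1, q <- iota 0 k.+1].
  split.
  - apply: allpairs_uniq; rewrite ?iota_uniq // => -[p q] [p' q'] _ _ /= [h1 h2].
    by congr (_, _); lia.
  - by rewrite size_allpairs !size_iota mulnn.
  move=> _ /allpairsP[[p q] [hp hq ->]]; move: hp hq; rewrite !mem_iota mem_pixels /= /lo.
  by do 2 case: ifP; lia.
move=> _ /allpairsP[[p q] [hp hq ->]]; move: hp hq; rewrite !mem_iota mem_box /= /lo.
by do 2 case: ifP; lia.
Qed.

Lemma ebound_mul0 (R : realType) d (T : measurableType d) (Q : probability T R)
  (F : T -> R) (c : R) : 0 <= c -> ebound Q (fun z => false%:R * F z) c.
Proof.
move=> c0; apply: ebound_weaken c0 _.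
rewrite (_ : (fun z => _) = (fun=> 0)); first exact: ebound_cst.
by apply/funext => z; rewrite mul0r.
Qed.

(** The margin [(K - 1) * t] is at least [K * t / 2]. Three shares of [K * t / 8] are taken from it:
    for the difference of the clean patches, for the fluctuation of the noise and for the change
    [18 * B] under resampling. *)
Lemma threshold_gap (R : realFieldType) (K t v B : R) : 2 <= K -> 0 < t ->
  18 * B <= K * t / 8 ->
  K * t / 8 + 2 * (K - 1) * v + t / 8 * K <= (K - 1) * (2 * v + t) - 18 * B.
Proof.
move=> K2 t0 hB; have h : 2 * t <= K * t by rewrite ler_pM2r.
have -> : (K - 1) * (2 * v + t) = 2 * (K - 1) * v + (K * t - t) by ring.
have -> : t / 8 * K = K * t / 8 by ring.
move: h hB; move: (K * t) (2 * (K - 1) * v) => u w; lra.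
Qed.

Section single_pixel.
Context {R : realType}.
Variable sigma : R.
Hypothesis sigma_gt0 : 0 < sigma.
Variables (Q : probability (noise_space R V) R).
Local Notation gam := (normal_prob 0 sigma).
Hypothesis hQ : resamplable gam Q.
Variables (x : V -> R) (n r k J : nat) (i : V) (t B s : R).
Local Notation S := (pixels n).
Local Notation K := (((2 * r).+1 ^ 2)%:R : R).
Local Notation W := ((k.+1 ^ 2)%:R : R).
Local Notation T := ((K - 1) * (2 * sigma ^+ 2 + t)).
Local Notation q := (144 * B / (K * sigma ^+ 2)).
Local Notation decay rho := (expR (- (rho ^+ 2 * K / (16 * tail_cst sigma)))).
Local Notation rho1 := (Num.min (sigma ^+ 2 / 4) (3 / 4)).
Hypothesis x01 : forall w, 0 <= x w <= 1.
Hypothesis iS : i \in S.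
Hypothesis shift_x : forall d, d \in box k ->
  \sum_(e <- box r | e != 0) (x (i + e) - x (i + d + e)) ^+ 2 <= K * t / 8.
Hypotheses (kn : (2 * k < n)%N) (kr : (k <= r)%N) (r_gt0 : (0 < r)%N) (J_gt0 : (0 < J)%N).
Hypotheses (t_gt0 : 0 < t) (t_le : t <= 6) (B_ge1 : 1 <= B) (B_le : 18 * B <= K * t / 8).
Hypotheses (J_ge : K / W <= J%:R) (s_gt0 : 0 < s) (s_le : s <= sigma ^+ 2) (s_le1 : s <= 3 / 4).
Hypotheses (Jq_le : J%:R * q <= 2^-1)
  (density_le : K * (J%:R * q) * (2 * (J%:R * q) + s / sigma ^+ 2) <= 1).
Hypotheses (tail_le : tail_moment sigma B <= 2^-1)
  (tail_J : tail_moment sigma B * J%:R <= 1)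
  (tail_K : B * (4 * K) * tail_moment sigma B <= 1).
Hypothesis few_le : (n ^ 2)%:R ^+ 2 * (W * decay (t / 8)) <= 1.
Hypothesis irregular_le : 2 * K / W * (decay s + (n ^ 2)%:R * decay rho1) <= 1.

Let K_ge2 : 2 <= K.
Proof. by rewrite ler_nat; move: r_gt0; case: r => // r' _; rewrite expnS expn1; nia. Qed.

Let s2 : 0 < sigma ^+ 2. Proof. exact: exprn_gt0. Qed.

Let gap := threshold_gap (sigma ^+ 2) K_ge2 t_gt0 B_le.

Let low_ge0 : 0 <= K * t / 8 + 2 * (K - 1) * sigma ^+ 2 + t / 8 * K.
Proof.
have K0 : 0 <= K by [].
have K1 : 0 <= K - 1 by have := K_ge2; lra.
by rewrite !addr_ge0 // !mulr_ge0 // ltW.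
Qed.

(** A shift within [box k] changes the clean patch by at most [K * t / 8], so each of the [W] pixels
    of a square at [i] passes the lowered threshold up to probability [decay (t / 8)]. If the count
    falls below [W], one of them must have failed. *)
Let few_near : ebound Q (fun z =>
  (cnt x r i [seq u <- S | u - i \in box r] (T - 18 * B) z < W)%R%:R) (W * decay (t / 8)).
Proof.
have [l [ul sl lS] li] := near_pixels iS kn.
have K2 := K_ge2; have t0 := t_gt0; have Bt := B_le; have t6 := t_le.
pose far (u : V) (z : V -> R) : R := (u != i)%:R *
  (K * t / 8 + 2 * (K - 1) * sigma ^+ 2 + t / 8 * K <= sqd r (obs x z) i u)%R%:R.
have hfar u : u \in l -> ebound Q (far u) (decay (t / 8)).
  move=> ul'; have [->|ui] := eqVneq u i.
    by rewrite /far eqxx; exact: ebound_mul0 (expR_ge0 _).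
  rewrite /far ui; under [X in ebound _ X _]funext => z do rewrite mul1r.
  apply: (sqd_upper_tail sigma_gt0 hQ) => //; first by rewrite eq_sym.
  - by rewrite divr_gt0.
  - by lra.
  - by have := shift_x (li _ ul'); rewrite addrC subrK.
apply: ebound_weaken; last apply: ebound_le (ebound_sum_cst hfar) => [|z|z] //.
- by rewrite sl.
- by apply: measurable_natr; apply: measurable_fun_ltr => //; exact: measurable_cnt.
case: ltP => //= few; last by apply: sumr_ge0 => u _; rewrite mulr_ge0.
have [all_close|] := boolP (all (fun u => sqd r (obs x z) i u <= T - 18 * B) l).
  exfalso; move: few; apply/negP; rewrite -leNgt -sl.
  rewrite /cnt -natr_sum ler_nat.
  rewrite (_ : (\sum_(u <- _) _)%N = count (fun u => sqd r (obs x z) i u <= T - 18 * B)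
    [seq u <- S | u - i \in box r]); last first.
    by rewrite -sum1_count [RHS]big_mkcond; apply: eq_bigr => u _; case: (_ <= _).
  rewrite -size_filter; apply: uniq_leq_size => // u ul'.
  rewrite !mem_filter (allP all_close) //= lS // andbT.
  exact: box_mono kr _ (li _ ul').
case/allPn => u ul'; rewrite -ltNge => hu.
have ui : u != i.
  apply: contraTneq hu => ->; rewrite sqd_self -leNgt.
  exact: le_trans low_ge0 gap.
rewrite (bigD1_seq u) //= /far ui mul1r.
rewrite (_ : (_ <= sqd _ _ _ _) = true); last first.
  by apply/idP; apply: le_trans gap (ltW hu).
rewrite lerDl; apply: sumr_ge0 => v _; by rewrite mulr_ge0.
Qed.

Local Notation kappa := (K * sigma ^+ 2 / 4).

Let irregular (U : seq V) : {subset U <= S} -> uniq U -> ebound Q (fun z =>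
  (~~ ((K * sigma ^+ 2 - s * K <= \sum_(e <- box r) z (i + e) ^+ 2) &&
     all (fun u => (u == i) || (kappa <= slope r x z i u)) U))%:R)
  (decay s + (n ^ 2)%:R * decay rho1).
Proof.
move=> US uU.
(* A partner for the pairing of coordinates: the norm bound concerns the patch of [i] alone but is
   stated for a pair of distinct pixels. *)
have i1 : i != i + (1, 0).
  by apply/eqP => /(congr1 (fun v => v - i)); rewrite subrr addrC addKr => /eqP.
have rho0 : 0 < rho1 by rewrite lt_min !divr_gt0.
have rho_le : rho1 <= 3 / 4 by rewrite ge_min lexx orbT.
have rho_le2 : rho1 <= sigma ^+ 2 / 4 by rewrite ge_min lexx.
have hs := norm_lower_tail sigma_gt0 hQ r i1 s_gt0 s_le1.
pose flat (u : V) (z : V -> R) : R := (u != i)%:R *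
  (slope r x z i u <= (K - 1) * sigma ^+ 2 - rho1 * K)%R%:R.
have hflat u : u \in U -> ebound Q (flat u) (decay rho1).
  move=> _; have [->|ui] := eqVneq u i.
    by rewrite /flat eqxx; exact: ebound_mul0 (expR_ge0 _).
  rewrite /flat ui; under [X in ebound _ X _]funext => z do rewrite mul1r.
  by apply: (slope_lower_tail sigma_gt0 hQ) => //; rewrite eq_sym.
apply: ebound_weaken; last apply: ebound_le (ebound_add hs (ebound_sum_cst hflat)) => [|z|z] //.
- by rewrite lerD2l ler_wpM2r ?expR_ge0 // ler_nat -size_pixels; exact: uniq_leq_size.
- apply: measurable_natr; apply: measurable_neg; apply: measurable_and.
    apply: measurable_fun_ler => //; apply: measurable_sum => e; apply: measurable_funX.
    exact: measurable_coord.
  elim: (U) => [|u U' IH] /=; first exact: measurable_cst.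
  apply: measurable_and => //; apply: measurable_or; first exact: measurable_cst.
  by apply: measurable_fun_ler => //; exact: measurable_slope.
have flat0 u : 0 <= flat u z by rewrite mulr_ge0.
have [z_large|z_small] /= := leP (K * sigma ^+ 2 - s * K) (\sum_(e <- box r) z (i + e) ^+ 2); last first.
  by rewrite (ltW z_small) lerDl sumr_ge0.
rewrite -[leLHS]add0r; apply: lerD => //.
case al : (all _ _) => /=; first exact: sumr_ge0.
have /allPn[u uU'] : ~~ all (fun u => (u == i) || (kappa <= slope r x z i u)) U by rewrite al.
rewrite negb_or -ltNge => /andP[ui hu].
rewrite (bigD1_seq u) //= [X in 1 <= X + _]/flat ui mul1r.
rewrite (_ : (slope _ _ _ _ _ <= _) = true) ?lerDl ?sumr_ge0 //.
apply/idP; apply: le_trans (ltW hu) _.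
(* [rho1 <= sigma ^+ 2 / 4] together with [K >= 2] leaves at least a quarter of [K * sigma ^+ 2],
   which is [kappa]. *)
have h1 : rho1 * K <= sigma ^+ 2 / 4 * K by rewrite ler_pM2r // (lt_le_trans _ K_ge2).
have h2 : 2 * sigma ^+ 2 <= K * sigma ^+ 2 by rewrite ler_pM2r.
have -> : (K - 1) * sigma ^+ 2 = K * sigma ^+ 2 - sigma ^+ 2 by ring.
have E : sigma ^+ 2 / 4 * K = K * sigma ^+ 2 / 4 by ring.
move: h1; rewrite E; move: h2; move: (rho1 * K) (K * sigma ^+ 2) => a b; lra.
Qed.

Let ratio (U : seq V) : {subset U <= S} -> uniq U -> ebound Q (fun z =>
  Num.min (cnt x r i U (T + 18 * B) z) (2 * K) / Num.max (cnt x r i U (T - 18 * B) z) W) 13.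
Proof.
move=> US uU.
have B0 : 0 < B by apply: lt_le_trans B_ge1.
have K0 : 0 < K by apply: lt_le_trans K_ge2.
have W0 : 0 < W by rewrite ltr0n.
have J0 : 0 < J%:R :> R by rewrite ltr0n.
have eta0 : 0 <= 18 * B by rewrite mulr_ge0 // ltW.
have q0 : 0 < q by rewrite divr_gt0 // mulr_gt0.
have etaT : 18 * B <= T by rewrite -subr_ge0; exact: le_trans low_ge0 gap.
(* The [144] in [q] makes this an equality. *)
have qk : 2 * (18 * B) <= q * kappa.
  by rewrite le_eqVlt; apply/orP; left; apply/eqP; field; rewrite !gt_eqF.
have := ebound_cnt_ratio sigma_gt0 hQ (erefl K) eta0 W0 J_gt0 q0 (ltW s_gt0) s_le
  Jq_le qk density_le etaT (irregular US uU).
(* [4 * (J + 2 * K / W) / J <= 12] because [K / W <= J]; the last [1] pays for irregular noise. *)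
have E : (13 : R) = 12 + 1 by ring.
apply: ebound_weaken; rewrite E; apply: lerD; last exact: irregular_le.
rewrite mulrC ler_pdivrMr //; move: J_ge; rewrite -mulrA; move: (K / W) J%:R => a b; lra.
Qed.

(** The fourth moment, then [64 * sigma ^+ 2 * (13 + 15)] from the two small-noise bounds, and [5]
    for the remaining contributions, which add up to at most [9 / 2]. *)
Definition pixel_cst : R := 1024 * sigma ^+ 4 + 1792 * sigma ^+ 2 + 5.

Lemma ebound_pixel_noise : ebound Q (fun z =>
  (\sum_(v <- S) (sqd r (obs x z) i v <= T)%R%:R * z v ^+ 2) / cnt x r i S T z) pixel_cst.
Proof.
have W0 : 0 < W by rewrite ltr0n.
have uS := pixels_uniq n.
have mX m : measurable_fun setT (fun y : R => y ^+ m) by exact: measurable_funX.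
have h4 v : ebound Q (fun z => z v ^+ 4) (1024 * sigma ^+ 4).
  apply: (ebound_coord v hQ (mX 4%N)); last exact: normal_fourth_moment.
  by move=> y; exact: exprn_even_ge0.
have hp v : ebound Q (fun z => (B < z v ^+ 2)%R%:R) (tail_moment sigma B).
  apply: (ebound_coord (f := fun y => (B < y ^+ 2)%R%:R) v hQ) => //; last exact: normal_prob_tail.
  by apply: measurable_natr; apply: measurable_fun_ltr => //; exact: measurable_funX.
have US : {subset [seq u <- S | u - i \in box r] <= S} by exact/mem_subseq/filter_subseq.
have := ebound_weighted_noise sigma_gt0 hQ x01 uS iS (erefl K) B_ge1 W0 few_near
  (normal_second_tail sigma_gt0 B) hp (normal_second_trunc sigma_gt0 B)
  (normal_prob_trunc sigma_gt0 tail_le) h4 (ratio US (filter_uniq _ uS)) (ratio (fun u => id) uS).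
apply: ebound_weaken; rewrite size_pixels.
have tm0 : 0 <= tail_moment sigma B by rewrite mulr_ge0 ?expR_ge0 // addr_ge0 // mulr_ge0 // ltW.
have h1 : tail_moment sigma B / 1 * (K / W) <= 1.
  by rewrite divr1; apply: le_trans tail_J; rewrite ler_wpM2l.
have h2 : B * (((2 * (2 * r)).+1 ^ 2)%:R * tail_moment sigma B) <= 1.
  apply: le_trans tail_K; rewrite mulrA ler_wpM2r // ler_wpM2l ?(le_trans _ B_ge1) //.
  by rewrite -natrM ler_nat box_double_le.
have -> : (2 : R)^-1^-1 = 2 by rewrite invrK.
rewrite /pixel_cst [tail_moment _ _ / 1 * (1 + _)]mulrDr mulr1.
move: h1 h2 few_le tail_le (ltW s2); rewrite divr1.
move: (tail_moment _ _) (_ * (K / W)) (_ * (_ * tail_moment _ _)) (_ * (W * _)) (sigma ^+ 4) => a b c d e.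
lra.
Qed.

End single_pixel.

(** * From single pixels to the whole image *)

(** Jensen's inequality, from the nonnegativity of the weighted variance. *)
Lemma sqr_weighted_mean (R : realFieldType) (I : Type) (s : seq I) (w a : I -> R) :
  (forall u, 0 <= w u) -> 0 < \sum_(u <- s) w u ->
  ((\sum_(u <- s) w u * a u) / \sum_(u <- s) w u) ^+ 2 <=
  (\sum_(u <- s) w u * a u ^+ 2) / \sum_(u <- s) w u.
Proof.
move=> w0; set N := \sum_(u <- s) w u => N0; set A := \sum_(u <- s) w u * a u.
have : 0 <= \sum_(u <- s) w u * (a u - A / N) ^+ 2.
  by apply: sumr_ge0 => u _; rewrite mulr_ge0 ?sqr_ge0.
have -> : \sum_(u <- s) w u * (a u - A / N) ^+ 2 =
   \sum_(u <- s) w u * a u ^+ 2 - (2 * (A / N)) * A + (A / N) ^+ 2 * N.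
  by rewrite /A /N !mulr_sumr -sumrB -big_split /=; apply: eq_bigr => u _; ring.
have -> : (A / N) ^+ 2 * N = (A / N) * A by field; rewrite gt_eqF.
move=> h; rewrite ler_pdivlMr //.
have -> : (A / N) ^+ 2 * N = (A / N) * A by field; rewrite gt_eqF.
move: h; rewrite -mulrA; move: (A / N * A) => b; lra.
Qed.

Lemma sqr_le_weighted (R : realFieldType) (b q : R) : 0 < b -> 0 <= q ->
  q <= b^-1 * q ^+ 2 + b.
Proof.
move=> b0 q0; have : 0 <= b * (b^-1 * q - 1) ^+ 2 by rewrite mulr_ge0 ?sqr_ge0 // ltW.
have -> : b * (b^-1 * q - 1) ^+ 2 = b^-1 * q ^+ 2 - 2 * q + b by field; rewrite gt_eqF.
lra.
Qed.

Lemma sqr_sum_le (R : realFieldType) (I : Type) (s : seq I) (a : I -> R) :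
  (\sum_(u <- s) a u) ^+ 2 <= (size s)%:R * \sum_(u <- s) a u ^+ 2.
Proof.
case: s => [|u s]; first by rewrite !big_nil expr0n mulr0.
set m := (size (u :: s))%:R.
have m0 : 0 < m :> R by rewrite ltr0n.
have E : \sum_(v <- u :: s) 1 = m :> R.
  by rewrite big_const_seq count_predT iter_addr_0.
have := @sqr_weighted_mean R I (u :: s) (fun=> 1) a (fun _ => ler01).
rewrite E => /(_ m0).
under eq_bigr do rewrite mul1r; under [X in _ <= X / _]eq_bigr do rewrite mul1r.
rewrite expr_div_n ler_pdivrMr ?exprn_gt0 // => /le_trans; apply.
by rewrite expr2 mulrA divfK ?gt_eqF // mulrC.
Qed.

(** Each of [m] pixels has an error of order [1 / m + E * len / m ^+ 2]; with [len <= E <= m] and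
    [1 <= E] the total is [O(E)]. *)
Lemma class_error_bound (R : realFieldType) (m E e v len : R) : 0 < m -> E <= m -> 1 <= E ->
  0 <= len -> len <= E -> 0 <= e -> 0 <= v ->
  m * (2 * m^-1 ^+ 2 * (8 * e * m) + 4 * E * m^-1 ^+ 2 * (len * (1 + 32 * v))) <=
  (16 * e + 4 + 128 * v) * E.
Proof.
move=> m0 Em E1 l0 lE e0 v0.
have -> : m * (2 * m^-1 ^+ 2 * (8 * e * m) + 4 * E * m^-1 ^+ 2 * (len * (1 + 32 * v))) =
  16 * e + E / m * (len * (4 + 128 * v)) by field; rewrite gt_eqF.
have EV : E / m <= 1 by rewrite ler_pdivrMr // mul1r.
have c0 : 0 <= 4 + 128 * v by lra.
have h1 : E / m * (len * (4 + 128 * v)) <= E * (4 + 128 * v).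
  apply: (@le_trans _ _ (len * (4 + 128 * v))).
    by rewrite -[leRHS]mul1r ler_wpM2r // mulr_ge0.
  by rewrite ler_wpM2r.
have h2 : e <= e * E by rewrite ler_peMr.
have -> : (16 * e + 4 + 128 * v) * E = 16 * (e * E) + E * (4 + 128 * v) by ring.
lra.
Qed.

(** The weights [n ^- 4] and [n ^+ 4] come from splitting a squared noise on a rare event between
    its fourth moment and the indicator of the event; a probability [p <= n ^- 8] then absorbs all
    the powers of [n]. *)
Lemma rare_event_bound (R : realFieldType) (n m p c : R) : 1 <= n -> 0 <= m -> m <= n ^+ 2 ->
  0 <= p -> 0 <= c -> n ^+ 8 * p <= 1 ->
  m * (2 * p + 2 * (n ^+ 2 * (n ^- 4 * c + n ^+ 4 * p))) <= 4 + 2 * c.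
Proof.
move=> n1 m0 mn p0 c0 np; have n0 : 0 < n by apply: lt_le_trans n1.
have a0 : 0 <= 2 * p + 2 * (n ^+ 2 * (n ^- 4 * c + n ^+ 4 * p)).
  rewrite addr_ge0 // mulr_ge0 // mulr_ge0 // ?sqr_ge0 // addr_ge0 // mulr_ge0 //.
    by rewrite invr_ge0 exprn_ge0 // ltW.
  by rewrite exprn_ge0 // ltW.
apply: (@le_trans _ _ (n ^+ 2 * (2 * p + 2 * (n ^+ 2 * (n ^- 4 * c + n ^+ 4 * p))))).
  by rewrite ler_wpM2r.
have -> : n ^+ 2 * (2 * p + 2 * (n ^+ 2 * (n ^- 4 * c + n ^+ 4 * p))) =
  2 * (n ^+ 2 * p) + 2 * c + 2 * (n ^+ 8 * p) by field; rewrite gt_eqF.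
have : n ^+ 2 * p <= n ^+ 8 * p by rewrite ler_wpM2r // ler_weXn2l.
lra.
Qed.

Section noise_sum.
Context {R : realType}.
Variable sigma : R.
Hypothesis sigma_gt0 : 0 < sigma.
Variables (Q : probability (noise_space R V) R).
Hypothesis hQ : resamplable (normal_prob 0 sigma) Q.

Let sqr_le_exp (y : R) : y ^+ 2 <= 4 * (expR y + expR (- y)).
Proof.
have h (v : R) : 0 <= v -> v ^+ 2 <= 4 * expR v.
  move=> v0; have -> : expR v = expR (v / 2) ^+ 2.
    by rewrite -expRM_natl; congr expR; field.
  by have := expR_ge1Dx (v / 2); move: (expR (v / 2)) => u; nra.
have [y0|y0] := leP 0 y.
  by apply: le_trans (h _ y0) _; rewrite ler_pM2l // lerDl expR_ge0.
have := h (- y); rewrite sqrrN oppr_ge0 => /(_ (ltW y0)) h1; apply: (le_trans h1).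
by rewrite ler_pM2l // lerDr expR_ge0.
Qed.

Lemma ebound_exp_sum (n : nat) (U : seq V) (l : R) : uniq U -> {subset U <= pixels n} ->
  ebound Q (fun z => expR (l * \sum_(u <- U) z u)) (expR ((size U)%:R * (l ^+ 2 * sigma ^+ 2))).
Proof.
(* The product bound asks for pairs of coordinates; the partners are pixels shifted out of the
   image, on which the factors do not depend. *)
move=> uU Un; pose b (v : V) := v + (n%:Z, 0).
have uab : uniq ([seq u | u <- U] ++ [seq b u | u <- U]).
  rewrite map_id cat_uniq uU map_inj_uniq ?uU ?andbT; last exact: addIr.
  apply/hasPn => _ /mapP[v /Un vn ->]; apply/negP => /Un.
  by move: vn; rewrite !mem_pixels /=; lia.
pose G (u : V) (y y' : R) := expR (l * y).
have mG u : measurable_fun setT (fun p : R * R => G u p.1 p.2).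
  apply: (measurableT_comp (@measurable_expR R)).
  by apply: measurable_funM => //; exact: measurable_fst.
have cG (u : V) : (\int[normal_prob 0 sigma]_y \int[normal_prob 0 sigma]_x (G u x y)%:E <=
    (expR (l ^+ 2 * sigma ^+ 2))%:E)%E.
  have h : `|0 : R| * sigma ^+ 2 <= 8^-1 by rewrite normr0 mul0r invr_ge0.
  rewrite (eq_integral (cst (\int[normal_prob 0 sigma]_x (expR (l * x))%:E)%E)) //.
  rewrite integral_cst // [X in (_ * X)%E]probability_setT mule1.
  have := normal_exp_quadratic_le l sigma_gt0 h.
  under eq_integral do rewrite mul0r add0r.
  by rewrite mul0r expr0n /= mulr0 !add0r.
have := ebound_prod_pairs hQ uab mG (fun _ _ _ => expR_ge0 _) cG.
rewrite big_const_seq count_predT iter_mulr_1 -expRM_natl mulr_natl.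
congr (ebound _ _ _); apply/funext => z.
by rewrite /G mulr_sumr expR_sum.
Qed.

(** The square is dominated by two exponentials of the sum divided by the root of [m], whose
    expectations are at most [expR (sigma ^+ 2)]. Independence thus enters through the product
    bound, without expanding the square into covariances. *)
Lemma ebound_sqr_sum (n : nat) (U : seq V) : uniq U -> {subset U <= pixels n} ->
  ebound Q (fun z => (\sum_(u <- U) z u) ^+ 2) (8 * expR (sigma ^+ 2) * (size U)%:R).
Proof.
move=> uU Un; set m := (size U)%:R : R.
have mS : measurable_fun setT (fun z : noise_space R V => \sum_(u <- U) z u).
  by apply: measurable_sum => u; exact: measurable_coord.
have [m0|m0] := eqVneq (size U) 0%N.
  rewrite /m m0 mulr0; move/size0nil: m0 => m0.
  apply: ebound_le (ebound_cst Q (lexx 0)) => [|z|z]; first exact: measurable_funX.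
    exact: sqr_ge0.
  by rewrite m0 big_nil expr0n.
have m_gt0 : 0 < m by rewrite ltr0n lt0n.
set l := (Num.sqrt m)^-1.
have l2 : l ^+ 2 = m^-1 by rewrite exprVn sqr_sqrtr // ltW.
have h1 := ebound_exp_sum l uU Un; have h2 := ebound_exp_sum (- l) uU Un.
have e1 : m * (l ^+ 2 * sigma ^+ 2) = sigma ^+ 2 by rewrite l2 mulrA mulfV ?mul1r // gt_eqF.
rewrite -/m sqrrN e1 in h2; rewrite -/m e1 in h1.
have m40 : 0 <= 4 * m by rewrite mulr_ge0 // ltW.
apply: ebound_weaken; last apply: ebound_le (ebound_scale m40 (ebound_add h1 h2)) => [|z|z].
- by rewrite le_eqVlt; apply/orP; left; apply/eqP; ring.
- exact: measurable_funX.
- exact: sqr_ge0.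
have := sqr_le_exp (l * \sum_(u <- U) z u).
rewrite exprMn l2 mulNr -(ler_pM2l m_gt0) mulrA mulfV ?gt_eqF // mul1r => h.
by apply: (le_trans h); rewrite mulrA [m * 4]mulrC.
Qed.

End noise_sum.

Section denoising_error.
Context {R : realType}.
Variable sigma : R.
Hypothesis sigma_gt0 : 0 < sigma.
Variables (Q : probability (noise_space R V) R).
Hypothesis hQ : resamplable (normal_prob 0 sigma) Q.
Variables (x : V -> R) (n r : nat) (T C1 pG E : R) (D : bool -> pred V).
Local Notation S := (pixels n).
Hypothesis x01 : forall w, 0 <= x w <= 1.
Hypothesis xD : forall b i, D b i -> x i = b%:R.
Hypotheses (n_gt0 : (0 < n)%N) (T_ge0 : 0 <= T) (E_ge1 : 1 <= E).
Hypothesis few_edges : (size [seq i <- S | ~~ D true i && ~~ D false i])%:R <= E.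
Hypothesis pixel_noise : forall i, i \in S -> ebound Q (fun z =>
  (\sum_(v <- S) (sqd r (obs x z) i v <= T)%R%:R * z v ^+ 2) / cnt x r i S T z) C1.

Let wt i z v : R := (sqd r (obs x z) i v <= T)%R%:R.

Definition average_close i (z : V -> R) : R :=
  (\sum_(v <- S) wt i z v * obs x z v) / cnt x r i S T z.

Let misclassified (z : V -> R) := has (fun i => has (fun u =>
    (D true i && D true u || D false i && D false u) && ~~ (sqd r (obs x z) i u <= T) ||
    (D true i && D false u || D false i && D true u) && (sqd r (obs x z) i u <= T)) S) S.

Hypothesis rarely_misclassified : ebound Q (fun z => (misclassified z)%:R) pG.
Hypothesis pG_le : n%:R ^+ 8 * pG <= 1.

Let cnt_ge1 i z : i \in S -> 1 <= cnt x r i S T z.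
Proof.
move=> iS; rewrite /cnt (bigD1_seq i) ?pixels_uniq //= sqd_self T_ge0 lerDl.
by apply: sumr_ge0.
Qed.

Let cnt_gt0 i z : i \in S -> 0 < cnt x r i S T z.
Proof. by move=> iS; exact: lt_le_trans (cnt_ge1 z iS). Qed.

Let deviation i z (c : R) : i \in S ->
  average_close i z - c = (\sum_(v <- S) wt i z v * (x v - c + z v)) / cnt x r i S T z.
Proof.
move=> iS; have N0 := cnt_gt0 z iS.
rewrite /average_close -[c in LHS](mulfK (lt0r_neq0 N0)) -mulrBl; congr (_ / _).
rewrite /cnt mulr_sumr -sumrB; apply: eq_bigr => v _.
by rewrite /obs -/(wt i z v); ring.
Qed.

Let error_le i z : i \in S -> (x i - average_close i z) ^+ 2 <=
  2 + 2 * ((\sum_(v <- S) wt i z v * z v ^+ 2) / cnt x r i S T z).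
Proof.
move=> iS; have N0 := cnt_gt0 z iS.
rewrite -sqrrN opprB deviation //.
apply: le_trans (sqr_weighted_mean _ _ N0) _ => [v|]; first exact: ler0n.
rewrite ler_pdivrMr // mulrDl -mulrA divfK ?gt_eqF // !mulr_sumr -big_split /=.
apply: ler_sum => v _; rewrite -/(wt i z v).
have w0 : 0 <= wt i z v by exact: ler0n.
rewrite [2 * wt _ _ _]mulrC [2 * (_ * _)]mulrCA -mulrDr ler_wpM2l //.
have := x01 v; have := x01 i; have := sqr_ge0 (x v - x i - z v).
move: (x v) (x i) (z v) => a b c; nra.
Qed.

Let mwt i v : measurable_fun setT (fun z : noise_space R V => wt i z v).
Proof. exact: measurable_close. Qed.

Let maverage i : measurable_fun setT (fun z : noise_space R V => average_close i z).
Proof.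
apply: measurable_funM.
  apply: measurable_sum => v; apply: measurable_funM; first exact: mwt.
  by apply: measurable_funD => //; exact: measurable_coord.
by apply: measurable_invr; [exact: measurable_cnt|move=> z; exact: cnt_ge0].
Qed.

Let merror i : measurable_fun setT (fun z : noise_space R V => (x i - average_close i z) ^+ 2).
Proof. by apply: measurable_funX; apply: measurable_funB => //; exact: maverage. Qed.

Let ebound_error i : i \in S ->
  ebound Q (fun z => (x i - average_close i z) ^+ 2) (2 + 2 * C1).
Proof.
move=> iS; apply: ebound_le (ebound_add (ebound_cst Q (ler0n R 2))
  (ebound_scale (ler0n R 2) (pixel_noise iS))) => [|z|z]; first exact: merror.
- exact: sqr_ge0.
- exact: error_le.
Qed.

Let ebound_error_misclassified i : i \in S -> ebound Q (fun z =>
    (misclassified z)%:R * (x i - average_close i z) ^+ 2)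
  (2 * pG + 2 * ((n ^ 2)%:R * (n%:R ^- 4 * (1024 * sigma ^+ 4) + n%:R ^+ 4 * pG))).
Proof.
move=> iS.
have n0 : 0 < (n%:R : R) ^+ 4 by rewrite exprn_gt0 // ltr0n.
have nV : 0 <= (n%:R : R) ^- 4 by rewrite invr_ge0 ltW.
have h4 (v : V) : ebound Q (fun z => z v ^+ 4) (1024 * sigma ^+ 4).
  apply: (ebound_coord v hQ (f := fun y => y ^+ 4)); first exact: measurable_funX.
  - by move=> y; exact: exprn_even_ge0.
  - exact: normal_fourth_moment.
have hv (v : V) : v \in S -> ebound Q (fun z => n%:R ^- 4 * z v ^+ 4 + n%:R ^+ 4 * (misclassified z)%:R)
   (n%:R ^- 4 * (1024 * sigma ^+ 4) + n%:R ^+ 4 * pG).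
  by move=> _; apply: ebound_add; apply: ebound_scale => //; exact: ltW.
rewrite -size_pixels.
apply: ebound_le (ebound_add (ebound_scale (ler0n R 2) rarely_misclassified)
  (ebound_scale (ler0n R 2) (ebound_sum_cst hv))) => [|z|z].
- by apply: measurable_funM; [case: rarely_misclassified|exact: merror].
- by rewrite mulr_ge0 ?sqr_ge0.
have q0 v : 0 <= n%:R ^- 4 * z v ^+ 4 by rewrite mulr_ge0 // exprn_even_ge0.
case: (misclassified z); last first.
  rewrite mul0r mulr0 add0r mulr_ge0 // sumr_ge0 // => v _.
  by rewrite mulr0 addr0.
rewrite mul1r mulr1; apply: le_trans (error_le z iS) _.
rewrite lerD2l ler_pM2l // ler_pdivrMr ?cnt_gt0 //.
apply: (@le_trans _ _ (\sum_(v <- S) (n%:R ^- 4 * z v ^+ 4 + n%:R ^+ 4 * 1))); last first.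
  rewrite -[leLHS]mulr1 ler_wpM2l ?cnt_ge1 // sumr_ge0 // => v _.
  by rewrite addr_ge0 // mulr1 ltW.
apply: ler_sum => v _; rewrite mulr1.
apply: (@le_trans _ _ (z v ^+ 2)).
  by rewrite /wt; case: (_ <= T); rewrite ?mul1r // mul0r sqr_ge0.
rewrite (_ : z v ^+ 4 = (z v ^+ 2) ^+ 2); last by rewrite -exprM.
exact: sqr_le_weighted (sqr_ge0 _).
Qed.

Local Notation U b := [seq i <- S | D b i].
Local Notation edge := [seq i <- S | ~~ D true i && ~~ D false i].

Let disj i : ~~ (D true i && D false i).
Proof.
by apply/negP => /andP[/xD h1 /xD /eqP]; rewrite h1 oner_eq0.
Qed.

Let split_sum b (f : V -> R) : \sum_(v <- S) f v =
  \sum_(v <- U b) f v + \sum_(v <- U (~~ b)) f v + \sum_(v <- edge) f v.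
Proof.
rewrite !big_filter [LHS](bigID (D b)) /= -addrA; congr (_ + _).
rewrite [LHS](bigID (D (~~ b))) /=; congr (_ + _); apply: eq_bigl => v.
  by have := disj v; case: b => /=; case: (D true v); case: (D false v).
by case: b => /=; rewrite // andbC.
Qed.

(** Bounds the squared error at all pixels of [U b] at once. Without misclassification the weights
    are [1] on [U b] and [0] on the opposite class, and the unknown ones on the edge are removed by
    the Cauchy-Schwarz inequality. No random weight is left, so the expectation needs no
    decoupling. *)
Definition class_error b (z : V -> R) : R := let m := (size (U b))%:R in
  2 * m^-1 ^+ 2 * (\sum_(v <- U b) z v) ^+ 2 +
  4 * E * m^-1 ^+ 2 * (\sum_(v <- edge) (1 + z v ^+ 2)).

Let class_error_ge0 b z : 0 <= class_error b z.
Proof.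
have E0 : 0 <= E by apply: le_trans E_ge1.
apply: addr_ge0; first by rewrite mulr_ge0 ?sqr_ge0 // mulr_ge0 ?sqr_ge0.
apply: mulr_ge0; first by rewrite mulr_ge0 ?sqr_ge0 // mulr_ge0.
by apply: sumr_ge0 => v _; rewrite addr_ge0 ?sqr_ge0.
Qed.

Let class_error_le b i z : i \in U b -> ~~ misclassified z ->
  (x i - average_close i z) ^+ 2 <= class_error b z.
Proof.
rewrite mem_filter => /andP[Di iS] good.
have same v : v \in U b -> wt i z v = 1.
  rewrite mem_filter => /andP[Dv vS]; rewrite /wt; case cl : (_ <= T) => //.
  move/hasPn : good => /(_ _ iS) /hasPn /(_ _ vS).
  by rewrite cl; case: (b) Di Dv => /= -> ->; rewrite /= ?orbT.
have other v : v \in U (~~ b) -> wt i z v = 0.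
  rewrite mem_filter => /andP[Dv vS]; rewrite /wt; case cl : (_ <= T) => //.
  move/hasPn : good => /(_ _ iS) /hasPn /(_ _ vS).
  by rewrite cl; case: (b) Di Dv => /= -> ->; rewrite /= ?orbT ?andbT ?andbF //.
have m_gt0 : 0 < (size (U b))%:R :> R.
  rewrite ltr0n lt0n size_eq0; apply/eqP => e.
  have : i \in U b by rewrite mem_filter Di.
  by rewrite e.
have mN : (size (U b))%:R <= cnt x r i S T z.
  rewrite /cnt (split_sum b) (eq_big_seq (fun=> 1)) //.
  rewrite big_const_seq count_predT iter_addr_0 -addrA lerDl.
  by rewrite addr_ge0 // sumr_ge0.
have N0 := cnt_gt0 z iS.
rewrite -sqrrN opprB deviation // (split_sum b).
rewrite (eq_big_seq (fun v => z v)); last first.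
  move=> v vU; rewrite same // mul1r; move: vU; rewrite mem_filter => /andP[/xD -> _].
  by rewrite (xD Di) subrr add0r.
rewrite [X in _ + X + _]big1_seq ?addr0; last first.
  by move=> v vU; rewrite other ?mul0r.
set A := \sum_(v <- U b) z v; set B := \sum_(v <- edge) _; set m := (size [seq i <- S | D b i])%:R : R.
have hB : B ^+ 2 <= E * (2 * \sum_(v <- edge) (1 + z v ^+ 2)).
  apply: (le_trans (sqr_sum_le _ _)); apply: ler_pM => //.
    by apply: sumr_ge0 => v _; exact: sqr_ge0.
  rewrite mulr_sumr; apply: ler_sum => v _.
  apply: (@le_trans _ _ ((x v - x i + z v) ^+ 2)).
    by rewrite exprMn /wt (xD Di); case: (_ <= T); rewrite /= ?expr1n ?mul1r // expr0n mul0r sqr_ge0.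
  have := x01 v; have := x01 i; have := sqr_ge0 (x v - x i - z v).
  move: (x v) (x i) (z v) => a c d; nra.
rewrite expr_div_n.
apply: (@le_trans _ _ ((A + B) ^+ 2 / m ^+ 2)).
  rewrite ler_wpM2l ?sqr_ge0 // lef_pV2 ?posrE ?exprn_gt0 //.
  by apply: lerXn2r => //; rewrite nnegrE; exact: ltW.
rewrite /class_error -/m -/A -exprVn.
have : (A + B) ^+ 2 <= 2 * A ^+ 2 + 2 * B ^+ 2.
  by have := sqr_ge0 (A - B); rewrite sqrrB sqrrD; lra.
have := sqr_ge0 m^-1; move: hB; set F := \sum_(v <- edge) _.
move: (m^-1 ^+ 2) (B ^+ 2) (A ^+ 2) ((A + B) ^+ 2) => a bb aa ab hB a0 hab.
have -> : 2 * a * aa + 4 * E * a * F = a * (2 * aa + 2 * (E * (2 * F))) by ring.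
rewrite mulrC ler_wpM2l //; lra.
Qed.

(** The contributions come from [ebound_error], [class_error_bound] and [rare_event_bound], the
    latter with fourth moment [1024 * sigma ^+ 4]. *)
Definition error_cst : R := 2 * (2 + 2 * C1) + 8 * expR (sigma ^+ 2) * 2 + 4 + 128 * sigma ^+ 2 +
  6 + 2048 * sigma ^+ 4.

Let C1_ge0 : 0 <= C1.
Proof.
have h : ((1 : int), (1 : int)) \in S by rewrite mem_pixels /=; move: n_gt0; clear; lia.
exact: ebound_ge0 (pixel_noise h).
Qed.

Let few_errors b : (size (U b))%:R <= E -> ebound Q
  (fun z => \sum_(i <- U b) (x i - average_close i z) ^+ 2) (error_cst * E).
Proof.
move=> mE.
have h i : i \in U b -> ebound Q (fun z => (x i - average_close i z) ^+ 2) (2 + 2 * C1).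
  by rewrite mem_filter => /andP[_]; exact: ebound_error.
apply: ebound_weaken; last exact: ebound_sum_cst h.
have C0 : 0 <= 2 + 2 * C1 by have := C1_ge0; lra.
apply: (@le_trans _ _ (E * (2 + 2 * C1))); first by rewrite ler_wpM2r.
rewrite mulrC ler_wpM2r ?(le_trans _ E_ge1) //.
have s4 : 0 <= sigma ^+ 4 by exact: exprn_even_ge0.
have := expR_ge0 (sigma ^+ 2); have := sqr_ge0 sigma; have := C1_ge0.
rewrite /error_cst; move: s4; move: (expR (sigma ^+ 2)) (sigma ^+ 4) (sigma ^+ 2) => a b' c; lra.
Qed.

Let ebound_class_error b : ebound Q (fun z => class_error b z)
  (2 * (size (U b))%:R^-1 ^+ 2 * (8 * expR (sigma ^+ 2) * (size (U b))%:R) +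
   4 * E * (size (U b))%:R^-1 ^+ 2 * ((size edge)%:R * (1 + 32 * sigma ^+ 2))).
Proof.
have E0 : 0 <= E by apply: le_trans E_ge1.
have US : {subset U b <= S} by exact/mem_subseq/filter_subseq.
apply: ebound_add; apply: ebound_scale.
- by rewrite mulr_ge0 ?sqr_ge0.
- by apply: ebound_sqr_sum US => //; rewrite filter_uniq ?pixels_uniq.
- by rewrite mulr_ge0 ?sqr_ge0 // mulr_ge0.
apply: ebound_sum_cst => v _; apply: ebound_add; first exact: ebound_cst.
apply: (ebound_coord v hQ (f := fun y => y ^+ 2)); first exact: measurable_funX.
- by move=> y; exact: sqr_ge0.
- exact: normal_second_moment.
Qed.

Let ebound_class b : ebound Q (fun z => \sum_(i <- U b) (x i - average_close i z) ^+ 2)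
  (error_cst * E).
Proof.
(* A class with at most [E] pixels need not average its noise out, but then an [O(1)] error per
   pixel is affordable. *)
have [|Em] := leP (size (U b))%:R E; first exact: few_errors.
have E0 : 0 < E by apply: lt_le_trans E_ge1.
have m0 : 0 < (size (U b))%:R :> R by apply: lt_trans Em.
have mU i : i \in U b -> ebound Q (fun z => (misclassified z)%:R * (x i - average_close i z) ^+ 2)
  (2 * pG + 2 * ((n ^ 2)%:R * (n%:R ^- 4 * (1024 * sigma ^+ 4) + n%:R ^+ 4 * pG))).
  by rewrite mem_filter => /andP[_]; exact: ebound_error_misclassified.
apply: ebound_weaken; last apply: ebound_le (ebound_add
    (ebound_scale (ltW m0) (ebound_class_error b)) (ebound_sum_cst mU)) => [|z|z].
- have mn : (size (U b))%:R <= (n%:R : R) ^+ 2.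
    by rewrite -natrX ler_nat -size_pixels size_filter count_size.
  have pG0 := ebound_ge0 rarely_misclassified.
  have n1 : 1 <= (n%:R : R) by rewrite ler1n.
  have s4 : 0 <= sigma ^+ 4 by exact: exprn_even_ge0.
  have e0 := expR_ge0 (sigma ^+ 2); have C0 := C1_ge0; have v0 := sqr_ge0 sigma.
  have c0 : 0 <= 1024 * sigma ^+ 4 by exact: mulr_ge0 (ler0n R 1024) s4.
  have h1 := class_error_bound m0 (ltW Em) E_ge1 (ler0n R _) few_edges e0 v0.
  have h2 := rare_event_bound n1 (ltW m0) mn pG0 c0 pG_le.
  rewrite natrX; apply: (le_trans (lerD h1 h2)).
  have h3 : 2 * (2 + 2 * C1) + 6 + 2048 * sigma ^+ 4 <= (2 * (2 + 2 * C1) + 6 + 2048 * sigma ^+ 4) * E.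
    apply: ler_peMr E_ge1; move: s4 C0; move: (sigma ^+ 4) => a; lra.
  move: h3 C0 s4; rewrite /error_cst.
  move: (expR (sigma ^+ 2)) => a; move: (sigma ^+ 4) (sigma ^+ 2) => b' c h3 C0 s4.
  have -> : (2 * (2 + 2 * C1) + 8 * a * 2 + 4 + 128 * c + 6 + 2048 * b') * E =
    (16 * a + 4 + 128 * c) * E + (2 * (2 + 2 * C1) + 6 + 2048 * b') * E by ring.
  by lra.
- by apply: measurable_sum => i; exact: merror.
- by apply: sumr_ge0 => i _; exact: sqr_ge0.
have -> : (size (U b))%:R * class_error b z = \sum_(i <- U b) class_error b z.
  by rewrite big_const_seq count_predT iter_addr_0 mulr_natl.
rewrite -big_split /= [leLHS]big_seq [leRHS]big_seq; apply: ler_sum => i iU.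
case mis : (misclassified z) => /=; first by rewrite mul1r lerDr.
by rewrite mul0r addr0; apply: class_error_le => //; rewrite mis.
Qed.

Lemma ebound_denoising_error :
  ebound Q (fun z => \sum_(i <- S) (x i - average_close i z) ^+ 2) (3 * error_cst * E).
Proof.
have he : ebound Q (fun z => \sum_(i <- edge) (x i - average_close i z) ^+ 2) (error_cst * E).
  have h i : i \in edge -> ebound Q (fun z => (x i - average_close i z) ^+ 2) (2 + 2 * C1).
    by rewrite mem_filter => /andP[_]; exact: ebound_error.
  have C0 := C1_ge0.
  apply: ebound_weaken; last exact: ebound_sum_cst h.
  apply: (@le_trans _ _ (E * (2 + 2 * C1))).
    by rewrite ler_wpM2r //; lra.
  rewrite mulrC ler_wpM2r ?(le_trans _ E_ge1) //.
  have s4 : 0 <= sigma ^+ 4 by exact: exprn_even_ge0.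
  have := expR_ge0 (sigma ^+ 2); have := sqr_ge0 sigma.
  by rewrite /error_cst; move: s4; move: (expR (sigma ^+ 2)) (sigma ^+ 4) (sigma ^+ 2) => a b' c; lra.
apply: ebound_weaken; last apply: ebound_le
  (ebound_add (ebound_add (ebound_class true) (ebound_class false)) he) => [|z|z].
- by rewrite le_eqVlt; apply/orP; left; apply/eqP; ring.
- by apply: measurable_sum => i; exact: merror.
- by apply: sumr_ge0 => i _; exact: sqr_ge0.
- by rewrite (split_sum true).
Qed.

End denoising_error.

(** * Pairs of pixels on equal and on opposite sides of the horizon *)

Section misclassification.
Context {R : realType}.
Variable sigma : R.
Hypothesis sigma_gt0 : 0 < sigma.
Variables (Q : probability (noise_space R V) R).
Hypothesis hQ : resamplable (normal_prob 0 sigma) Q.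
Variables (x : V -> R) (n r : nat) (t : R) (D : bool -> pred V).
Local Notation S := (pixels n).
Local Notation K := (((2 * r).+1 ^ 2)%:R : R).
Local Notation T := ((K - 1) * (2 * sigma ^+ 2 + t)).
Local Notation decay rho := (expR (- (rho ^+ 2 * K / (16 * tail_cst sigma)))).
Hypothesis x01 : forall w, 0 <= x w <= 1.
Hypothesis deep : forall b i e, D b i -> e \in box r -> x (i + e) = b%:R.
Hypotheses (r_gt0 : (0 < r)%N) (t_gt0 : 0 < t) (t_le : t <= 2^-1).

Let K_ge2 : 2 <= K.
Proof.
by rewrite ler_nat; move: r_gt0; clear; case: r => // r' _; rewrite expnS expn1; nia.
Qed.

Let T_ge0 : 0 <= T.
Proof.
have := K_ge2; have := t_gt0; have := sqr_ge0 sigma => h1 h2 h3.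
by apply: mulr_ge0; lra.
Qed.

Let same_tail b i u : i != u -> D b i -> D b u ->
  ebound Q (fun z => (~~ (sqd r (obs x z) i u <= T))%:R) (decay (t / 8)).
Proof.
move=> iu Di Du.
have t8 : 0 < t / 8 by rewrite divr_gt0.
have t34 : t / 8 <= 3 / 4 by have := t_le; lra.
have h : \sum_(e <- box r | e != 0) (x (i + e) - x (u + e)) ^+ 2 <= 0.
  rewrite big_seq_cond big1 // => e /andP[eb _].
  by rewrite (deep Di eb) (deep Du eb) subrr expr0n.
apply: ebound_le (sqd_upper_tail sigma_gt0 hQ iu x01 t8 t34 h) => [|z|z] //.
  apply: measurable_natr; apply: measurable_neg; apply: measurable_fun_ler => //.
  exact: measurable_sqd.
rewrite ler_nat; case: leP => //= hT; rewrite lt0b; apply: le_trans (ltW hT).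
have h2 : 2 * t <= K * t by rewrite ler_pM2r.
have -> : (K - 1) * (2 * sigma ^+ 2 + t) = 2 * (K - 1) * sigma ^+ 2 + (K * t - t) by ring.
have -> : t / 8 * K = K * t / 8 by ring.
move: h2; have := t_gt0; move: (K * t) (2 * (K - 1) * sigma ^+ 2) => a c; lra.
Qed.

(** The clean patches differ by [K - 1] while the threshold allows [(K - 1) * t <= (K - 1) / 2]. As
    [K >= 2], at least [K / 4] is left for the fluctuation, whence the rate [4^-1]. *)
Let cross_tail b i u : i != u -> D b i -> D (~~ b) u ->
  ebound Q (fun z => (sqd r (obs x z) i u <= T)%R%:R) (decay 4^-1).
Proof.
move=> iu Di Du.
have t8 : 0 < 4^-1 :> R by [].
have t34 : 4^-1 <= 3 / 4 :> R by lra.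
have h : K - 1 <= \sum_(e <- box r | e != 0) (x (i + e) - x (u + e)) ^+ 2.
  rewrite -count_nonzero big_seq_cond [leRHS]big_seq_cond; apply: ler_sum => e /andP[eb _].
  rewrite (deep Di eb) (deep Du eb); case: (b) => /=; rewrite ?subr0 ?sub0r ?sqrrN expr1n //.
apply: ebound_le (sqd_lower_tail sigma_gt0 hQ iu x01 t8 t34 h) => [|z|z] //.
  apply: measurable_natr; apply: measurable_fun_ler => //; exact: measurable_sqd.
rewrite ler_nat; case h1 : (_ <= T) => //=; rewrite lt0b; apply: (le_trans h1).
have K2 := K_ge2.
have h2 : (K - 1) * t <= (K - 1) * 2^-1 by rewrite ler_wpM2l //; lra.
have -> : (K - 1) * (2 * sigma ^+ 2 + t) = 2 * (K - 1) * sigma ^+ 2 + (K - 1) * t by ring.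
move: h2 K2; move: (2 * (K - 1) * sigma ^+ 2) ((K - 1) * t) K => a c k; lra.
Qed.

Let disj i : D true i -> D false i -> False.
Proof.
move=> h1 h2; have := deep h1 (box0 r); rewrite (deep h2 (box0 r)) => /eqP.
by rewrite eq_sym oner_eq0.
Qed.

Lemma ebound_misclassified : ebound Q (fun z => (has (fun i => has (fun u =>
    (D true i && D true u || D false i && D false u) && ~~ (sqd r (obs x z) i u <= T) ||
    (D true i && D false u || D false i && D true u) && (sqd r (obs x z) i u <= T)) S) S)%:R)
  ((n ^ 2)%:R * ((n ^ 2)%:R * (decay (t / 8) + decay 4^-1))).
Proof.
pose bad i u (z : V -> R) :=
    (D true i && D true u || D false i && D false u) && ~~ (sqd r (obs x z) i u <= T) ||
    (D true i && D false u || D false i && D true u) && (sqd r (obs x z) i u <= T).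
have msqd i u : measurable_fun setT (fun z : noise_space R V => sqd r (obs x z) i u <= T).
  by apply: measurable_fun_ler => //; exact: measurable_sqd.
have mbad i u : measurable_fun setT (fun z : noise_space R V => bad i u z).
  apply: measurable_or; apply: measurable_and; try exact: measurable_cst => //.
    exact: measurable_neg.
  exact: msqd.
have e0 : 0 <= decay (t / 8) by exact: expR_ge0.
have e1 : 0 <= decay 4^-1 by exact: expR_ge0.
have hbad i u : ebound Q (fun z => (bad i u z)%:R) (decay (t / 8) + decay 4^-1).
  have zero : (forall z, bad i u z = false) -> ebound Q (fun z => (bad i u z)%:R) (decay (t / 8) + decay 4^-1).
    move=> hz; apply: ebound_weaken (addr_ge0 e0 e1) _.
    apply: ebound_le (ebound_cst Q (lexx 0)) => [|z|z] //; first exact: measurable_natr.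
    by rewrite hz.
  (* Concentration compares distinct pixels; for [i = u] the distance is zero and the classes agree,
     so no misclassification occurs. *)
  have [iu|iu] := eqVneq i u.
    apply: zero => z; rewrite /bad -iu sqd_self T_ge0 /= andbF andbT /=.
    by apply/negP => /orP[]/andP[h1 h2]; [exact: disj h1 h2|exact: disj h2 h1].
  have same b : (forall z, bad i u z = ~~ (sqd r (obs x z) i u <= T)) -> D b i -> D b u ->
      ebound Q (fun z => (bad i u z)%:R) (decay (t / 8) + decay 4^-1).
    move=> hb Di Du; apply: ebound_weaken (_ : decay (t / 8) <= _) _; first by rewrite lerDl.
    apply: ebound_le (same_tail iu Di Du) => [|z|z] //; first exact: measurable_natr.
    by rewrite hb.
  have cross b : (forall z, bad i u z = (sqd r (obs x z) i u <= T)) -> D b i -> D (~~ b) u ->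
      ebound Q (fun z => (bad i u z)%:R) (decay (t / 8) + decay 4^-1).
    move=> hb Di Du; apply: ebound_weaken (_ : decay 4^-1 <= _) _; first by rewrite lerDr.
    apply: ebound_le (cross_tail iu Di Du) => [|z|z] //; first exact: measurable_natr.
    by rewrite hb.
  case a1 : (D true i); case a2 : (D false i); try (by case: (disj a1 a2));
  case a3 : (D true u); case a4 : (D false u); try (by case: (disj a3 a4));
  rewrite ?a1 ?a2 ?a3 ?a4.
  - by apply: (same true) => // z; rewrite /bad a1 a2 a3 a4 /= orbF.
  - by apply: (cross true) => // z; rewrite /bad a1 a2 a3 a4.
  - by apply: zero => z; rewrite /bad a1 a2 a3 a4.
  - by apply: (cross false) => // z; rewrite /bad a1 a2 a3 a4.
  - by apply: (same false) => // z; rewrite /bad a1 a2 a3 a4 /= orbF.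
  - by apply: zero => z; rewrite /bad a1 a2 a3 a4.
  - by apply: zero => z; rewrite /bad a1 a2 a3 a4.
  - by apply: zero => z; rewrite /bad a1 a2 a3 a4.
  - by apply: zero => z; rewrite /bad a1 a2 a3 a4.
have mhas (f : V -> noise_space R V -> bool) : (forall u, measurable_fun setT (f u)) ->
    measurable_fun setT (fun z : noise_space R V => has (f^~ z) S).
  by move=> mf; elim: (S) => [|u U IH] /=; [exact: measurable_cst|exact: measurable_or].
rewrite -(size_pixels n).
apply: ebound_le (ebound_sum_cst (fun i _ => ebound_sum_cst (fun u _ => hbad i u))) => [|z|z] //.
  apply: measurable_natr; apply: (mhas (fun i z => has (fun u => bad i u z) S)) => i.
  by apply: (mhas (bad i)) => u; exact: mbad.
case h : (has _ _); last by do 2 (apply: sumr_ge0 => ? _).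
move/hasP : h => [i iS /hasP[u uS]]; rewrite -/(bad i u z) => biu.
rewrite (bigD1_seq i) ?pixels_uniq //= (bigD1_seq u) ?pixels_uniq //= biu.
by rewrite -addrA lerDl addr_ge0 // ?sumr_ge0 // => v _; apply: sumr_ge0.
Qed.

End misclassification.

(** * Geometry of horizon images *)

Lemma big_box (R : nmodType) r (F : V -> R) : \sum_(e <- box r) F e =
  \sum_(l <- iota 0 (2 * r).+1) \sum_(m <- iota 0 (2 * r).+1) F (l%:Z - r%:Z, m%:Z - r%:Z).
Proof. exact: big_allpairs_dep. Qed.

Lemma big_pixels (R : nmodType) n (F : V -> R) : \sum_(v <- pixels n) F v =
  \sum_(1 <= i < n.+1) \sum_(1 <= j < n.+1) F (i%:Z, j%:Z).
Proof. exact: big_allpairs_dep. Qed.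

Section staircase.
Context {R : realType}.

(** What is kept of a horizon image, in pixel units: [H] is the height at the left border of a
    column. Within a column the horizon varies by less than one pixel, which is the margin [1]; the
    margin [2] adds the height of the pixel, whose index marks its lower border. *)
Definition staircase (x : V -> R) (H : int -> R) : Prop :=
  [/\ forall a b : int, `|H a - H b| <= `|(a - b)%:~R|,
      forall v, 0 <= x v <= 1,
      forall v, v.2%:~R + 2 <= H v.1 -> x v = 1 &
      forall v, H v.1 + 1 <= v.2%:~R -> x v = 0].

Lemma size_int_interval (s : seq int) (lo : R) (L : nat) : uniq s ->
  (forall b, b \in s -> lo < b%:~R < lo + L%:R) -> (size s <= L)%N.
Proof.
move=> us hs; set c := Num.floor lo.
have hc : c%:~R <= lo < (c + 1)%:~R by exact: floor_itv.
have h b : b \in s -> 1 <= b - c <= L%:Z.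
  move=> /hs hb; have h1 : (c%:~R : R) < b%:~R by lra.
  have : (b%:~R : R) < (c + 1 + L%:Z)%:~R by rewrite intrD /=; lra.
  by move: h1; rewrite !ltr_int; lia.
rewrite -(size_iota 1 L) -(size_map (fun p : nat => p%:Z + c)).
apply: uniq_leq_size => // b /h hb; apply/mapP; exists `|b - c|%N; last by lia.
by rewrite mem_iota; lia.
Qed.

Lemma sum_int_interval (s : seq int) (f : int -> R) (lo : R) (L : nat) : uniq s ->
  (forall b, 0 <= f b <= 1) -> (forall b, ~~ (lo < b%:~R < lo + L%:R) -> f b = 0) ->
  \sum_(b <- s) f b <= L%:R.
Proof.
move=> us f01 f0.
apply: (@le_trans _ _ (\sum_(b <- s | lo < b%:~R < lo + L%:R) 1)).
  rewrite [leRHS]big_mkcond; apply: ler_sum => b _.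
  by case: ifPn => [_|/f0 ->//]; have /andP[] := f01 b.
rewrite -big_filter big_const_seq count_predT iter_addr_0 ler_nat.
apply: (@size_int_interval _ lo); first exact: filter_uniq.
by move=> b; rewrite mem_filter => /andP[].
Qed.

Variables (x : V -> R) (H : int -> R).
Hypothesis stair : staircase x H.

(** Outside the window both pixels lie on the same side: the height and the position vary by at most
    [k] each, which gives [2 * k] on either side, and the margins [2] and [1] add the [3]. *)
Lemma staircase_eq (a b c e : int) (k : nat) : (`|a - c| <= k)%N -> (`|b - e| <= k)%N ->
  ~~ (H a - 2 - 2 * k%:R < b%:~R < H a - 2 - 2 * k%:R + (4 * k + 3)%:R) ->
  x (a, b) = x (c, e).
Proof.
case: stair => HL _ x1 x0 ac be.
have hH : `|H a - H c| <= k%:R.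
  apply: (le_trans (HL _ _)); rewrite -intr_norm -[k%:R]/(k%:Z%:~R) ler_int.
  by move: ac; clear; lia.
have hb : `|b%:~R - e%:~R| <= (k%:R : R).
  rewrite -intrB -intr_norm -[k%:R]/(k%:Z%:~R) ler_int.
  by move: be; clear; lia.
have E : (4 * k + 3)%:R = 4 * k%:R + 3 :> R by rewrite natrD natrM.
have k0 : 0 <= (k%:R : R) by [].
move: hH hb; rewrite !ler_norml E => hH hb.
rewrite negb_and -!leNgt => /orP h.
case: h => h.
  by rewrite !x1 //=; lra.
by rewrite !x0 //=; lra.
Qed.

(** In each column at most [4 * k + 3] pixels change. The total is of order [r * k] and has to stay
    below [K * t / 8], which is why [k] is of order [r * t]. *)
Lemma staircase_shift (i d : V) (k r : nat) : d \in box k ->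
  \sum_(e <- box r | e != 0) (x (i + e) - x (i + d + e)) ^+ 2 <=
  ((2 * r).+1 * (4 * k + 3))%:R.
Proof.
rewrite mem_box => /andP[d1 d2]; have [_ x01 _ _] := stair.
apply: (@le_trans _ _ (\sum_(e <- box r) (x (i + e) - x (i + d + e)) ^+ 2)).
  by rewrite [leRHS](bigID (fun e => e != 0)) /= lerDl sumr_ge0 // => e _; exact: sqr_ge0.
rewrite big_box natrM.
have col a : \sum_(m <- iota 0 (2 * r).+1)
    (x (i + (a, m%:Z - r%:Z)) - x (i + d + (a, m%:Z - r%:Z))) ^+ 2 <= (4 * k + 3)%:R.
  have -> : \sum_(m <- iota 0 (2 * r).+1)
    (x (i + (a, m%:Z - r%:Z)) - x (i + d + (a, m%:Z - r%:Z))) ^+ 2 =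
    \sum_(b <- [seq i.2 + (m%:Z - r%:Z) | m <- iota 0 (2 * r).+1])
      (x (i.1 + a, b) - x (i.1 + d.1 + a, b + d.2)) ^+ 2.
    rewrite big_map; apply: eq_bigr => m _; congr ((x _ - x _) ^+ 2).
    by rewrite -[i.2 + _ + _]addrAC.
  apply: (sum_int_interval (lo := H (i.1 + a) - 2 - 2 * k%:R)).
  - by rewrite map_inj_uniq ?iota_uniq // => p q /= pq; lia.
  - move=> b; have := x01 (i.1 + a, b); have := x01 (i.1 + d.1 + a, b + d.2).
    move: (x _) (x _) => u v hu hv; rewrite sqr_ge0 /= -subr_ge0.
    have -> : 1 - (u - v) ^+ 2 = (1 - v + u) * (1 + v - u) by ring.
    by apply: mulr_ge0; lra.
  - move=> b hb; rewrite (staircase_eq (c := i.1 + d.1 + a) (e := b + d.2) _ _ hb).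
    + by rewrite subrr expr0n.
    + by move: d1; clear; lia.
    + by move: d2; clear; lia.
apply: le_trans (ler_sum _ (fun l _ => col (l%:Z - r%:Z))) _.
by rewrite big_const_seq count_predT size_iota iter_addr_0 mulr_natl.
Qed.

Variable r : nat.

(** One [r] for the vertical extent of the patch, one for the variation of [H] over its columns, and
    then the margin of [staircase]. *)
Definition deep (b : bool) : pred V := fun v =>
  if b then v.2%:~R + (2 * r + 2)%:R <= H v.1 else H v.1 + (2 * r + 1)%:R <= v.2%:~R.

Lemma deep_patch b i e : deep b i -> e \in box r -> x (i + e) = b%:R.
Proof.
rewrite mem_box => Di /andP[e1 e2]; case: stair => HL _ x1 x0.
have hH : `|H i.1 - H (i + e).1| <= r%:R.
  apply: (le_trans (HL _ _)); rewrite -intr_norm -[r%:R]/(r%:Z%:~R) ler_int /=.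
  by move: e1; clear; lia.
have hb : `|i.2%:~R - (i + e).2%:~R| <= (r%:R : R).
  rewrite -intrB -intr_norm -[r%:R]/(r%:Z%:~R) ler_int /=.
  by move: e2; clear; lia.
move: hH hb; rewrite !ler_norml => hH hb.
have r0 : 0 <= (r%:R : R) by [].
by case: b Di => /=; rewrite natrD natrM => Di; [apply: x1|apply: x0]; lra.
Qed.

Lemma size_edge n : (size [seq i <- pixels n | ~~ deep true i && ~~ deep false i])%:R <=
  (n * (4 * r + 3))%:R :> R.
Proof.
rewrite size_filter -sum1_count natr_sum big_mkcond /= big_pixels natrM.
have col (a : nat) : \sum_(j <- index_iota 1 n.+1)
   (if ~~ deep true (a%:Z, j%:Z) && ~~ deep false (a%:Z, j%:Z) then 1 else 0) <= (4 * r + 3)%:R :> R.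
  rewrite -(big_map (fun j : nat => j%:Z) predT
    (fun b => if ~~ deep true (a%:Z, b) && ~~ deep false (a%:Z, b) then 1 else 0)).
  apply: (sum_int_interval (lo := H a%:Z - (2 * r + 2)%:R)).
  - by rewrite map_inj_uniq ?iota_uniq // => p q [].
  - by move=> b; case: ifP; rewrite ?lexx ?ler01.
  - move=> b hb; case: ifP => // /andP[]; rewrite /deep /= -!ltNge => h1 h2.
    case/negP: hb; move: h1 h2.
    have E (c p : nat) : (c * r + p)%:R = c%:R * r%:R + p%:R :> R by rewrite natrD natrM.
    by rewrite !E => h1 h2; apply/andP; split; lra.
apply: le_trans (ler_sum _ (fun l _ => col l)) _.
by rewrite big_const_seq count_predT size_iota subSS subn0 iter_addr_0 mulr_natl.
Qed.

End staircase.

(** * Pixel averages of a Lipschitz horizon *)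

Section horizon_pixels.
Context {R : realType}.
Local Notation mu2 := ((@lebesgue_measure R) \x (@lebesgue_measure R))%E.
Variables (h : R -> R) (n : nat).
Hypothesis n_gt0 : (0 < n)%N.
Hypothesis h_lip : forall t t', `|h t - h t'| <= `|t - t'|.

Let n0 : 0 < n%:R :> R. Proof. by rewrite ltr0n. Qed.

Lemma measurable_lipschitz : measurable_fun setT h.
Proof.
apply: continuous_measurable_fun => t; apply/cvgrPdist_le => e e0.
near=> s; apply: (le_trans (h_lip _ _)); near: s.
by apply: cvgr_dist_le => //; exact: cvg_id.
Unshelve. all: by end_near. Qed.

Let measurable_horizon (A : set (R * R)) : measurable_fun A (fun t => (horizon h t)%:E).
Proof.
apply/measurable_EFinP; apply: (@measurable_funS _ _ _ _ setT) => //.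
rewrite /horizon; apply: measurable_fun_ifT => //.
apply: measurable_fun_ltr; first exact: measurable_snd.
exact: (measurableT_comp measurable_lipschitz measurable_fst).
Qed.

Let m_itv (i : int) : measurable (`[i%:~R / n%:R, (i + 1)%:~R / n%:R[%classic : set R).
Proof. exact: measurable_itv. Qed.

Let m_pixel i j : measurable (@pixel R n i j).
Proof. exact: measurableX. Qed.

Let mu_itv (i : int) : lebesgue_measure (`[i%:~R / n%:R, (i + 1)%:~R / n%:R[%classic : set R) = (n%:R^-1)%:E.
Proof.
rewrite lebesgue_measure_itv /= lte_fin ltr_pM2r ?invr_gt0 // ltr_int ltrDl ltr01.
by rewrite -EFinD -mulrBl -intrB addrAC subrr add0r mul1r.
Qed.

Let mu_pixel i j : mu2 (@pixel R n i j) = (n%:R^-1 * n%:R^-1)%:E.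
Proof.
rewrite /pixel product_measure1E //= EFinM.
by congr (_ * _)%E; exact: mu_itv.
Qed.

Let horizon01 t : 0 <= horizon h t <= 1.
Proof. by rewrite /horizon; case: ifP; rewrite ?lexx ?ler01. Qed.

Let a0 : 0 < n%:R^-1 * n%:R^-1 :> R. Proof. by rewrite mulr_gt0 // invr_gt0. Qed.

Let averageE i j (c : R) : (forall t, pixel n i j t -> horizon h t = c) ->
  pixel_average (horizon h) n i j = c.
Proof.
move=> hc; rewrite /pixel_average mu_pixel /Rintegral.
rewrite (eq_integral (cst c%:E)); last by move=> t /[!inE] /hc ->.
rewrite integral_cst; last exact: m_pixel.
by rewrite [X in fine (_ * X)%E]mu_pixel -EFinM /= mulrCA mulVf ?mulr1 // gt_eqF.
Qed.

Let average01 i j : 0 <= pixel_average (horizon h) n i j <= 1.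
Proof.
rewrite /pixel_average mu_pixel /Rintegral /=.
have I0 : (0 <= \int[mu2]_(t in pixel n i j) (horizon h t)%:E)%E.
  by apply: integral_ge0 => t _; rewrite lee_fin; have /andP[] := horizon01 t.
have I1 : (\int[mu2]_(t in pixel n i j) (horizon h t)%:E <= (n%:R^-1 * n%:R^-1)%:E)%E.
  apply: (@le_trans _ _ (\int[mu2]_(t in pixel n i j) (cst 1%E t))%E).
    apply: ge0_le_integral.
    - exact: m_pixel.
    - by move=> t _; rewrite lee_fin; have /andP[] := horizon01 t.
    - exact: measurable_horizon.
    - exact: measurable_cst.
    - by move=> t _; rewrite lee_fin; have /andP[] := horizon01 t.
  rewrite integral_cst; last exact: m_pixel.
  by rewrite mul1e [leLHS]mu_pixel.
rewrite mulr_ge0 ?fine_ge0 ?invr_ge0 ?(ltW a0) //= ler_pdivrMl // mulr1.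
rewrite -lee_fin fineK //; apply/fin_numP; split; apply/eqP => e; by rewrite e in I0 I1.
Qed.

Let near_column i j (t : R * R) : pixel n i j t ->
  `|h t.1 - h (i%:~R / n%:R)| < n%:R^-1 /\ j%:~R / n%:R <= t.2 < (j%:~R + 1) / n%:R.
Proof.
case=> /=; rewrite !in_itv /= !intrD => /andP[h1 h2] h3; split => //.
apply: (le_lt_trans (h_lip _ _)); rewrite ger0_norm ?subr_ge0 // ltrBlDl.
by apply: (lt_le_trans h2); rewrite mulrDl mul1r.
Qed.

Lemma staircase_horizon : staircase (fun v => pixel_average (horizon h) n v.1 v.2)
  (fun i => n%:R * h (i%:~R / n%:R)).
Proof.
split=> [a b|v|[i j]|[i j]] /=.
- rewrite -mulrBr normrM (ger0_norm (ltW n0)).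
  apply: (le_trans (ler_wpM2l (ltW n0) (h_lip _ _))).
  rewrite -mulrBl normrM [X in _ * (_ * X)]ger0_norm ?invr_ge0 ?(ltW n0) //.
  by rewrite mulrC divfK ?gt_eqF // intrB.
- exact: average01.
- move=> hij; apply: averageE => t /near_column[h1 /andP[_ h2]]; rewrite /horizon ifT //.
  apply: (lt_le_trans h2); move: h1; rewrite ltr_norml => /andP[h1 _].
  have : (j%:~R + 2) / n%:R <= h (i%:~R / n%:R) by rewrite ler_pdivrMr // mulrC.
  rewrite !mulrDl !mul1r; move: h1; move: (n%:R^-1) => e; lra.
- move=> hij; apply: averageE => t /near_column[h1 /andP[h2 _]]; rewrite /horizon ifF //.
  apply/negbTE; rewrite -leNgt; apply: le_trans h2; move: h1; rewrite ltr_norml => /andP[_ h1].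
  have : h (i%:~R / n%:R) + n%:R^-1 <= j%:~R / n%:R.
    by rewrite ler_pdivlMr // mulrDl mulVf ?gt_eqF // mulrC.
  move: h1; move: (n%:R^-1) => e; lra.
Qed.

End horizon_pixels.

Lemma holder1_lipschitz (R : realType) (h : R -> R) : holder 1 1 h ->
  forall t t', `|h t - h t'| <= `|t - t'|.
Proof.
case=> _ hl t t'; have := hl t t'; rewrite /holder_order eqxx /=.
by rewrite subr0 powRr1 // mul1r.
Qed.

(** * The estimator as an average over close patches *)

Section nlm_average.
Context {R : realType}.
Implicit Type y : pixel_array R.

Lemma neighborhood_distance2E r y i j q p : neighborhood_distance2 r y i j q p =
  (((2 * r).+1 ^ 2)%:R - 1)^-1 * sqd r (fun v => y v.1 v.2) (i, j) (q, p).
Proof.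
rewrite /neighborhood_distance2 addn1; congr (_ * _).
set F := fun e : V => `|y (i + e.1) (j + e.2) - y (q + e.1) (p + e.2)| ^+ 2.
have -> : sqd r (fun v => y v.1 v.2) (i, j) (q, p) = \sum_(e <- box r | e != 0) F e.
  by apply: eq_bigr => e _; rewrite /F real_normK ?num_real.
(* The subtracted term is the summand at the centre, which [sqd] omits. *)
have -> : `|y i j - y q p| ^+ 2 = F 0 by rewrite /F /= !addr0.
apply/eqP; rewrite subr_eq; apply/eqP.
transitivity (\sum_(e <- box r) F e).
  have E : iota 0 (2 * r).+1 = index_iota 0 (2 * r).+1 by rewrite /index_iota subn0.
  rewrite big_box exchange_big E !big_mkord.
  by apply: eq_bigr => m _; rewrite big_mkord.
by rewrite (bigD1_seq 0) ?box0 ?box_uniq //= addrC.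
Qed.

Lemma nlm_average (sigma t : R) (n r : nat) (x z : V -> R) y (i j : nat) : (0 < r)%N ->
  (forall v, y v.1 v.2 = obs x z v) ->
  nlm sigma n r t y i%:Z j%:Z =
  average_close x n r ((((2 * r).+1 ^ 2)%:R - 1) * (2 * sigma ^+ 2 + t)) (i%:Z, j%:Z) z.
Proof.
move=> r0 yE; have {}yE : (fun v => y v.1 v.2) = obs x z by apply/funext.
have K1 : 0 < ((2 * r).+1 ^ 2)%:R - 1 :> R.
  by rewrite subr_gt0 ltr1n; move: r0; case: r => // r _; rewrite expnS expn1; nia.
have w v : nlm_weight sigma r t y i%:Z j%:Z v.1 v.2 = (sqd r (obs x z) (i%:Z, j%:Z) v <=
    (((2 * r).+1 ^ 2)%:R - 1) * (2 * sigma ^+ 2 + t))%R%:R.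
  by rewrite /nlm_weight neighborhood_distance2E yE ler_pdivrMl //; case: v => a b; case: ifP.
rewrite /nlm /average_close /cnt !big_pixels.
congr (_ / _); apply: eq_bigr => a _; apply: eq_bigr => b _; rewrite -w //=.
by rewrite -yE.
Qed.

End nlm_average.

Section risk_bound.
Context {R : realType}.
Variable sigma : R.
Hypothesis sigma_gt0 : 0 < sigma.
Variables (n r k J : nat) (t B s : R).
Local Notation K := (((2 * r).+1 ^ 2)%:R : R).
Local Notation W := ((k.+1 ^ 2)%:R : R).
Local Notation q := (144 * B / (K * sigma ^+ 2)).
Local Notation decay rho := (expR (- (rho ^+ 2 * K / (16 * tail_cst sigma)))).
Local Notation rho1 := (Num.min (sigma ^+ 2 / 4) (3 / 4)).

(** The auxiliary [k], [J], [B] and [s] do not depend on the image, so the bound is uniform over the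
    class. The power [n ^+ 12] consists of [n ^+ 4] for the union bound over pairs of pixels and of
    the [n ^+ 8] in [pG_le]; it also covers [few_le]. *)
Definition admissible : Prop :=
  [/\ [/\ (2 * k < n)%N, (k <= r)%N & (0 < r)%N],
      [/\ 0 < t, t <= 2^-1 & ((2 * r).+1 * (4 * k + 3))%:R <= K * t / 8],
      [/\ 1 <= B, 18 * B <= K * t / 8 & tail_moment sigma B <= 2^-1],
      [/\ (0 < J)%N, K / W <= J%:R, tail_moment sigma B * J%:R <= 1 &
          B * (4 * K) * tail_moment sigma B <= 1] &
      [/\ [/\ 0 < s, s <= sigma ^+ 2 & s <= 3 / 4],
        J%:R * q <= 2^-1,
        K * (J%:R * q) * (2 * (J%:R * q) + s / sigma ^+ 2) <= 1,
        n%:R ^+ 12 * (decay (t / 8) + decay 4^-1) <= 1 &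
        2 * K / W * (decay s + (n ^ 2)%:R * decay rho1) <= 1]].

Hypothesis adm : admissible.

Let T : R := (K - 1) * (2 * sigma ^+ 2 + t).

Section law.
Variables (Q : probability (noise_space R V) R).
Hypothesis hQ : resamplable (normal_prob 0 sigma) Q.
Variables (x : V -> R) (H : int -> R).
Hypothesis stair : staircase x H.

Let few_le : (n ^ 2)%:R ^+ 2 * (W * decay (t / 8)) <= 1.
Proof.
case: adm => -[kn _ _] _ _ _ [_ _ _ h _].
apply: le_trans h; have n1 : 1 <= n%:R :> R by rewrite ler1n; case: (n) kn.
have Wn : W <= n%:R ^+ 2 by rewrite -natrX ler_nat leq_exp2r //; move: kn; clear; lia.
have e0 := expR_ge0 (- ((t / 8) ^+ 2 * K / (16 * tail_cst sigma))).
have e1 := expR_ge0 (- (4^-1 ^+ 2 * K / (16 * tail_cst sigma))).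
rewrite natrX -exprM mulrA; apply: ler_pM => //.
- apply: (@le_trans _ _ (n%:R ^+ 4 * n%:R ^+ 2)); first by rewrite ler_wpM2l // exprn_ge0.
  by rewrite -exprD ler_weXn2l.
- by rewrite lerDl.
Qed.

Lemma ebound_risk : ebound Q
  (fun z => \sum_(i <- pixels n) (x i - average_close x n r T i z) ^+ 2)
  (3 * error_cst sigma (pixel_cst sigma) * (n * (4 * r + 3))%:R).
Proof.
case: (adm) => -[kn kr r0] [t0 t1 tK] [B1 B2 B3] [J0 J1 J2 J3] [[s0 s1 s2] h1 h2 h3 h4].
have [_ x01 _ _] := stair.
have n0 : (0 < n)%N by case: (n) kn.
have K1 : 1 <= K by rewrite ler1n expn_gt0.
have T0 : 0 <= T by rewrite mulr_ge0 ?subr_ge0 // addr_ge0 ?(ltW t0) // mulr_ge0 // sqr_ge0.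
have xD b i : deep H r b i -> x i = b%:R.
  by move=> Di; rewrite -[i]addr0; apply: (deep_patch stair Di); exact: box0.
have E1 : 1 <= (n * (4 * r + 3))%:R :> R by rewrite ler1n muln_gt0 n0 addn3.
have noise i : i \in pixels n -> ebound Q (fun z =>
    (\sum_(v <- pixels n) (sqd r (obs x z) i v <= T)%R%:R * z v ^+ 2) /
    cnt x r i (pixels n) T z) (pixel_cst sigma).
  move=> iS; apply: (ebound_pixel_noise sigma_gt0 hQ (k := k) (J := J) (B := B) (s := s)) => //.
  + by move=> d db; apply: le_trans tK; exact: (staircase_shift stair).
  + by apply: (le_trans t1); lra.
have mis := ebound_misclassified sigma_gt0 hQ n x01 (deep_patch stair (r := r)) r0 t0 t1.
apply: (ebound_denoising_error sigma_gt0 hQ x01 xD n0 T0 E1 (size_edge _ _ _) noise mis).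
apply: le_trans h3; rewrite natrX; move: (expR _ + _) => a; rewrite le_eqVlt.
by apply/orP; left; apply/eqP; ring.
Qed.

End law.

Lemma risk_le d (U : measurableType d) (P : probability U R)
    (z : V -> {RV P >-> R}) (h : R -> R) :
  iid_gaussian sigma z -> holder 1 1 h ->
  (risk z n (horizon h) (nlm sigma n r t) <=
   (3 * error_cst sigma (pixel_cst sigma) * ((4 * r + 3)%:R / n%:R))%:E)%E.
Proof.
move=> [ind law] hh.
case: (adm) => -[kn _ r0] _ _ _ _.
have n0 : (0 < n)%N by case: (n) kn.
have n_gt0 : 0 < n%:R :> R by rewrite ltr0n.
have [Q hQ QE] := resamplable_law ind law.
have stair := staircase_horizon n0 (holder1_lipschitz hh).
set x := fun v : V => _ in stair.
have n2 : 0 <= (n%:R ^+ 2)^-1 :> R by rewrite invr_ge0 sqr_ge0.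
have [mF F0 Fle] := ebound_scale n2 (ebound_risk hQ stair).
rewrite /risk unlock; apply: (@le_trans _ _ (\int[Q]_w ((n%:R ^+ 2)^-1 *
   \sum_(i <- pixels n) (x i - average_close x n r T i w) ^+ 2)%:E)%E).
  rewrite le_eqVlt; apply/orP; left; apply/eqP.
  rewrite -(QE (fun w => ((n%:R ^+ 2)^-1 *
   \sum_(i <- pixels n) (x i - average_close x n r T i w) ^+ 2)%:E)).
  - apply: eq_integral => w _; congr (_ * _)%:E; rewrite big_pixels.
    apply: eq_bigr => i _; apply: eq_bigr => j _; congr ((_ - _) ^+ 2).
    by apply: nlm_average => // -[a b].
  - exact/measurable_EFinP.
  - by move=> w; rewrite lee_fin.
apply: (le_trans Fle); rewrite lee_fin le_eqVlt; apply/orP; left; apply/eqP.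
by rewrite natrM; field; rewrite gt_eqF.
Qed.

End risk_bound.

(** * Asymptotics of the parameters *)

Section parameters.
Context {R : realType}.
Variable sigma : R.
Hypothesis sigma_gt0 : 0 < sigma.
Local Notation v := (sigma ^+ 2).
Local Notation C0 := (tail_cst sigma).

(** [K / W] and [J] are at most [window_cst * tau ^+ 2], the [+ 1] paying for the rounding of [J];
    consequently [K * (J * q)] is at most [slack_cst * (tau ^+ 2 * P)]. *)
Definition window_cst : R := 2 ^+ 10 / v ^+ 2 + 1.
Definition slack_cst : R := 144 * window_cst / v.
Local Notation c0 := window_cst.
Local Notation c1 := slack_cst.
Local Notation rho1 := (Num.min (v / 4) (3 / 4)).
Local Notation ct := (64 * v + 4).

(* With P = (ln n)^(1/4) and tau = (ln n)^(epsilon/2), the paper's parameters are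
   r ~ 2 P^2 tau^2 and t = 2 sigma^2 / tau. *)
Variables (n r m : nat) (P tau : R).
Local Notation a := (P ^+ 2 * tau ^+ 2).
Local Notation M := ((2 * r).+1%:R : R).
Local Notation K := (((2 * r).+1 ^ 2)%:R : R).
Local Notation decay rho := (expR (- (rho ^+ 2 * K / (16 * tail_cst sigma)))).

Hypotheses (nE : n%:R = expR (P ^+ 4)) (r_near : `|r%:R - 2 * a| < 1) (tau_le : tau <= P ^+ m).
Hypotheses (P1 : 1 <= P) (tau1 : 1 <= tau).
Hypotheses (tau_v : 4 * v <= tau) (P_v : 8 <= P * v)
  (P_c0 : 32 * c0 / v <= P) (P_c1 : 64 * c1 * c0 / v <= P) (P_s : 1 <= 2 * c1 * P)
  (P_s' : v <= c1 * P).
Hypotheses (tau_t : 13 <= 9 * v ^+ 2 / (256 * C0) * tau) (tau_4 : 13 <= 9 / (256 * C0) * tau)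
  (tau_rho : 3 <= 9 * rho1 ^+ 2 / (16 * C0) * tau).
Hypotheses (exp_n : 7 * P ^+ (2 + 2 * m) * expR (- P) <= 1)
  (exp_half : 2 * ct * expR (- (P / (16 * v))) <= 1)
  (exp_J : c0 * ct * P ^+ (2 * m) * expR (- (P / (16 * v))) <= 1)
  (exp_K : 196 * ct * P ^+ (5 + 4 * m) * expR (- (P / (16 * v))) <= 1)
  (exp_s : 4 * c0 * P ^+ (2 * m) * expR (- (9 * v ^+ 2 / (64 * c1 ^+ 2 * C0) * P)) <= 1)
  (exp_rho : 4 * c0 * P ^+ (2 * m) * expR (- P) <= 1).

Let v0 : 0 < v. Proof. exact: exprn_gt0. Qed.
Let C0_gt0 : 0 < C0. Proof. exact: tail_cst_gt0. Qed.
Let c0_gt0 : 0 < c0.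
Proof. by apply: addr_gt0 => //; apply: divr_gt0; exact: exprn_gt0. Qed.
Let c1_gt0 : 0 < c1. Proof. by rewrite divr_gt0 // mulr_gt0. Qed.
Let P0 : 0 < P. Proof. exact: lt_le_trans P1. Qed.
Let tau0 : 0 < tau. Proof. exact: lt_le_trans tau1. Qed.
Let K0 : 0 < K. Proof. by rewrite ltr0n expn_gt0. Qed.
Let rho0 : 0 < rho1.
Proof. by rewrite lt_min; apply/andP; split; apply: divr_gt0. Qed.

Local Ltac pos := solve [try apply: ltW; repeat first [exact: v0 | exact: C0_gt0 | exact: c0_gt0 |
  exact: c1_gt0 | exact: P0 | exact: tau0 | exact: K0 | exact: rho0 | exact: ltr0Sn | exact: ltr01 |
  exact: ltr0n | apply: mulr_gt0 | apply: exprn_gt0 | rewrite invr_gt0]].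

Let a1 : 1 <= a. Proof. by rewrite mulr_ege1 // exprn_ege1. Qed.

Let M_bounds : 3 * a <= M <= 7 * a.
Proof.
have -> : M = 2 * r%:R + 1 by rewrite -natr1 natrM.
move: r_near a1; rewrite ltr_norml; move: (a) (r%:R : R) => b c; lra.
Qed.

Let M0 : 0 < M. Proof. by []. Qed.

Let KE : K = M ^+ 2. Proof. by rewrite natrX. Qed.

Let K_ge : 9 * (P ^+ 4 * tau ^+ 4) <= K.
Proof.
have -> : 9 * (P ^+ 4 * tau ^+ 4) = (3 * a) ^+ 2 by ring.
have /andP[h _] := M_bounds; rewrite KE lerXn2r ?nnegrE ?(ltW M0) //.
by rewrite mulr_ge0 // (le_trans _ a1).
Qed.

Let K_le : K <= 49 * (P ^+ 4 * tau ^+ 4).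
Proof.
have -> : 49 * (P ^+ 4 * tau ^+ 4) = (7 * a) ^+ 2 by ring.
have /andP[_ h] := M_bounds; rewrite KE lerXn2r ?nnegrE ?(ltW M0) //.
by rewrite mulr_ge0 // (le_trans _ a1).
Qed.

Let t := 2 * v / tau.
(** Solves [M * (4 * y) = K * t / 8], the cost allowed for a shift, as
    [4 * k + 3 <= 4 * k.+1 <= 4 * y]. *)
Let y := M * v / (16 * tau).
Let k := (Num.truncn y).-1.
Let J := (Num.truncn (2 ^+ 10 * tau ^+ 2 / v ^+ 2)).+1.
(** Makes [c1 * (tau ^+ 2 * P) * (s / v)] equal to [1 / 2]; the other half of [density_le] is left
    to the term quadratic in [J * q]. *)
Let s := v / (2 * c1 * (tau ^+ 2 * P)).
Local Notation W := ((k.+1 ^ 2)%:R : R).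

Let t0 : 0 < t. Proof. by rewrite divr_gt0 // mulr_gt0. Qed.

Let t_le : t <= 2^-1.
Proof. by rewrite ler_pdivrMr //; move: tau_v; move: (v) => w; lra. Qed.

Let y1 : 1 <= y.
Proof.
rewrite ler_pdivlMr ?mulr_gt0 // mul1r.
have /andP[h _] := M_bounds.
apply: (@le_trans _ _ (3 * a * v)); last by rewrite ler_pM2r.
have -> : 3 * a * v = 3 * tau * (P * tau * (P * v)) by ring.
rewrite [leRHS]mulrAC; apply: (@le_trans _ _ (3 * (1 * 8) * tau)).
  by have := tau0; lra.
rewrite ler_pM2r // ler_pM2l //; apply: ler_pM => //.
by rewrite mulr_ege1.
Qed.

Let kE : k.+1 = Num.truncn y.
Proof. by rewrite prednK // truncn_gt0. Qed.

Let k_le : k.+1%:R <= y.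
Proof. by rewrite kE truncn_le // (le_trans _ y1). Qed.

Let k_ge : y / 2 <= k.+1%:R.
Proof.
have := truncnS_gt y; rewrite -kE -natr1; have : 1 <= k.+1%:R :> R by rewrite ler1n.
move: (k.+1%:R : R) => b; lra.
Qed.

Let W0 : 0 < W. Proof. by rewrite ltr0n. Qed.

(** In spite of the rounding, [k.+1] is at least [y / 2], and [M / (y / 2) = 32 * tau / v]. *)
Let KW : K / W <= 2 ^+ 10 * tau ^+ 2 / v ^+ 2.
Proof.
rewrite ler_pdivrMr //.
have h : (y / 2) ^+ 2 <= W.
  rewrite natrX lerXn2r ?nnegrE //; first by rewrite divr_ge0 // (le_trans _ y1).
apply: (@le_trans _ _ (2 ^+ 10 * tau ^+ 2 / v ^+ 2 * (y / 2) ^+ 2)); last first.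
  by rewrite ler_wpM2l // divr_ge0 ?sqr_ge0 // mulr_ge0 ?sqr_ge0.
rewrite le_eqVlt; apply/orP; left; apply/eqP; rewrite KE /y.
by field; rewrite !gt_eqF.
Qed.

Let J_ge : K / W <= J%:R.
Proof.
by apply: (le_trans KW); apply: ltW; exact: truncnS_gt.
Qed.

Let tau_ge1 : 1 <= tau ^+ 2. Proof. exact: exprn_ege1. Qed.

Let KW_c0 : K / W <= c0 * tau ^+ 2.
Proof.
apply: (le_trans KW); rewrite mulrAC ler_wpM2r ?sqr_ge0 // lerDl //.
Qed.

Let J_le : J%:R <= c0 * tau ^+ 2.
Proof.
rewrite mulrDl mul1r /J -natr1 lerD // mulrAC truncn_le //.
by pos.
Qed.

Let rk : (k <= r)%N.
Proof.
have h : y <= M / 2.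
  rewrite ler_pdivrMr ?mulr_gt0 // -mulrA ler_pM2l //.
  by have := tau0; have := v0; move: tau_v; move: (v) => w; lra.
have : (k.+1%:R : R) <= M / 2 by exact: le_trans h.
rewrite ler_pdivlMr // -natrM ler_nat; clear; lia.
Qed.

Let kn : (2 * k < n)%N.
Proof.
apply: (@leq_ltn_trans (2 * r)); first by rewrite leq_mul2l rk orbT.
rewrite -(ltr_nat R) nE; apply: (@lt_le_trans _ _ M); first by rewrite ltr_nat.
have /andP[_ h] := M_bounds; apply: (le_trans h).
apply: (@le_trans _ _ (7 * P ^+ (2 + 2 * m))).
  rewrite exprD ler_pM2l // ler_pM2l ?exprn_gt0 // mulnC exprM.
  by rewrite lerXn2r ?nnegrE ?exprn_ge0 ?(ltW tau0) ?(ltW P0).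
apply: (@le_trans _ _ (expR P)); last by rewrite ler_expR -[leLHS]expr1 ler_weXn2l.
by move: exp_n; rewrite expRN ler_pdivrMr ?expR_gt0 // mul1r.
Qed.

Let r0 : (0 < r)%N.
Proof.
rewrite -(ltr_nat R); move: r_near a1; rewrite ltr_norml; move: (a) => b; lra.
Qed.

Let KtE : K * t / 8 = K * v / (4 * tau).
Proof. by rewrite /t; field; rewrite gt_eqF. Qed.

Let kK : ((2 * r).+1 * (4 * k + 3))%:R <= K * t / 8.
Proof.
rewrite KtE natrM KE.
have -> : M ^+ 2 * v / (4 * tau) = M * (4 * y) by rewrite /y; field; rewrite gt_eqF.
rewrite ler_pM2l //; apply: (@le_trans _ _ (4 * k.+1%:R)); last by rewrite ler_pM2l.
by rewrite -natrM ler_nat; clear; lia.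
Qed.

Let tau_pow j : tau ^+ j <= P ^+ (j * m).
Proof. by rewrite mulnC exprM lerXn2r ?nnegrE ?exprn_ge0 ?(ltW tau0) ?(ltW P0). Qed.

Let BK : 18 * P <= K * t / 8.
Proof.
rewrite KtE ler_pdivlMr ?mulr_gt0 //.
apply: (@le_trans _ _ (9 * (P ^+ 4 * tau ^+ 4) * v)); last by rewrite ler_pM2r.
have -> : 9 * (P ^+ 4 * tau ^+ 4) * v = 9 * (P * v) * (P ^+ 2 * tau ^+ 3) * (P * tau) by ring.
have -> : 18 * P * (4 * tau) = 72 * 1 * (P * tau) by ring.
rewrite ler_pM2r ?mulr_gt0 //; apply: ler_pM => //.
  by move: P_v; move: (P * v) => b; lra.
by rewrite mulr_ege1 // exprn_ege1.
Qed.

Let B3 : tail_moment sigma P <= 2^-1.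
Proof.
move: exp_half; rewrite /tail_moment -mulrA; move: (ct * _) => b; lra.
Qed.

Let J2 : tail_moment sigma P * J%:R <= 1.
Proof.
apply: le_trans exp_J; rewrite /tail_moment.
have -> : c0 * ct * P ^+ (2 * m) * expR (- (P / (16 * v))) =
  ct * expR (- (P / (16 * v))) * (c0 * P ^+ (2 * m)) by ring.
have e0 := expR_ge0 (- (P / (16 * v))).
rewrite ler_wpM2l //; first by rewrite mulr_ge0 // addr_ge0 // mulr_ge0 // ltW.
by apply: (le_trans J_le); rewrite ler_pM2l.
Qed.

Let J3 : P * (4 * K) * tail_moment sigma P <= 1.
Proof.
apply: le_trans exp_K; rewrite /tail_moment.
have -> : 196 * ct * P ^+ (5 + 4 * m) * expR (- (P / (16 * v))) =
  196 * P ^+ (5 + 4 * m) * (ct * expR (- (P / (16 * v)))) by ring.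
have e0 := expR_ge0 (- (P / (16 * v))).
rewrite ler_wpM2r //; first by rewrite mulr_ge0 // addr_ge0 // mulr_ge0 // ltW.
apply: (@le_trans _ _ (P * (4 * (49 * (P ^+ 4 * tau ^+ 4))))).
  by rewrite ler_pM2l // ler_pM2l.
have -> : P * (4 * (49 * (P ^+ 4 * tau ^+ 4))) = 196 * (P ^+ 5 * tau ^+ 4) by ring.
by rewrite ler_pM2l // exprD ler_pM2l ?exprn_gt0.
Qed.

Let q : R := 144 * P / (K * v).

Let Jq_le : J%:R * q <= 16 * c0 / v / (P ^+ 3 * tau ^+ 2).
Proof.
have q0 : 0 <= q by rewrite /q; pos.
apply: (@le_trans _ _ (c0 * tau ^+ 2 * q)); first by rewrite ler_wpM2r.
rewrite ler_pdivlMr ?mulr_gt0 ?exprn_gt0 //.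
have -> : c0 * tau ^+ 2 * q * (P ^+ 3 * tau ^+ 2) =
  16 * c0 / v * (9 * (P ^+ 4 * tau ^+ 4) / K).
  by rewrite /q; field; rewrite !gt_eqF.
rewrite -[leRHS]mulr1 ler_wpM2l //; last by rewrite ler_pdivrMr // mul1r.
by pos.
Qed.

Let P3 : P ^+ 2 <= P ^+ 3 * tau ^+ 2.
Proof.
by rewrite [P ^+ 3]exprSr -mulrA ler_peMr ?sqr_ge0 // mulr_ege1.
Qed.

Let Jq_half : J%:R * q <= 2^-1.
Proof.
apply: (le_trans Jq_le); rewrite ler_pdivrMr ?mulr_gt0 ?exprn_gt0 //.
have h : P <= P ^+ 3 * tau ^+ 2.
  by apply: le_trans P3; rewrite expr2 ler_peMr // ltW.
have : 16 * c0 / v * 2 <= P by rewrite mulrAC [_ * 2]mulrAC; apply: le_trans P_c0; rewrite -natrM.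
move: h; move: (P ^+ 3 * _) (16 * c0 / v) => b c; lra.
Qed.

Let density_le : K * (J%:R * q) * (2 * (J%:R * q) + s / v) <= 1.
Proof.
have Jq0 : 0 <= J%:R * q by apply: mulr_ge0 => //; rewrite /q; pos.
have KJq : K * (J%:R * q) <= c1 * (tau ^+ 2 * P).
  have -> : K * (J%:R * q) = J%:R * (144 * P / v) by rewrite /q; field; rewrite !gt_eqF.
  have -> : c1 * (tau ^+ 2 * P) = c0 * tau ^+ 2 * (144 * P / v).
    by rewrite /slack_cst; field; rewrite gt_eqF.
  by rewrite ler_wpM2r //; pos.
have tP0 : 0 < tau ^+ 2 * P by rewrite mulr_gt0 // exprn_gt0.
have sE : s / v = (2 * (c1 * (tau ^+ 2 * P)))^-1.
  by rewrite /s; field; rewrite !gt_eqF.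
have s0 : 0 <= s / v by rewrite sE; pos.
apply: (@le_trans _ _ (c1 * (tau ^+ 2 * P) * (2 * (16 * c0 / v / (P ^+ 3 * tau ^+ 2)) + s / v))).
  apply: ler_pM => //.
  - by rewrite mulr_ge0 // ltW.
  - by rewrite addr_ge0 // mulr_ge0.
  - by rewrite lerD2r ler_pM2l.
rewrite mulrDr sE.
have -> : c1 * (tau ^+ 2 * P) * (2 * (c1 * (tau ^+ 2 * P)))^-1 = 2^-1.
  by field; rewrite !gt_eqF.
have -> : c1 * (tau ^+ 2 * P) * (2 * (16 * c0 / v / (P ^+ 3 * tau ^+ 2))) =
  64 * c1 * c0 / v / (2 * P ^+ 2) by field; rewrite !gt_eqF.
have : 64 * c1 * c0 / v / (2 * P ^+ 2) <= 2^-1.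
  rewrite ler_pdivrMr; last pos.
  rewrite [2^-1 * _]mulrA mulVf ?mul1r //.
  by apply: (le_trans P_c1); rewrite expr2 ler_peMr // ltW.
move: (_ / (2 * P ^+ 2)) => b; lra.
Qed.

Let tP : P <= tau ^+ 2 * P. Proof. by rewrite ler_peMl // ltW. Qed.

Let s0 : 0 < s.
Proof. by rewrite /s; pos. Qed.

Let s_le : s <= v.
Proof.
rewrite /s ler_pdivrMr; last pos.
rewrite ler_peMr ?(ltW v0) //.
by apply: (le_trans P_s); rewrite ler_pM2l // mulr_gt0.
Qed.

Let s_le1 : s <= 3 / 4.
Proof.
rewrite /s ler_pdivrMr; last pos.
apply: (le_trans P_s'); apply: (@le_trans _ _ (c1 * (tau ^+ 2 * P))).
  by rewrite ler_pM2l.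
have : 0 <= c1 * (tau ^+ 2 * P) by pos.
have -> : 3 / 4 * (2 * c1 * (tau ^+ 2 * P)) = 3 / 2 * (c1 * (tau ^+ 2 * P)) by field.
move: (c1 * _) => b; lra.
Qed.

(** As [n = expR (P ^+ 4)], an exponent [b * P ^+ 4] with [b >= j + 1] absorbs [n ^+ j] and still
    leaves [expR (- P ^+ 4) <= expR (- P)]. *)
Let decay_le (rho b : R) (j : nat) : b * P ^+ 4 <= rho ^+ 2 * K / (16 * C0) ->
  (j.+1)%:R <= b -> n%:R ^+ j * decay rho <= expR (- P).
Proof.
move=> h jb; rewrite nE -expRM_natl -expRD ler_expR.
have P4 : P <= P ^+ 4 by rewrite -[leLHS]expr1 ler_weXn2l.
have P40 : 0 <= P ^+ 4 by rewrite exprn_ge0 // ltW.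
have : j.+1%:R * P ^+ 4 <= b * P ^+ 4 by rewrite ler_wpM2r.
rewrite -natr1 mulrDl mul1r; move: h P4.
move: (rho ^+ 2 * K / _) (P ^+ 4) (j%:R * P ^+ 4) (b * P ^+ 4) => c d e f; lra.
Qed.

Let eP : expR (- P) <= 2^-1.
Proof.
rewrite expRN lef_pV2 ?posrE ?expR_gt0 //.
by have := expR_ge1Dx P; have := P1; lra.
Qed.

Let KC (rho : R) : rho ^+ 2 * (9 * (P ^+ 4 * tau ^+ 4)) / (16 * C0) <= rho ^+ 2 * K / (16 * C0).
Proof. by rewrite ler_pM2r ?invr_gt0 ?mulr_gt0 // ler_wpM2l ?sqr_ge0. Qed.

Let tau_sq (b c : R) : 0 <= c -> b <= c * tau -> b <= c * tau ^+ 2.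
Proof.
move=> c0' h; apply: (le_trans h).
by rewrite ler_wpM2l // expr2 ler_peMr // (ltW tau0).
Qed.

Let tau_4th (b c : R) : 0 <= c -> b <= c * tau -> b <= c * tau ^+ 4.
Proof.
move=> c0' h; apply: (le_trans h); rewrite ler_wpM2l // -[leLHS]expr1 ler_weXn2l //.
Qed.

(** [t ^+ 2 * K] is of order [P ^+ 4 * tau ^+ 2]. The spare [tau ^+ 2] tends to infinity and so
    outgrows any fixed power of [n], here the twelfth plus one. *)
Let rare : n%:R ^+ 12 * (decay (t / 8) + decay 4^-1) <= 1.
Proof.
rewrite mulrDr.
have h1 : n%:R ^+ 12 * decay (t / 8) <= expR (- P).
  apply: (decay_le (b := 9 * v ^+ 2 / (256 * C0) * tau ^+ 2)).
    apply: le_trans (KC _); rewrite le_eqVlt; apply/orP; left; apply/eqP.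
    by rewrite /t; field; rewrite !gt_eqF.
  by apply: tau_sq tau_t; pos.
have h2 : n%:R ^+ 12 * decay 4^-1 <= expR (- P).
  apply: (decay_le (b := 9 / (256 * C0) * tau ^+ 4)).
    apply: le_trans (KC _); rewrite le_eqVlt; apply/orP; left; apply/eqP.
    by field; rewrite !gt_eqF.
  by apply: tau_4th tau_4; pos.
by have := eP; move: h1 h2; move: (_ * decay _) (_ * decay _) (expR (- P)) => b c e; lra.
Qed.

(** The deviation [s] is so small that [s ^+ 2 * K] is only of order [P ^+ 2], too little against a
    power of [n]. But the norm concerns a single patch, so only the factor [K / W] has to be beaten.
    The slopes, taken over all pixels, have the constant deviation [rho1]. *)
Let irregular_rare : 2 * K / W * (decay s + (n ^ 2)%:R * decay rho1) <= 1.
Proof.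
have h1 : decay s <= expR (- (9 * v ^+ 2 / (64 * c1 ^+ 2 * C0) * P)).
  rewrite ler_expR lerN2; apply: le_trans (KC _).
  have -> : s ^+ 2 * (9 * (P ^+ 4 * tau ^+ 4)) / (16 * C0) =
    9 * v ^+ 2 / (64 * c1 ^+ 2 * C0) * P ^+ 2.
    by rewrite /s; field; rewrite !gt_eqF.
  rewrite ler_wpM2l ?expr2 ?ler_peMr ?(ltW P0) //.
  by pos.
have h2 : (n ^ 2)%:R * decay rho1 <= expR (- P).
  rewrite natrX; apply: (decay_le (b := 9 * rho1 ^+ 2 / (16 * C0) * tau ^+ 4)).
    apply: le_trans (KC _); rewrite le_eqVlt; apply/orP; left; apply/eqP.
    by field; rewrite !gt_eqF.
  by apply: tau_4th tau_rho; pos.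
have h3 : K / W <= c0 * P ^+ (2 * m).
  by apply: (le_trans KW_c0); rewrite ler_pM2l.
have kw0 : 0 <= K / W by rewrite divr_ge0 // ltW.
have d0 := expR_ge0 (- (s ^+ 2 * K / (16 * C0))).
have d1 : 0 <= (n ^ 2)%:R * decay rho1 by rewrite mulr_ge0 ?expR_ge0.
have g1 : K / W * decay s <= 4^-1.
  apply: (@le_trans _ _ (c0 * P ^+ (2 * m) * expR (- (9 * v ^+ 2 / (64 * c1 ^+ 2 * C0) * P)))).
    exact: ler_pM.
  move: exp_s; rewrite -!mulrA; move: (c0 * _) => b; lra.
have g2 : K / W * ((n ^ 2)%:R * decay rho1) <= 4^-1.
  apply: (@le_trans _ _ (c0 * P ^+ (2 * m) * expR (- P))); first exact: ler_pM.
  move: exp_rho; rewrite -!mulrA; move: (c0 * _) => b; lra.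
have -> : 2 * K / W * (decay s + (n ^ 2)%:R * decay rho1) =
  2 * (K / W * decay s + K / W * ((n ^ 2)%:R * decay rho1)) by ring.
move: g1 g2; move: (_ * decay s) (_ * (_ * decay rho1)) => b c; lra.
Qed.

Lemma admissible_parameters :
  exists k J B s, admissible sigma n r k J (2 * sigma ^+ 2 / tau) B s.
Proof.
exists k, J, P, s; split.
- by split.
- by split.
- by split.
- by split.
- split=> //.
Qed.

End parameters.

Section asymptotics.
Context {R : realType}.

Lemma near_ge_linear (c d : R) : 0 < d -> \forall x \near +oo, c <= d * x.
Proof.
move=> d0; near=> x; rewrite mulrC -ler_pdivrMr //; near: x.
Unshelve. all: by end_near. Qed.

(** [expR (c * x)] is the power with exponent [N.+1] of [expR (c * x / N.+1)], which is at least
    [c * x / N.+1]; one power of [x] is left over to beat [A]. *)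
Lemma near_expR_decay (A c : R) (N : nat) : 0 < c ->
  \forall x \near +oo, A * x ^+ N * expR (- (c * x)) <= 1.
Proof.
move=> c0; have N0 : 0 < N.+1%:R :> R by [].
set d := (c / N.+1%:R) ^+ N.+1; have d0 : 0 < d by rewrite exprn_gt0 // divr_gt0.
near=> x.
have x0 : 0 < x by near: x; apply: nbhs_pinfty_gt; rewrite num_real.
have Ax : A <= d * x by near: x; exact: near_ge_linear.
rewrite expRN ler_pdivrMr ?expR_gt0 // mul1r.
have -> : expR (c * x) = expR (c * x / N.+1%:R) ^+ N.+1.
  by rewrite -expRM_natl [_%:R * _]mulrC divfK ?gt_eqF.
have h : c * x / N.+1%:R <= expR (c * x / N.+1%:R).
  by have := expR_ge1Dx (c * x / N.+1%:R); move: (c * x / _) => b; lra.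
apply: (@le_trans _ _ ((c * x / N.+1%:R) ^+ N.+1)); last first.
  rewrite lerXn2r // nnegrE ?expR_ge0 // divr_ge0 // mulr_ge0 // ltW //.
rewrite mulrAC exprMn -/d exprSr mulrA mulrAC.
by rewrite ler_pM2r // exprn_gt0.
Unshelve. all: by end_near. Qed.

(** [P] and [tau] are only asked to be large separately; the exponent [m] bounds powers of [tau] by
    powers of [P], so that exponentials in [- P] beat all the polylogarithmic factors. *)
Lemma near_admissible (sigma : R) (m : nat) : 0 < sigma ->
  exists P0 : R, forall (n r : nat) (P tau : R), n%:R = expR (P ^+ 4) ->
    `|r%:R - 2 * (P ^+ 2 * tau ^+ 2)| < 1 -> tau <= P ^+ m -> P0 <= P -> P0 <= tau ->
    1 <= P /\ 1 <= tau /\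
    exists k J B s, admissible sigma n r k J (2 * sigma ^+ 2 / tau) B s.
Proof.
move=> s0; have v0 : 0 < sigma ^+ 2 by exact: exprn_gt0.
have C0 := tail_cst_gt0 s0.
have c0 : 0 < window_cst sigma.
  by apply: addr_gt0 => //; apply: divr_gt0; exact: exprn_gt0.
have c1 : 0 < slack_cst sigma by apply: divr_gt0 => //; exact: mulr_gt0.
have rho0 : 0 < Num.min (sigma ^+ 2 / 4) (3 / 4).
  by rewrite lt_min; apply/andP; split; apply: divr_gt0.
have pos16 : 0 < 16 * tail_cst sigma by exact: mulr_gt0.
have pos256 : 0 < 256 * tail_cst sigma by exact: mulr_gt0.
have d1 : 0 < 9 * sigma ^+ 2 ^+ 2 / (256 * tail_cst sigma).
  by apply: divr_gt0 => //; apply: mulr_gt0 => //; exact: exprn_gt0.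
have d2 : 0 < 9 / (256 * tail_cst sigma) by exact: divr_gt0.
have d3 : 0 < 9 * Num.min (sigma ^+ 2 / 4) (3 / 4) ^+ 2 / (16 * tail_cst sigma).
  by apply: divr_gt0 => //; apply: mulr_gt0 => //; exact: exprn_gt0.
have d4 : 0 < 9 * sigma ^+ 2 ^+ 2 / (64 * slack_cst sigma ^+ 2 * tail_cst sigma).
  apply: divr_gt0; apply: mulr_gt0 => //; first exact: exprn_gt0.
  by apply: mulr_gt0 => //; exact: exprn_gt0.
have d5 : 0 < (16 * sigma ^+ 2)^-1 by rewrite invr_gt0 mulr_gt0.
have d6 : 0 < 2 * slack_cst sigma by exact: mulr_gt0.
(* One list of conditions on a single variable, applied at [x = P] and at [x = tau]. *)
have [M [_ hM]] : \forall x \near +oo,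
  [/\ 1 <= x, 4 * sigma ^+ 2 <= x & 8 <= sigma ^+ 2 * x] /\
   [/\ 32 * window_cst sigma / sigma ^+ 2 <= x,
      64 * slack_cst sigma * window_cst sigma / sigma ^+ 2 <= x,
      1 <= 2 * slack_cst sigma * x & sigma ^+ 2 <= slack_cst sigma * x] /\
   [/\ 13 <= 9 * sigma ^+ 2 ^+ 2 / (256 * tail_cst sigma) * x,
      13 <= 9 / (256 * tail_cst sigma) * x &
      3 <= 9 * Num.min (sigma ^+ 2 / 4) (3 / 4) ^+ 2 / (16 * tail_cst sigma) * x] /\
   [/\ 7 * x ^+ (2 + 2 * m) * expR (- (1 * x)) <= 1,
      2 * (64 * sigma ^+ 2 + 4) * x ^+ 0 * expR (- ((16 * sigma ^+ 2)^-1 * x)) <= 1,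
      window_cst sigma * (64 * sigma ^+ 2 + 4) * x ^+ (2 * m) * expR (- ((16 * sigma ^+ 2)^-1 * x)) <= 1 &
      196 * (64 * sigma ^+ 2 + 4) * x ^+ (5 + 4 * m) * expR (- ((16 * sigma ^+ 2)^-1 * x)) <= 1] /\
   [/\ 4 * window_cst sigma * x ^+ (2 * m) *
        expR (- (9 * sigma ^+ 2 ^+ 2 / (64 * slack_cst sigma ^+ 2 * tail_cst sigma) * x)) <= 1 &
      4 * window_cst sigma * x ^+ (2 * m) * expR (- (1 * x)) <= 1].
  near=> x; do 4 (split; first (split; near: x; solve [exact: near_ge_linear | exact: near_expR_decay
    | by apply: nbhs_pinfty_ge; rewrite num_real])).
  by split; near: x; exact: near_expR_decay.
exists (M + 1) => n r P tau nE rE tP hP ht.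
have MP : M < P by lra.
have Mt : M < tau by lra.
have [[P1 _ P_v] [[Pc0 Pc1 Ps Ps'] [_ [[e1 e2 e3 e4] [e5 e6]]]]] := hM _ MP.
have [[t1 tv _] [_ [[tt t4 tr] _]]] := hM _ Mt.
split => //; split => //; apply: (@admissible_parameters R sigma s0 n r m P tau) => //.
- by rewrite mulrC.
- by move: e1; rewrite mul1r.
- by move: e2; rewrite mulr1 mulrC [P / _]mulrC [_ * (2 * _)]mulrC.
- by move: e3; rewrite [P / _]mulrC.
- by move: e4; rewrite [P / _]mulrC.
- by move: e6; rewrite mul1r.
Unshelve. all: by end_near. Qed.

End asymptotics.

Lemma near_admissible_ln (R : realType) (sigma epsilon : R) (delta : nat -> nat) :
  0 < sigma -> 0 < epsilon ->
  (forall n, is_rounding (2 * ln (n%:R : R) `^ (2^-1 + epsilon)) (delta n)) ->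
  exists n0 : nat, forall n : nat, (n0 < n)%N ->
    1 <= ln (n%:R : R) `^ (2^-1 + epsilon) /\
    exists k J B s, admissible sigma n (delta n) k J
      (2 * sigma ^+ 2 / (ln (n%:R : R) `^ (epsilon / 2))) B s.
Proof.
(* [tau <= P ^+ m] amounts to [epsilon / 2 <= m / 4]. *)
move=> s0 e0 dE; set m := (Num.truncn (2 * epsilon)).+1.
have em : epsilon / 2 <= 4^-1 * m%:R.
  have : 2 * epsilon < m%:R by exact: truncnS_gt.
  lra.
have [P0 hP0] := near_admissible m s0.
pose b := Num.max P0 1.
(* Beyond [L0] the logarithm is at least [1], and its powers with exponents [4^-1] and [epsilon / 2]
   are at least [P0]. Replacing [P0] by the nonnegative [b] allows real powers to be inverted. *)
pose L0 := Num.max 1 (Num.max (b `^ (4^-1)^-1) (b `^ (epsilon / 2)^-1)).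
have b0 : 0 <= b by rewrite le_max ler01 orbT.
exists (Num.truncn (expR L0)) => n hn.
have n_gt : expR L0 <= n%:R.
  apply: ltW; apply: lt_le_trans (truncnS_gt _) _; by rewrite ler_nat.
have n_gt0 : 0 < n%:R :> R by apply: lt_le_trans n_gt; exact: expR_gt0.
set L := ln (n%:R : R).
have hL : L0 <= L by rewrite /L -(expRK L0) ler_ln ?posrE ?expR_gt0.
have L1 : 1 <= L by apply: le_trans hL; rewrite le_max lexx.
have Lgt0 : 0 < L by apply: lt_le_trans L1.
have pow (p : R) : 0 < p -> b `^ p^-1 <= L -> P0 <= L `^ p.
  move=> p0 h; apply: (@le_trans _ _ b); first by rewrite le_max lexx.
  have -> : b = (b `^ p^-1) `^ p by rewrite -powRrM mulVf ?powRr1 // gt_eqF.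
  by apply: ge0_ler_powR => //; rewrite ?nnegrE ?powR_ge0 // ltW.
have P4 : (L `^ 4^-1) ^+ 4 = L.
  by rewrite -powR_mulrn ?powR_ge0 // -powRrM mulVf // powRr1 // ltW.
have aE : (L `^ 4^-1) ^+ 2 * (L `^ (epsilon / 2)) ^+ 2 = L `^ (2^-1 + epsilon).
  rewrite -!powR_mulrn ?powR_ge0 // -!powRrM -powRD; last by rewrite (gt_eqF Lgt0) implybT.
  by congr (_ `^ _); field.
have nE : n%:R = expR ((L `^ 4^-1) ^+ 4) by rewrite P4 lnK // posrE.
have rE : `|(delta n)%:R - 2 * ((L `^ 4^-1) ^+ 2 * (L `^ (epsilon / 2)) ^+ 2)| < 1.
  by rewrite aE; exact: dE.
have tauP : L `^ (epsilon / 2) <= (L `^ 4^-1) ^+ m.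
  by rewrite -powR_mulrn ?powR_ge0 // -powRrM ler_powR.
have hP : P0 <= L `^ 4^-1.
  by apply: pow => //; apply: le_trans hL; rewrite !le_max lexx ?orbT.
have htau : P0 <= L `^ (epsilon / 2).
  by apply: pow; [rewrite divr_gt0|apply: le_trans hL; rewrite !le_max lexx ?orbT].
have [P1 [t1 adm]] := hP0 _ _ _ _ nE rE tauP hP htau.
by split=> //; rewrite -aE mulr_ege1 // exprn_ege1.
Qed.

Lemma holder_cst0 (R : realType) (alpha C : R) : 0 <= C -> holder alpha C (cst 0).
Proof.
move=> C0; have d0 j : derive1n j (cst 0 : R -> R) = cst 0.
  by elim: j => [|j IH] //; rewrite derive1nS IH; apply/funext => t; exact: derive1_cst.
split=> [j t _|t t']; rewrite d0; first exact: derivable_cst.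
by rewrite subrr normr0 mulr_ge0 ?powR_ge0.
Qed.

Lemma risk_ge0 (R : realType) d (T : measurableType d) (P : probability T R)
    (z : int * int -> {RV P >-> R}) n f fhat : (0 <= risk z n f fhat)%E.
Proof.
rewrite /risk unlock; apply: integral_ge0 => w _; rewrite lee_fin.
by rewrite mulr_ge0 ?invr_ge0 ?sqr_ge0 // !sumr_ge0 // => i _; rewrite sumr_ge0 // => j _; exact: sqr_ge0.
Qed.

Theorem theorem4 (R : realType) (alpha C sigma epsilon : R)
  (alpha_gt0 : 0 < alpha) (C_gt0 : 0 < C) (sigma_gt0 : 0 < sigma)
  (epsilon_gt0 : 0 < epsilon)
  (d : measure_display) (T : measurableType d) (P : probability T R)
  (z : nat -> int * int -> {RV P >-> R})
  (z_iid : forall n : nat, iid_gaussian sigma (z n))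
  (delta : nat -> nat)
  (deltaE : forall n : nat,
     is_rounding (2 * ln (n%:R : R) `^ (2^-1 + epsilon)) (delta n))
  (t : nat -> R)
  (tE : forall n : nat,
     t n = 2 * sigma ^+ 2 / (ln (n%:R : R) `^ (epsilon / 2))) :
  bigO_seq
    (fun n : nat => ereal_sup
       [set risk (z n) n f (nlm sigma n (delta n) (t n))
         | f in horizon_class alpha C])
    (fun n : nat => ln (n%:R : R) `^ (2^-1 + epsilon) / n%:R).
Proof.
have [n0 hn0] := near_admissible_ln sigma_gt0 epsilon_gt0 deltaE.
pose c : R := 3 * error_cst sigma (pixel_cst sigma).
have c_ge0 : 0 <= c.
  have s4 : 0 <= sigma ^+ 4 by exact: exprn_even_ge0.
  have := expR_ge0 (sigma ^+ 2); have := sqr_ge0 sigma.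
  rewrite /c /error_cst /pixel_cst; move: (expR (sigma ^+ 2)) => e.
  by move: s4; move: (sigma ^+ 4) (sigma ^+ 2) => u v; lra.
(* With [a >= 1], rounding gives [4 * delta n + 3 <= 4 * (2 * a + 1) + 3 <= 15 * a]. *)
exists (c * 15), n0 => n hn.
have [a1 [k [J [B [s adm]]]]] := hn0 n hn.
set a := ln (n%:R : R) `^ (2^-1 + epsilon) in a1 *.
have n_gt0 : 0 < n%:R :> R by rewrite ltr0n; case: (n) hn.
have an0 : 0 <= a / n%:R by rewrite divr_ge0 // ltW // (lt_le_trans _ a1).
(* Removing the absolute value requires a member of the class, here the flat horizon, as the
   supremum of an empty family would be [-oo]. *)
rewrite (ger0_norm an0) gee0_abs; last first.
  apply: (@le_trans _ _ (risk (z n) n (horizon (cst 0)) (nlm sigma n (delta n) (t n)))).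
    exact: risk_ge0.
  apply: ereal_sup_ubound; exists (horizon (cst 0)) => //; exists (cst 0) => //.
  by split; apply: holder_cst0 => //; exact: ltW.
apply: ge_ereal_sup => _ [_ [h [_ h1] <-] <-]; rewrite tE.
apply: (le_trans (risk_le sigma_gt0 adm (z_iid n) h1)); rewrite lee_fin -/c.
rewrite -[leRHS]mulrA ler_wpM2l // mulrA ler_pM2r ?invr_gt0 //.
have := deltaE n; rewrite /is_rounding -/a ltr_norml natrD natrM => /andP[_].
by lra.
Qed.
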